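(* Let $I=(1\le i_1\le\cdots\le i_r\le n)$ be an ordered multiset of $[n]$ and fix a partition $\lambda=(\lambda_1,\dots,\lambda_l)$ of $r$. Then in $A_q(\mathrm{Mat}_n)$ $$\mathrm{Imm}_{\psi_q^{\lambda}}(X_I)=\sum_{(I_1,\dots,I_l)}{\det}_q(X_{I_1})\cdots{\det}_q(X_{I_l}),$$ $$\mathrm{Imm}_{\phi_q^{\lambda}}(X_I)=\sum_{(I_1,\dots,I_l)}\frac{m_{q^2}(I)}{m_{q^2}(I_1)\cdots m_{q^2}(I_l)}\,\mathrm{per}_q(X_{I_1})\cdots\mathrm{per}_q(X_{I_l}),$$ where the sums are taken over all sequences $(I_1,\dots,I_l)$ of non-decreasing ordered multisets of $[n]$ satisfying $|I_j|=\lambda_j$ and such that the disjoint union (as multisets) of $I_1,\dots,I_l$ is $I$.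
   Context: Let $q\in\mathbb{C}^\times$ be not a root of unity; $[n]=\{1,\dots,n\}$; $(k)_q=\frac{q^k-1}{q-1}$, $(k)_q!=(1)_q\cdots(k)_q$. Hecke algebra: $\mathcal H_m$ is generated by $T_1,\dots,T_{m-1}$ with $(T_i-q)(T_i+q^{-1})=0$, $T_iT_{i+1}T_i=T_{i+1}T_iT_{i+1}$, $T_iT_j=T_jT_i$ for $|i-j|>1$; $T_\sigma$ ($\sigma\in\mathfrak S_m$) is the standard basis given by reduced words. For a finite-dimensional $\mathcal H_m$-module $V$, its character is the element $\chi^V=\sum_{\sigma\in\mathfrak S_m}\mathrm{tr}_V(T_{\sigma^{-1}})T_\sigma\in\mathcal H_m$. The trivial module is the one-dimensional module $T_i\mapsto q$, with character $\chi_q^{(m)}=\sum_\sigma q^{\ell(\sigma)}T_\sigma$, and the sign module is $T_i\mapsto-q^{-1}$, with character $\chi_q^{(1^m)}=\sum_\sigma(-q^{-1})^{\ell(\sigma)}T_\sigma$. For a partition $\lambda=(\lambda_1,\dots,\lambda_l)$ of $r$, $\psi_q^\lambda$ (resp. $\phi_q^\lambda$) is the character of the $\mathcal H_r$-module $\mathcal H_r\otimes_{\mathcal H_\lambda}V$ induced from the sign (resp. trivial) module $V$ of the parabolic subalgebra $\mathcal H_\lambda=\mathcal H_{\lambda_1}\otimes\cdots\otimes\mathcal H_{\lambda_l}$. Action on tensors: $\mathcal H_m$ acts on $(\mathbb{C}^n)^{\otimes m}$ by $T_k\mapsto\check R_k$, the operator $\check R=q\sum_i e_{ii}\otimes e_{ii}+\sum_{i\ne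 j}e_{ij}\otimes e_{ji}+(q-q^{-1})\sum_{i>j}e_{ii}\otimes e_{jj}$ acting in factors $k,k+1$. Quantum coordinate algebra: $A_q(\mathrm{Mat}_n)$ is the unital algebra generated by $x_{ij}$, $1\le i,j\le n$, with relations $\check R X_1X_2=X_1X_2\check R$, $X=(x_{ij})$, where $X_k$ denotes $X$ in the $k$-th tensor factor. Immanants: with $|j_1,\dots,j_m\rangle=e_{j_1}\otimes\cdots\otimes e_{j_m}$ and $\langle i_1,\dots,i_m|$ the dual basis, for $I=(i_1,\dots,i_m)$ put $\mathrm{Imm}_{\chi}(X_I)=\langle i_1,\dots,i_m|\chi X_1\cdots X_m|i_1,\dots,i_m\rangle\in A_q(\mathrm{Mat}_n)$ for $\chi\in\mathcal H_m$. For $|I|=m$ put $\det_q(X_I)=\mathrm{Imm}_{\chi_q^{(1^m)}}(X_I)$ and $\mathrm{per}_q(X_I)=\mathrm{Imm}_{\chi_q^{(m)}}(X_I)$. $m_i(I)$ is the multiplicity of $i$ in $I$ and $m_{q^2}(I)=\prod_{i=1}^n(m_i(I))_{q^2}!$.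
   Formalization: The first identity is proved with the extra factor m_{q^2}(I) before the sum; as printed it fails when I has repeated entries (e.g. n=1, λ=(1,1), I=(1,1): left side (1+q^2)x_11^2, right side x_11^2). For I without repetitions the factor is 1. *)

(* Defs.v *)
From HB Require Import structures.
From mathcomp Require Import all_boot all_order all_fingroup all_algebra.
From mathcomp Require Import generic_quotient ring zify.
From mathcomp Require Import boolp classical_sets.

Set Implicit Arguments.
Unset Strict Implicit.
Unset Printing Implicit Defensive.

Import GRing.Theory.
Local Open Scope quotient_scope.
Local Open Scope ring_scope.

Inductive aterm (K X : Type) : Type :=
| Var of X
| Cst of K
| Add of aterm K X & aterm K X
| Mul of aterm K X & aterm K X.
Arguments Var {K X}.
Arguments Cst {K X}.

Declare Scope aterm_scope.
Delimit Scope aterm_scope with AT.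
Bind Scope aterm_scope with aterm.
Infix "+" := Add : aterm_scope.
Infix "*" := Mul : aterm_scope.

HB.instance Definition _ (K X : Type) := gen_eqMixin (aterm K X).
HB.instance Definition _ (K X : Type) := gen_choiceMixin (aterm K X).

(* The congruence generated by the axioms of a unital associative K-algebra
   ([Cst] being the structure map) and by the relations [rel]. *)
Inductive peq (K : fieldType) (X : Type) (rel : aterm K X -> aterm K X -> Prop) :
    aterm K X -> aterm K X -> Prop :=
| peq_refl t : peq rel t t
| peq_sym s t : peq rel s t -> peq rel t s
| peq_trans s t u : peq rel s t -> peq rel t u -> peq rel s u
| peq_add s s' t t' : peq rel s s' -> peq rel t t' ->
    peq rel (s + t)%AT (s' + t')%AT
| peq_mul s s' t t' : peq rel s s' -> peq rel t t' ->
    peq rel (s * t)%AT (s' * t')%AT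
| peq_addA s t u : peq rel (s + (t + u))%AT (s + t + u)%AT
| peq_addC s t : peq rel (s + t)%AT (t + s)%AT
| peq_add0 t : peq rel (Cst 0 + t)%AT t
| peq_addN t : peq rel (Cst (- 1) * t + t)%AT (Cst 0)
| peq_mulA s t u : peq rel (s * (t * u))%AT (s * t * u)%AT
| peq_1mul t : peq rel (Cst 1 * t)%AT t
| peq_mul1 t : peq rel (t * Cst 1)%AT t
| peq_mulDl s t u : peq rel ((s + t) * u)%AT (s * u + t * u)%AT
| peq_mulDr s t u : peq rel (u * (s + t))%AT (u * s + u * t)%AT
| peq_cstD c d : peq rel (Cst (c + d)) (Cst c + Cst d)%AT
| peq_cstM c d : peq rel (Cst (c * d)) (Cst c * Cst d)%AT
| peq_cst_comm c t : peq rel (Cst c * t)%AT (t * Cst c)%AT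
| peq_rel s t : rel s t -> peq rel s t.

(* [algType] excludes the zero ring, whence the field [pres_neq0]. *)
Record presentation (K : fieldType) := Presentation {
  pres_gen : Type;
  pres_rel : aterm K pres_gen -> aterm K pres_gen -> Prop;
  pres_neq0 : ~ peq pres_rel (Cst 1) (Cst 0)
}.

Section PresentedAlgebra.
Variables (K : fieldType) (P : presentation K).
Local Notation trm := (aterm K (pres_gen P)).
Local Notation eqv := (peq (@pres_rel K P)).

Definition peqb (s t : trm) : bool := `[< eqv s t >].

Lemma peqb_refl : reflexive peqb.
Proof. by move=> t; apply/asboolP; apply: peq_refl. Qed.
Lemma peqb_sym : symmetric peqb.
Proof. by move=> s t; apply/asboolP/asboolP; apply: peq_sym. Qed.
Lemma peqb_trans : transitive peqb.
Proof.
move=> t s u /asboolP st /asboolP tu; apply/asboolP.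
exact: peq_trans st tu.
Qed.
Canonical peqb_equiv := EquivRel peqb peqb_refl peqb_sym peqb_trans.

Definition palg := {eq_quot peqb}.
HB.instance Definition _ := Choice.on palg.

Definition pclass (t : trm) : palg := \pi_{eq_quot peqb} t.
Definition prepr (a : palg) : trm := repr (a : {eq_quot peqb}).

Lemma pclassP s t : pclass s = pclass t <-> eqv s t.
Proof. by split=> [/eqmodP/asboolP//|st]; apply/eqmodP/asboolP. Qed.
Lemma preprK a : pclass (prepr a) = a. Proof. exact: reprK. Qed.
Lemma prepr_eqv t : eqv (prepr (pclass t)) t.
Proof. by apply/pclassP; rewrite preprK. Qed.

Definition palg_gen (x : pres_gen P) : palg := pclass (Var x).
Definition palg_add (a b : palg) : palg := pclass (prepr a + prepr b)%AT.
Definition palg_mul (a b : palg) : palg := pclass (prepr a * prepr b)%AT.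
Definition palg_opp (a : palg) : palg := pclass (Cst (- 1) * prepr a)%AT.
Definition palg_scale (c : K) (a : palg) : palg := pclass (Cst c * prepr a)%AT.

Lemma pclassD s t : palg_add (pclass s) (pclass t) = pclass (s + t)%AT.
Proof. by apply/pclassP/peq_add; apply: prepr_eqv. Qed.
Lemma pclassM s t : palg_mul (pclass s) (pclass t) = pclass (s * t)%AT.
Proof. by apply/pclassP/peq_mul; apply: prepr_eqv. Qed.
Lemma pclassN t : palg_opp (pclass t) = pclass (Cst (- 1) * t)%AT.
Proof. by apply/pclassP/peq_mul; [apply: peq_refl|apply: prepr_eqv]. Qed.
Lemma pclassZ c t : palg_scale c (pclass t) = pclass (Cst c * t)%AT.
Proof. by apply/pclassP/peq_mul; [apply: peq_refl|apply: prepr_eqv]. Qed.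
Lemma pclassW (Q : palg -> Prop) : (forall t, Q (pclass t)) -> forall a, Q a.
Proof. by move=> QP a; rewrite -(preprK a). Qed.

Lemma palg_addA : associative palg_add.
Proof.
elim/pclassW=> s; elim/pclassW=> t; elim/pclassW=> u.
by rewrite !pclassD; apply/pclassP/peq_addA.
Qed.
Lemma palg_addC : commutative palg_add.
Proof.
elim/pclassW=> s; elim/pclassW=> t.
by rewrite !pclassD; apply/pclassP/peq_addC.
Qed.
Lemma palg_add0 : left_id (pclass (Cst 0)) palg_add.
Proof. by elim/pclassW=> s; rewrite pclassD; apply/pclassP/peq_add0. Qed.
Lemma palg_addN : left_inverse (pclass (Cst 0)) palg_opp palg_add.
Proof.
by elim/pclassW=> s; rewrite pclassN pclassD; apply/pclassP/peq_addN.
Qed.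
HB.instance Definition _ :=
  GRing.isZmodule.Build palg palg_addA palg_addC palg_add0 palg_addN.

Lemma palg_mulA : associative palg_mul.
Proof.
elim/pclassW=> s; elim/pclassW=> t; elim/pclassW=> u.
by rewrite !pclassM; apply/pclassP/peq_mulA.
Qed.
Lemma palg_1mul : left_id (pclass (Cst 1)) palg_mul.
Proof. by elim/pclassW=> s; rewrite pclassM; apply/pclassP/peq_1mul. Qed.
Lemma palg_mul1 : right_id (pclass (Cst 1)) palg_mul.
Proof. by elim/pclassW=> s; rewrite pclassM; apply/pclassP/peq_mul1. Qed.
Lemma palg_mulDl : left_distributive palg_mul palg_add.
Proof.
elim/pclassW=> s; elim/pclassW=> t; elim/pclassW=> u.
by rewrite !(pclassM, pclassD); apply/pclassP/peq_mulDl.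
Qed.
Lemma palg_mulDr : right_distributive palg_mul palg_add.
Proof.
elim/pclassW=> s; elim/pclassW=> t; elim/pclassW=> u.
by rewrite !(pclassM, pclassD); apply/pclassP/peq_mulDr.
Qed.
Lemma palg_1neq0 : pclass (Cst 1) != pclass (Cst 0).
Proof. by apply/eqP => /pclassP; apply: pres_neq0. Qed.
HB.instance Definition _ := GRing.Zmodule_isNzRing.Build palg
  palg_mulA palg_1mul palg_mul1 palg_mulDl palg_mulDr palg_1neq0.

Lemma palg_scaleA c d a :
  palg_scale c (palg_scale d a) = palg_scale (c * d) a.
Proof.
elim/pclassW: a => s; rewrite !pclassZ; apply/pclassP.
apply: peq_trans (peq_mulA _ _ _ _) _.
by apply: peq_mul (peq_refl _ _); apply/peq_sym/peq_cstM.
Qed.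
Lemma palg_scale1 : left_id 1 palg_scale.
Proof. by elim/pclassW=> s; rewrite pclassZ; apply/pclassP/peq_1mul. Qed.
Lemma palg_scaleDr : right_distributive palg_scale +%R.
Proof.
move=> c; elim/pclassW=> s; elim/pclassW=> t.
by rewrite /GRing.add /= !(pclassZ, pclassD); apply/pclassP/peq_mulDr.
Qed.
Lemma palg_scaleDl a : {morph palg_scale^~ a : c d / c + d}.
Proof.
elim/pclassW: a => s c d.
rewrite [RHS]/GRing.add /= !(pclassZ, pclassD); apply/pclassP.
apply: peq_trans (peq_mulDl _ _ _ _).
exact: peq_mul (peq_cstD _ _ _) (peq_refl _ _).
Qed.
HB.instance Definition _ := GRing.Zmodule_isLmodule.Build K palg
  palg_scaleA palg_scale1 palg_scaleDr palg_scaleDl.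

Lemma palg_scaleAl c (a b : palg) : c *: (a * b) = (c *: a) * b.
Proof.
elim/pclassW: a => s; elim/pclassW: b => t.
rewrite /GRing.scale /GRing.mul /= !(pclassM, pclassZ).
exact/pclassP/peq_mulA.
Qed.
HB.instance Definition _ := GRing.Lmodule_isLalgebra.Build K palg palg_scaleAl.

Lemma palg_scaleAr c (a b : palg) : c *: (a * b) = a * (c *: b).
Proof.
elim/pclassW: a => s; elim/pclassW: b => t.
rewrite /GRing.scale /GRing.mul /= !(pclassM, pclassZ); apply/pclassP.
apply: peq_trans (peq_mulA _ _ _ _) _.
apply: peq_trans (peq_sym (peq_mulA _ _ _ _)).
exact: peq_mul (peq_cst_comm _ _ _) (peq_refl _ _).
Qed.
HB.instance Definition _ := GRing.Lalgebra_isAlgebra.Build K palg palg_scaleAr.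

Lemma palg_addE s t : pclass s + pclass t = pclass (s + t)%AT.
Proof. exact: pclassD. Qed.
Lemma palg_mulE s t : pclass s * pclass t = pclass (s * t)%AT.
Proof. exact: pclassM. Qed.
Lemma palg_scaleE c t : c *: pclass t = pclass (Cst c * t)%AT.
Proof. exact: pclassZ. Qed.
Lemma palg_oneE : (1 : palg) = pclass (Cst 1). Proof. by []. Qed.
Lemma palg_cstE c : pclass (Cst c) = c%:A.
Proof. by rewrite palg_oneE palg_scaleE; apply/pclassP/peq_sym/peq_mul1. Qed.

End PresentedAlgebra.

Fixpoint teval (K : fieldType) (X : Type) (A : algType K) (g : X -> A)
    (t : aterm K X) : A :=
  match t with
  | Var x => g x
  | Cst c => c%:A
  | Add s u => teval g s + teval g u
  | Mul s u => teval g s * teval g u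
  end.

Lemma teval_peq (K : fieldType) (X : Type) (rel : aterm K X -> aterm K X -> Prop)
    (A : algType K) (g : X -> A) :
  (forall s t, rel s t -> teval g s = teval g t) ->
  forall s t, peq rel s t -> teval g s = teval g t.
Proof.
move=> gP s t; elim=> {s t} //=.
- by move=> s t u _ -> _ ->.
- by move=> s s' t t' _ -> _ ->.
- by move=> s s' t t' _ -> _ ->.
- by move=> s t u; rewrite addrA.
- by move=> s t; rewrite addrC.
- by move=> t; rewrite scale0r add0r.
- by move=> t; rewrite scaleN1r mulN1r addNr scale0r.
- by move=> s t u; rewrite mulrA.
- by move=> t; rewrite scale1r mul1r.
- by move=> t; rewrite scale1r mulr1.
- by move=> s t u; rewrite mulrDl.
- by move=> s t u; rewrite mulrDr.
- by move=> c d; rewrite scalerDl.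
- by move=> c d; rewrite mulr_algl scalerA.
- by move=> c t; rewrite mulr_algl mulr_algr.
Qed.

Lemma teval_gen (K : fieldType) (P : presentation K) t :
  teval (@palg_gen K P) t = pclass t.
Proof.
elim: t => //= [c|s -> t ->|s -> t ->].
- by rewrite palg_cstE.
- exact: palg_addE.
- exact: palg_mulE.
Qed.

Lemma palg_relE (K : fieldType) (P : presentation K) s t :
  @pres_rel K P s t -> teval (@palg_gen K P) s = teval (@palg_gen K P) t.
Proof. by move=> st; rewrite !teval_gen; apply/pclassP/peq_rel. Qed.

Section AlgebraLift.
Variables (K : fieldType) (P : presentation K) (A : algType K).
Variable g : pres_gen P -> A.
Hypothesis gP : forall s t, pres_rel s t -> teval g s = teval g t.

Definition palg_lift of (forall s t, pres_rel s t -> teval g s = teval g t) :=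
  fun a : palg P => teval g (prepr a).
Local Notation f := (palg_lift gP).

Lemma palg_liftE t : f (pclass t) = teval g t.
Proof. exact/(teval_peq gP)/prepr_eqv. Qed.
Lemma palg_lift_is_additive : {morph f : a b / a + b}.
Proof.
by elim/pclassW=> s; elim/pclassW=> t; rewrite palg_addE !palg_liftE.
Qed.
Lemma palg_lift_is_zmod : zmod_morphism f.
Proof.
have f0 : f 0 = 0.
  by apply: (addrI (f 0)); rewrite -palg_lift_is_additive !addr0.
move=> a b; apply/eqP; rewrite eq_sym subr_eq -palg_lift_is_additive.
by rewrite subrK.
Qed.
Lemma palg_lift_is_monoid_morphism : monoid_morphism f.
Proof.
split=> [|a b]; first by rewrite palg_oneE palg_liftE /= scale1r.
elim/pclassW: a => s; elim/pclassW: b => t.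
by rewrite palg_mulE !palg_liftE.
Qed.
Lemma palg_lift_is_scalable : scalable f.
Proof.
move=> c; elim/pclassW=> t.
by rewrite palg_scaleE !palg_liftE /= mulr_algl.
Qed.
HB.instance Definition _ :=
  GRing.isZmodMorphism.Build (palg P) A f palg_lift_is_zmod.
HB.instance Definition _ :=
  GRing.isMonoidMorphism.Build (palg P) A f palg_lift_is_monoid_morphism.
HB.instance Definition _ :=
  GRing.isScalable.Build K (palg P) A *:%R f palg_lift_is_scalable.

End AlgebraLift.

Record amodule (K : fieldType) (A : algType K) := AModule {
  amod_sort :> lmodType K;
  aact : A -> amod_sort -> amod_sort;
  aactDl : forall a b v, aact (a + b) v = aact a v + aact b v;
  aactDr : forall a v w, aact a (v + w) = aact a v + aact a w;
  aactZl : forall c a v, aact (c *: a) v = c *: aact a v;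
  aactZr : forall c a v, aact a (c *: v) = c *: aact a v;
  aact1 : forall v, aact 1 v = v;
  aactM : forall a b v, aact (a * b) v = aact a (aact b v)
}.
Arguments aact {K A} _ _ _.

Section ModuleLift.
Variables (K : fieldType) (P : presentation K) (V : lmodType K).
Variable g : pres_gen P -> {linear V -> V}.

Fixpoint meval (t : aterm K (pres_gen P)) (v : V) : V :=
  match t with
  | Var x => g x v
  | Cst c => c *: v
  | Add s u => meval s v + meval u v
  | Mul s u => meval s (meval u v)
  end.

Hypothesis gP : forall s t, pres_rel s t -> meval s =1 meval t.

Lemma mevalD t v w : meval t (v + w) = meval t v + meval t w.
Proof.
elim: t v w => [x|c|s IHs u IHu|s IHs u IHu] v w /=.
- exact: raddfD.
- exact: scalerDr.
- by rewrite IHs IHu addrACA.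
- by rewrite IHu IHs.
Qed.
Lemma mevalZ t c v : meval t (c *: v) = c *: meval t v.
Proof.
elim: t c v => [x|d|s IHs u IHu|s IHs u IHu] c v /=.
- exact: linearZ.
- by rewrite !scalerA mulrC.
- by rewrite IHs IHu scalerDr.
- by rewrite IHu IHs.
Qed.
Lemma meval_peq s t : peq (@pres_rel K P) s t -> meval s =1 meval t.
Proof.
elim=> {s t} //=.
- by move=> s t _ IH v; rewrite IH.
- by move=> s t u _ IH _ IH' v; rewrite IH IH'.
- by move=> s s' t t' _ IH _ IH' v; rewrite IH IH'.
- by move=> s s' t t' _ IH _ IH' v; rewrite IH' IH.
- by move=> s t u v; rewrite addrA.
- by move=> s t v; rewrite addrC.
- by move=> t v; rewrite scale0r add0r.
- by move=> t v; rewrite scaleN1r addNr scale0r.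
- by move=> t v; rewrite scale1r.
- by move=> t v; rewrite scale1r.
- by move=> s t u v; rewrite mevalD.
- by move=> c d v; rewrite scalerDl.
- by move=> c d v; rewrite scalerA.
- by move=> c t v; rewrite mevalZ.
Qed.

Definition lift_act (a : palg P) (v : V) : V := meval (prepr a) v.

Lemma lift_actE t v : lift_act (pclass t) v = meval t v.
Proof. exact/meval_peq/prepr_eqv. Qed.
Lemma lift_actDl a b v : lift_act (a + b) v = lift_act a v + lift_act b v.
Proof.
by elim/pclassW: a => s; elim/pclassW: b => t; rewrite palg_addE !lift_actE.
Qed.
Lemma lift_actZl c a v : lift_act (c *: a) v = c *: lift_act a v.
Proof. by elim/pclassW: a => s; rewrite palg_scaleE !lift_actE. Qed.
Lemma lift_act1 v : lift_act 1 v = v.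
Proof. by rewrite palg_oneE lift_actE /= scale1r. Qed.
Lemma lift_actM a b v : lift_act (a * b) v = lift_act a (lift_act b v).
Proof.
by elim/pclassW: a => s; elim/pclassW: b => t; rewrite palg_mulE !lift_actE.
Qed.

Definition lift_module : amodule (palg P) :=
  AModule lift_actDl (fun a => mevalD (prepr a)) lift_actZl
    (fun c a => mevalZ (prepr a) c) lift_act1 lift_actM.

End ModuleLift.

Inductive tensor_term (A V K : Type) : Type :=
| Tens of A & V
| TZero
| TAdd of tensor_term A V K & tensor_term A V K
| TScale of K & tensor_term A V K.
Arguments Tens {A V K}.
Arguments TZero {A V K}.
Arguments TAdd {A V K}.
Arguments TScale {A V K}.

HB.instance Definition _ (A V K : Type) := gen_eqMixin (tensor_term A V K).
HB.instance Definition _ (A V K : Type) := gen_choiceMixin (tensor_term A V K).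

Section ExtensionOfScalars.
Variables (K : fieldType) (B A : algType K) (f : {lrmorphism B -> A}).
Variable V : amodule B.
Local Notation trm := (tensor_term A V K).

(* [ext] below is A (x)_B V, A being a right B-module through [f]; formal terms
   are taken modulo K-linearity, bilinearity and a f(b) (x) v = a (x) b v. *)
Inductive teq : trm -> trm -> Prop :=
| teq_refl t : teq t t
| teq_sym s t : teq s t -> teq t s
| teq_trans s t u : teq s t -> teq t u -> teq s u
| teq_add s s' t t' : teq s s' -> teq t t' -> teq (TAdd s t) (TAdd s' t')
| teq_scale c t t' : teq t t' -> teq (TScale c t) (TScale c t')
| teq_addA s t u : teq (TAdd s (TAdd t u)) (TAdd (TAdd s t) u)
| teq_addC s t : teq (TAdd s t) (TAdd t s)
| teq_add0 t : teq (TAdd TZero t) t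
| teq_addN t : teq (TAdd (TScale (- 1) t) t) TZero
| teq_scaleA c d t : teq (TScale c (TScale d t)) (TScale (c * d) t)
| teq_scale1 t : teq (TScale 1 t) t
| teq_scaleDr c s t : teq (TScale c (TAdd s t)) (TAdd (TScale c s) (TScale c t))
| teq_scaleDl c d t : teq (TScale (c + d) t) (TAdd (TScale c t) (TScale d t))
| teq_tensDl a a' v : teq (Tens (a + a') v) (TAdd (Tens a v) (Tens a' v))
| teq_tensDr a v v' : teq (Tens a (v + v')) (TAdd (Tens a v) (Tens a v'))
| teq_tensZl c a v : teq (Tens (c *: a) v) (TScale c (Tens a v))
| teq_tensZr c a v : teq (Tens a (c *: v)) (TScale c (Tens a v))
| teq_balanced a b v : teq (Tens (a * f b) v) (Tens a (aact V b v)).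

Definition teqb (s t : trm) : bool := `[< teq s t >].

Lemma teqb_refl : reflexive teqb.
Proof. by move=> t; apply/asboolP; apply: teq_refl. Qed.
Lemma teqb_sym : symmetric teqb.
Proof. by move=> s t; apply/asboolP/asboolP; apply: teq_sym. Qed.
Lemma teqb_trans : transitive teqb.
Proof.
move=> t s u /asboolP st /asboolP tu; apply/asboolP.
exact: teq_trans st tu.
Qed.
Canonical teqb_equiv := EquivRel teqb teqb_refl teqb_sym teqb_trans.

Definition ext := {eq_quot teqb}.
HB.instance Definition _ := Choice.on ext.

Definition tclass (t : trm) : ext := \pi_{eq_quot teqb} t.
Definition trepr (a : ext) : trm := repr (a : {eq_quot teqb}).

Lemma tclassP s t : tclass s = tclass t <-> teq s t.
Proof. by split=> [/eqmodP/asboolP//|st]; apply/eqmodP/asboolP. Qed.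
Lemma treprK a : tclass (trepr a) = a. Proof. exact: reprK. Qed.
Lemma trepr_eqv t : teq (trepr (tclass t)) t.
Proof. by apply/tclassP; rewrite treprK. Qed.
Lemma tclassW (Q : ext -> Prop) : (forall t, Q (tclass t)) -> forall a, Q a.
Proof. by move=> QP a; rewrite -(treprK a). Qed.

Definition ext_add (a b : ext) : ext := tclass (TAdd (trepr a) (trepr b)).
Definition ext_scale (c : K) (a : ext) : ext := tclass (TScale c (trepr a)).

Lemma tclassD s t : ext_add (tclass s) (tclass t) = tclass (TAdd s t).
Proof. by apply/tclassP/teq_add; apply: trepr_eqv. Qed.
Lemma tclassZ c t : ext_scale c (tclass t) = tclass (TScale c t).
Proof. exact/tclassP/teq_scale/trepr_eqv. Qed.

Lemma ext_addA : associative ext_add.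
Proof.
elim/tclassW=> s; elim/tclassW=> t; elim/tclassW=> u.
by rewrite !tclassD; apply/tclassP/teq_addA.
Qed.
Lemma ext_addC : commutative ext_add.
Proof.
elim/tclassW=> s; elim/tclassW=> t.
by rewrite !tclassD; apply/tclassP/teq_addC.
Qed.
Lemma ext_add0 : left_id (tclass TZero) ext_add.
Proof. by elim/tclassW=> s; rewrite tclassD; apply/tclassP/teq_add0. Qed.
Lemma ext_addN : left_inverse (tclass TZero) (ext_scale (- 1)) ext_add.
Proof.
by elim/tclassW=> s; rewrite tclassZ tclassD; apply/tclassP/teq_addN.
Qed.
HB.instance Definition _ :=
  GRing.isZmodule.Build ext ext_addA ext_addC ext_add0 ext_addN.

Lemma ext_scaleA c d a : ext_scale c (ext_scale d a) = ext_scale (c * d) a.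
Proof.
by elim/tclassW: a => s; rewrite !tclassZ; apply/tclassP/teq_scaleA.
Qed.
Lemma ext_scale1 : left_id 1 ext_scale.
Proof. by elim/tclassW=> s; rewrite tclassZ; apply/tclassP/teq_scale1. Qed.
Lemma ext_scaleDr : right_distributive ext_scale +%R.
Proof.
move=> c; elim/tclassW=> s; elim/tclassW=> t.
by rewrite /GRing.add /= !(tclassZ, tclassD); apply/tclassP/teq_scaleDr.
Qed.
Lemma ext_scaleDl a : {morph ext_scale^~ a : c d / c + d}.
Proof.
elim/tclassW: a => s c d.
rewrite [RHS]/GRing.add /= !(tclassZ, tclassD).
exact/tclassP/teq_scaleDl.
Qed.
HB.instance Definition _ := GRing.Zmodule_isLmodule.Build K ext
  ext_scaleA ext_scale1 ext_scaleDr ext_scaleDl.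

Definition tens (a : A) (v : V) : ext := tclass (Tens a v).

Fixpoint tact (x : A) (t : trm) : trm :=
  match t with
  | Tens a v => Tens (x * a) v
  | TZero => TZero
  | TAdd s u => TAdd (tact x s) (tact x u)
  | TScale c s => TScale c (tact x s)
  end.

Lemma tact_teq x s t : teq s t -> teq (tact x s) (tact x t).
Proof.
elim=> {s t} /=.
- by move=> t; apply: teq_refl.
- by move=> s t _; apply: teq_sym.
- by move=> s t u _ IH _; apply: teq_trans.
- by move=> s s' t t' _ IH _ IH'; apply: teq_add.
- by move=> c t t' _; apply: teq_scale.
- by move=> *; apply: teq_addA.
- by move=> *; apply: teq_addC.
- by move=> *; apply: teq_add0.
- by move=> *; apply: teq_addN.
- by move=> *; apply: teq_scaleA.
- by move=> *; apply: teq_scale1.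
- by move=> *; apply: teq_scaleDr.
- by move=> *; apply: teq_scaleDl.
- by move=> a a' v; rewrite mulrDr; apply: teq_tensDl.
- by move=> *; apply: teq_tensDr.
- by move=> c a v; rewrite -scalerAr; apply: teq_tensZl.
- by move=> *; apply: teq_tensZr.
- by move=> a b v; rewrite mulrA; apply: teq_balanced.
Qed.

Definition ext_act (x : A) (e : ext) : ext := tclass (tact x (trepr e)).

Lemma ext_actE x t : ext_act x (tclass t) = tclass (tact x t).
Proof. exact/tclassP/tact_teq/trepr_eqv. Qed.
Lemma ext_addE s t : tclass s + tclass t = tclass (TAdd s t).
Proof. exact: tclassD. Qed.
Lemma ext_scaleE c t : c *: tclass t = tclass (TScale c t).
Proof. exact: tclassZ. Qed.

Lemma ext_actDr x e e' : ext_act x (e + e') = ext_act x e + ext_act x e'.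
Proof.
elim/tclassW: e => s; elim/tclassW: e' => t.
by rewrite ext_addE !ext_actE ext_addE.
Qed.
Lemma ext_actZr c x e : ext_act x (c *: e) = c *: ext_act x e.
Proof. by elim/tclassW: e => s; rewrite ext_scaleE !ext_actE ext_scaleE. Qed.
Lemma ext_actDl x y e : ext_act (x + y) e = ext_act x e + ext_act y e.
Proof.
elim/tclassW: e; elim=> [a v||s IHs t IHt|c s IHs].
- rewrite !ext_actE ext_addE; apply/tclassP => /=.
  by rewrite mulrDl; apply: teq_tensDl.
- by rewrite !ext_actE ext_addE; apply/tclassP/teq_sym/teq_add0.
- by rewrite -ext_addE !ext_actDr IHs IHt addrACA.
- by rewrite -ext_scaleE !ext_actZr IHs scalerDr.
Qed.
Lemma ext_actZl c x e : ext_act (c *: x) e = c *: ext_act x e.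
Proof.
elim/tclassW: e; elim=> [a v||s IHs t IHt|d s IHs].
- rewrite !ext_actE ext_scaleE; apply/tclassP => /=.
  by rewrite -scalerAl; apply: teq_tensZl.
- have -> : tclass TZero = 0 by [].
  by rewrite -(scale0r 0) !ext_actZr !scale0r scaler0.
- by rewrite -ext_addE !ext_actDr IHs IHt scalerDr.
- by rewrite -ext_scaleE !ext_actZr IHs !scalerA mulrC.
Qed.
Lemma ext_act1 e : ext_act 1 e = e.
Proof.
elim/tclassW: e; elim=> [a v||s IHs t IHt|d s IHs].
- by rewrite ext_actE /= mul1r.
- by rewrite ext_actE.
- by rewrite -ext_addE !ext_actDr IHs IHt.
- by rewrite -ext_scaleE !ext_actZr IHs.
Qed.
Lemma ext_actM x y e : ext_act (x * y) e = ext_act x (ext_act y e).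
Proof.
elim/tclassW: e; elim=> [a v||s IHs t IHt|d s IHs].
- by rewrite !ext_actE /= mulrA.
- by rewrite !ext_actE.
- by rewrite -ext_addE !ext_actDr IHs IHt.
- by rewrite -ext_scaleE !ext_actZr IHs.
Qed.

Definition ext_module : amodule A :=
  AModule ext_actDl ext_actDr ext_actZl ext_actZr ext_act1 ext_actM.

End ExtensionOfScalars.

Definition is_basis (K : fieldType) (V : lmodType K) (d : nat)
    (e : 'I_d -> V) : Prop :=
  forall v, exists! c : {ffun 'I_d -> K}, v = \sum_i c i *: e i.

Definition is_trace (K : fieldType) (V : lmodType K) (u : V -> V) (t : K) : Prop :=
  exists d (e : 'I_d -> V) (M : 'M[K]_d),
    [/\ is_basis e, (forall j, u (e j) = \sum_i M i j *: e i) & t = \tr M].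

(* Meaningful for linear [u] on a finite-dimensional [V] only (0 if [V] has no
   finite basis). *)
Definition trace (K : fieldType) (V : lmodType K) (u : V -> V) : K :=
  xget 0 [set t | is_trace u t].

(* Generators [T_x], where [x : X] stands for the index [pos x]. *)
Inductive hecke_rel (K : fieldType) (q : K) (X : Type) (pos : X -> nat) :
    aterm K X -> aterm K X -> Prop :=
| hecke_quad x : hecke_rel q pos
    ((Var x + Cst (- q)) * (Var x + Cst q^-1))%AT (Cst 0)
| hecke_braid x y : pos y = (pos x).+1 -> hecke_rel q pos
    (Var x * Var y * Var x)%AT (Var y * Var x * Var y)%AT
| hecke_comm x y : ((pos x).+1 < pos y)%N -> hecke_rel q pos
    (Var x * Var y)%AT (Var y * Var x)%AT.

Section HeckeAlgebra.
Variables (K : fieldType) (q : K).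

Section Presentation.
Variables (X : Type) (pos : X -> nat).

Lemma hecke_char (c : K) : (c - q) * (c + q^-1) = 0 ->
  forall s t, hecke_rel q pos s t ->
    teval (fun=> c : K^o) s = teval (fun=> c : K^o) t.
Proof.
move=> cP s t [x|x y _|x y _] //=.
by rewrite /GRing.scale /= !mulr1 cP.
Qed.

Lemma hecke_neq0 : ~ peq (hecke_rel q pos) (Cst 1) (Cst 0).
Proof.
move/(teval_peq (hecke_char (c := q) _)) => /=.
rewrite subrr mul0r scale1r scale0r => /(_ erefl) /eqP.
by rewrite oner_eq0.
Qed.

Definition hecke_pres : presentation K := Presentation hecke_neq0.
Definition hecke_alg : algType K := palg hecke_pres.

Definition scale_op (c : K) : {linear K^o -> K^o} := GRing.scale c.

Lemma onedimP (c : K) : (c - q) * (c + q^-1) = 0 ->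
  forall s t, @pres_rel K hecke_pres s t ->
    @meval K hecke_pres K^o (fun=> scale_op c) s =1
    @meval K hecke_pres K^o (fun=> scale_op c) t.
Proof.
move=> cP s t [x|x y _|x y _] v //=.
rewrite scale0r -scalerDl -/(GRing.scale _ _).
by rewrite -scalerDl scalerA cP scale0r.
Qed.

Lemma triv_quad : (q - q) * (q + q^-1) = 0.
Proof. by rewrite subrr mul0r. Qed.
Lemma sign_quad : (- q^-1 - q) * (- q^-1 + q^-1) = 0.
Proof. by rewrite addNr mulr0. Qed.

Definition triv_module : amodule hecke_alg := lift_module (onedimP triv_quad).
Definition sign_module : amodule hecke_alg := lift_module (onedimP sign_quad).

End Presentation.

(* Indices are shifted by one: [i : 'I_m.-1] stands for T_(i+1), and the
   corresponding transposition exchanges the positions i and i+1 of 'I_m. *)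
Definition Hecke (m : nat) : algType K := hecke_alg (@nat_of_ord m.-1).
Definition HeckeT (m : nat) (i : 'I_m.-1) : Hecke m :=
  @palg_gen K (hecke_pres (@nat_of_ord m.-1)) i.

Lemma ltn_pred_ord m (i : 'I_m.-1) : (i < m)%N.
Proof. exact: leq_trans (ltn_ord i) (leq_pred m). Qed.
Lemma ltn_pred_ordS m (i : 'I_m.-1) : (i.+1 < m)%N.
Proof. by case: m i => [|m] i; [case: i|rewrite ltnS ltn_ord]. Qed.

Definition adj_tperm m (i : 'I_m.-1) : 'S_m :=
  tperm (Ordinal (ltn_pred_ord i)) (Ordinal (ltn_pred_ordS i)).
Definition word_perm m (w : seq 'I_m.-1) : 'S_m :=
  (\prod_(i <- w) adj_tperm i)%g.
Definition is_reduced_word m (s : 'S_m) (w : seq 'I_m.-1) : Prop :=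
  word_perm w = s /\ forall w', word_perm w' = s -> (size w <= size w')%N.

(* In [word_perm] permutations are multiplied from left to right; the opposite
   convention exchanges T_s and T_(s^-1), which does not affect [character]. *)
Definition Tperm m (s : 'S_m) : Hecke m :=
  \prod_(i <- xget [::] [set w | is_reduced_word s w]) HeckeT i.

Definition character m (V : amodule (Hecke m)) : Hecke m :=
  \sum_(s : 'S_m) trace (aact V (Tperm s^-1%g)) *: Tperm s.

(* T_i lies in the parabolic subalgebra iff the positions i and i+1 that it
   exchanges lie in the same block of the composition [lam]. *)
Definition parab_gen (r : nat) (lam : seq nat) :=
  {i : 'I_r.-1 | reshape_index lam i == reshape_index lam i.+1}.
Definition parab_pos (r : nat) (lam : seq nat) (i : parab_gen r lam) : nat :=
  val (val i).
Definition Parabolic (r : nat) (lam : seq nat) : algType K :=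
  hecke_alg (@parab_pos r lam).

Lemma parab_embP r lam s t :
  @pres_rel K (hecke_pres (@parab_pos r lam)) s t ->
  teval (fun x => HeckeT (val x)) s = teval (fun x => HeckeT (val x)) t.
Proof.
case=> [x|x y xy|x y xy].
- exact: (palg_relE (P := hecke_pres (@nat_of_ord r.-1))
           (hecke_quad q (@nat_of_ord r.-1) (val x))).
- exact: (palg_relE (P := hecke_pres (@nat_of_ord r.-1))
           (@hecke_braid K q _ (@nat_of_ord r.-1) (val x) (val y) xy)).
- exact: (palg_relE (P := hecke_pres (@nat_of_ord r.-1))
           (@hecke_comm K q _ (@nat_of_ord r.-1) (val x) (val y) xy)).
Qed.

Definition parab_emb r lam : {lrmorphism Parabolic r lam -> Hecke r} :=
  palg_lift (@parab_embP r lam).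

Definition psi (r : nat) (lam : seq nat) : Hecke r :=
  character (ext_module (parab_emb r lam) (sign_module _)).
Definition phi (r : nat) (lam : seq nat) : Hecke r :=
  character (ext_module (parab_emb r lam) (triv_module _)).

End HeckeAlgebra.

(* The entry <i,j| R |k,l>. *)
Definition Rmat (K : fieldType) (q : K) (n : nat) (i j k l : 'I_n) : K :=
  q * [&& i == j, k == i & l == i]%:R
  + [&& i != j, k == j & l == i]%:R
  + (q - q^-1) * [&& (j < i)%N, k == i & l == j]%:R.

Definition two_pos_op (K : fieldType) (q : K) (T : Type) (a b : T -> nat)
    (s : T -> T) (f : T -> K) (x : T) : K :=
  if a x == b x then q * f x
  else f (s x) + (if (b x < a x)%N then (q - q^-1) * f x else 0).

Lemma two_pos_op_braid (K : fieldType) (q : K) (T : Type) (a b c : T -> nat)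
    (s t : T -> T) (f : T -> K) (x : T) :
  q != 0 ->
  (forall y, a (s y) = b y) -> (forall y, b (s y) = a y) ->
  (forall y, c (s y) = c y) ->
  (forall y, a (t y) = a y) -> (forall y, b (t y) = c y) ->
  (forall y, c (t y) = b y) ->
  involutive s -> involutive t -> (forall y, s (t (s y)) = t (s (t y))) ->
  let S := two_pos_op q a b s in let U := two_pos_op q b c t in
  S (U (S f)) x = U (S (U f)) x.
Proof.
move=> q0 as_ bs cs at_ bt ct sK tK sts /=.
rewrite /two_pos_op !(as_, bs, cs, at_, bt, ct) !sK !tK sts.
have : q * (q - q^-1) = q ^+ 2 - 1 by field.
move: (f x) (f (s x)) (f (t x)) (f (s (t x))) (f (t (s x))) (f (t (s (t x)))).
move: (a x) (b x) (c x) (q - q^-1) => i j k z y0 y1 y2 y3 y4 y5 qz.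
case: (ltngtP i j) => [ij|ij|ij]; case: (ltngtP j k) => [jk|jk|jk];
 case: (ltngtP i k) => [ik|ik|ik]; try (exfalso; lia); rewrite /=; try by ring.
- apply/eqP; rewrite -subr_eq0; apply/eqP.
  by transitivity (z * y0 * (1 + q * z - q ^+ 2)); [|rewrite qz]; ring.
- apply/eqP; rewrite -subr_eq0; apply/eqP.
  by transitivity (z * y0 * (q ^+ 2 - q * z - 1)); [|rewrite qz]; ring.
Qed.

Section TensorAction.
Variables (K : fieldType) (q : K) (n m : nat).

(* A tensor is given by its coordinates on the basis |j_1,...,j_m>. *)
Definition tensor_space : lmodType K := {ffun m.-tuple 'I_n -> K^o}.

Definition ket (J : m.-tuple 'I_n) : tensor_space := [ffun L => (L == J)%:R].
Definition bra (I : m.-tuple 'I_n) (v : tensor_space) : K := v I.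

Definition posl (k : 'I_m.-1) : 'I_m := Ordinal (ltn_pred_ord k).
Definition posr (k : 'I_m.-1) : 'I_m := Ordinal (ltn_pred_ordS k).

(* The entry <I| R_k |J>, where R_k is R acting in the factors k and k+1. *)
Definition Rk_entry (k : 'I_m.-1) (I J : m.-tuple 'I_n) : K :=
  Rmat q (tnth I (posl k)) (tnth I (posr k))
         (tnth J (posl k)) (tnth J (posr k))
  * [forall p : 'I_m, (p != posl k) && (p != posr k) ==>
       (tnth I p == tnth J p)]%:R.

Definition Rk_fun (k : 'I_m.-1) (v : tensor_space) : tensor_space :=
  [ffun I => \sum_J Rk_entry k I J * v J].

Lemma Rk_is_linear k : linear (Rk_fun k).
Proof.
move=> c u v; apply/ffunP => I; rewrite !ffunE /GRing.scale /= mulr_sumr.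
rewrite -big_split /=; apply: eq_bigr => J _.
by rewrite !ffunE mulrDr mulrCA.
Qed.
HB.instance Definition _ k :=
  GRing.isLinear.Build K tensor_space tensor_space *:%R (Rk_fun k)
    (Rk_is_linear k).
Definition Rk (k : 'I_m.-1) : {linear tensor_space -> tensor_space} := Rk_fun k.

Definition swap_pos (k : 'I_m.-1) (I : m.-tuple 'I_n) : m.-tuple 'I_n :=
  [tuple tnth I (adj_tperm k p) | p < m].

Lemma tnth_swap k I p : tnth (swap_pos k I) p = tnth I (adj_tperm k p).
Proof. exact: tnth_mktuple. Qed.
Lemma swap_posl k I : tnth (swap_pos k I) (posl k) = tnth I (posr k).
Proof. by rewrite tnth_swap tpermL. Qed.
Lemma swap_posr k I : tnth (swap_pos k I) (posr k) = tnth I (posl k).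
Proof. by rewrite tnth_swap tpermR. Qed.
Lemma swap_posD k I p : p != posl k -> p != posr k ->
  tnth (swap_pos k I) p = tnth I p.
Proof. by move=> pl pr; rewrite tnth_swap tpermD // eq_sym. Qed.
Lemma swap_posK k I : swap_pos k (swap_pos k I) = I.
Proof. by apply: eq_from_tnth => p; rewrite !tnth_swap tpermK. Qed.

Lemma eq_posP k (I J : m.-tuple 'I_n) :
  [&& tnth J (posl k) == tnth I (posl k), tnth J (posr k) == tnth I (posr k)
    & [forall p : 'I_m, (p != posl k) && (p != posr k) ==>
       (tnth I p == tnth J p)]] = (J == I).
Proof.
apply/and3P/eqP => [[/eqP jl /eqP jr /forallP jd]|->].
  apply: eq_from_tnth => p; have := jd p.
  have [->//|pl] := eqVneq p (posl k); have [->//|pr] := eqVneq p (posr k).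
  by move=> /eqP.
by split=> //; apply/forallP => p; rewrite eqxx implybT.
Qed.

Lemma eq_swapP k (I J : m.-tuple 'I_n) :
  [&& tnth J (posl k) == tnth I (posr k), tnth J (posr k) == tnth I (posl k)
    & [forall p : 'I_m, (p != posl k) && (p != posr k) ==>
       (tnth I p == tnth J p)]] = (J == swap_pos k I).
Proof.
rewrite -(eq_posP k) swap_posl swap_posr; congr [&& _, _ & _].
apply: eq_forallb => p.
by case: (altP (p =P posl k)) => //= pl; case: (altP (p =P posr k)) => //= pr;
  rewrite swap_posD.
Qed.

Lemma Rk_entryE k I J : Rk_entry k I J =
  let i := tnth I (posl k) in let j := tnth I (posr k) in
  if i == j then q * (J == I)%:R
  else (J == swap_pos k I)%:R
       + (if (j < i)%N then (q - q^-1) * (J == I)%:R else 0).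
Proof.
rewrite /Rk_entry /Rmat -(eq_posP k) -(eq_swapP k) /=.
case: (altP (tnth I (posl k) =P tnth I (posr k))) => [->|ij] /=.
  by rewrite ltnn /= !mulr0 !addr0 -mulrA -natrM mulnb -andbA.
rewrite mulr0 add0r mulrDl -natrM mulnb -andbA; congr (_ + _).
case: ifP => _ /=; last by rewrite mulr0 mul0r.
by rewrite -mulrA -natrM mulnb -andbA.
Qed.

Lemma sum_delta (v : tensor_space) (I : m.-tuple 'I_n) :
  \sum_J (J == I)%:R * v J = v I.
Proof.
rewrite (bigD1 I) //= eqxx mul1r big1 ?addr0 // => J /negPf->.
by rewrite mul0r.
Qed.

Lemma RkE k v I : Rk k v I =
  let i := tnth I (posl k) in let j := tnth I (posr k) in
  if i == j then q * v I
  else v (swap_pos k I) + (if (j < i)%N then (q - q^-1) * v I else 0).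
Proof.
rewrite ffunE /=; under eq_bigr do rewrite Rk_entryE /=.
case: ifP => _.
  by under eq_bigr do rewrite -mulrA; rewrite -mulr_sumr sum_delta.
under eq_bigr do rewrite mulrDl.
rewrite big_split /= sum_delta; congr (_ + _).
case: ifP => _; last by rewrite big1 // => J _; rewrite mul0r.
by under eq_bigr do rewrite -mulrA; rewrite -mulr_sumr sum_delta.
Qed.

Hypothesis q0 : q != 0.

Lemma Rk_quad k (v w : tensor_space) :
  w = Rk k v + q^-1 *: v -> Rk k w + (- q) *: w = 0.
Proof.
move=> wE; have {}wE J : w J = Rk k v J + q^-1 * v J by rewrite wE !ffunE.
apply/ffunP => I; transitivity (Rk k w I - q * w I).
  by rewrite ffunE [X in _ + X]ffunE /GRing.scale /= mulNr.
rewrite [RHS]ffunE RkE /= !wE !RkE /= swap_posl swap_posr swap_posK.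
rewrite (eq_sym (tnth I (posr k))).
case: eqP => [_|/eqP ij]; first by field.
have {}ij : nat_of_ord (tnth I (posl k)) <> tnth I (posr k).
  by move=> /val_inj/eqP; rewrite (negPf ij).
by case: ltngtP ij => //= _ _; field.
Qed.

Lemma swapE k I p : tnth (swap_pos k I) p =
  if p == k :> nat then tnth I (posr k)
  else if p == k.+1 :> nat then tnth I (posl k) else tnth I p.
Proof.
have [pl|pl] := eqVneq (val p) (val k).
  by rewrite (_ : p = posl k) ?swap_posl //; apply: val_inj.
have [pr|pr] := eqVneq (val p) k.+1.
  by rewrite (_ : p = posr k) ?swap_posr //; apply: val_inj.
by rewrite swap_posD.
Qed.

Lemma swap_comm (k k' : 'I_m.-1) I : (k.+1 < k')%N ->
  swap_pos k (swap_pos k' I) = swap_pos k' (swap_pos k I).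
Proof.
move=> kk'; apply: eq_from_tnth => p; rewrite !swapE /=.
by repeat (case: eqP => //); lia.
Qed.

Lemma swap_braid (k k' : 'I_m.-1) I : k' = k.+1 :> nat ->
  swap_pos k (swap_pos k' (swap_pos k I)) =
  swap_pos k' (swap_pos k (swap_pos k' I)).
Proof.
move=> kk'; have rl : posr k = posl k' by apply: val_inj; rewrite /= kk'.
apply: eq_from_tnth => p; rewrite !swapE /= kk' !rl.
by repeat (case: eqP => //); lia.
Qed.

Lemma Rk_comm (k k' : 'I_m.-1) v : (k.+1 < k')%N -> Rk k (Rk k' v) = Rk k' (Rk k v).
Proof.
move=> kk'.
have kl : posl k != posl k' by rewrite -val_eqE /=; lia.
have kr : posl k != posr k' by rewrite -val_eqE /=; lia.
have kl' : posr k != posl k' by rewrite -val_eqE /=; lia.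
have kr' : posr k != posr k' by rewrite -val_eqE /=; lia.
have [lk rk lk' rk'] : [/\ posl k' != posl k, posl k' != posr k,
    posr k' != posl k & posr k' != posr k] by split; rewrite eq_sym.
apply/ffunP => I; rewrite !RkE /= !swap_posD // (swap_comm _ kk').
by do 2!case: eqP => _; do ?case: ifP => _; ring.
Qed.

Lemma Rk_braid (k k' : 'I_m.-1) v : k' = k.+1 :> nat ->
  Rk k (Rk k' (Rk k v)) = Rk k' (Rk k (Rk k' v)).
Proof.
move=> kk'.
have rl : posr k = posl k' by apply: val_inj; rewrite /= kk'.
have n1 : posl k != posl k' by rewrite -val_eqE /=; lia.
have n2 : posl k != posr k' by rewrite -val_eqE /=; lia.
have n3 : posr k' != posl k by rewrite eq_sym.
have n4 : posr k' != posr k by rewrite -val_eqE /=; lia.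
pose A (I : m.-tuple 'I_n) : nat := tnth I (posl k).
pose B (I : m.-tuple 'I_n) : nat := tnth I (posr k).
pose C (I : m.-tuple 'I_n) : nat := tnth I (posr k').
have As I : A (swap_pos k I) = B I by rewrite /A swap_posl.
have Bs I : B (swap_pos k I) = A I by rewrite /B swap_posr.
have Cs I : C (swap_pos k I) = C I by rewrite /C swap_posD.
have At I : A (swap_pos k' I) = A I by rewrite /A swap_posD.
have Bt I : B (swap_pos k' I) = C I by rewrite /B rl swap_posl.
have Ct I : C (swap_pos k' I) = B I by rewrite /B rl /C swap_posr.
have sE w I : Rk k w I = two_pos_op q A B (swap_pos k) w I by exact: RkE.
have tE w I : Rk k' w I = two_pos_op q B C (swap_pos k') w I.
  by rewrite RkE /two_pos_op /B rl.
have sE' w : (Rk k w : _ -> _) = two_pos_op q A B (swap_pos k) w.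
  by apply: funext => I; apply: sE.
have tE' w : (Rk k' w : _ -> _) = two_pos_op q B C (swap_pos k') w.
  by apply: funext => I; apply: tE.
apply/ffunP => I; rewrite sE tE' sE' tE sE' tE'.
exact: (two_pos_op_braid v I q0 As Bs Cs At Bt Ct (@swap_posK k)
  (@swap_posK k') (fun J => swap_braid J kk')).
Qed.

Lemma tensorP s t : @pres_rel K (hecke_pres q (@nat_of_ord m.-1)) s t ->
  @meval K (hecke_pres q (@nat_of_ord m.-1)) tensor_space Rk s =1
  @meval K (hecke_pres q (@nat_of_ord m.-1)) tensor_space Rk t.
Proof.
case=> [x|x y xy|x y xy] v /=.
- by rewrite scale0r; apply: Rk_quad.
- exact: Rk_braid.
- exact: Rk_comm.
Qed.

Definition tensor_module : amodule (Hecke q m) := lift_module tensorP.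

End TensorAction.

(* The matrix entries <i,j| _ |k,l> of the relation R X_1 X_2 = X_1 X_2 R;
   the entry of X_1 X_2 is x_ik x_jl. *)
Inductive rtt_rel (K : fieldType) (q : K) (n : nat) :
    aterm K ('I_n * 'I_n) -> aterm K ('I_n * 'I_n) -> Prop :=
| RTT (i j k l : 'I_n) : rtt_rel q
    (\big[@Add _ _/Cst 0]_(a : 'I_n) \big[@Add _ _/Cst 0]_(b : 'I_n)
       (Cst (Rmat q i j a b) * (Var (a, k) * Var (b, l))))%AT
    (\big[@Add _ _/Cst 0]_(a : 'I_n) \big[@Add _ _/Cst 0]_(b : 'I_n)
       ((Var (i, a) * Var (j, b)) * Cst (Rmat q a b k l)))%AT.

Lemma teval_sum (K : fieldType) (X : Type) (A : algType K) (g : X -> A)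
    (J : finType) (F : J -> aterm K X) :
  teval g (\big[@Add _ _/Cst 0]_(a : J) F a) = \sum_(a : J) teval g (F a).
Proof. by apply: (big_morph (teval g)) => //=; rewrite scale0r. Qed.

Lemma rtt_neq0 (K : fieldType) (q : K) (n : nat) :
  ~ peq (@rtt_rel K q n) (Cst 1) (Cst 0).
Proof.
move/(@teval_peq _ _ _ K^o (fun=> 0)) => /=.
rewrite scale1r scale0r => /(_ _)/eqP; rewrite oner_eq0 => /(_ _)/notF; apply.
move=> _ _ [i j k l]; rewrite !teval_sum !big1 // => a _;
  rewrite teval_sum big1 // => b _ /=.
- by rewrite mulr0 mul0r.
- by rewrite mulr0 mulr0.
Qed.

Definition Aq_pres (K : fieldType) (q : K) (n : nat) : presentation K :=
  Presentation (@rtt_neq0 K q n).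
Definition Aq (K : fieldType) (q : K) (n : nat) : algType K :=
  palg (Aq_pres q n).
Definition Xgen (K : fieldType) (q : K) (n : nat) (i j : 'I_n) : Aq q n :=
  @palg_gen K (Aq_pres q n) (i, j).

Section Immanants.
Variables (K : fieldType) (q : K) (q0 : q != 0) (n : nat).

(* <I| chi X_1 ... X_m |I> = \sum_J <I| chi |J> <J| X_1 ... X_m |I>, and
   <J| X_1 ... X_m |I> = x_(j_1 i_1) ... x_(j_m i_m). *)
Definition Imm (m : nat) (chi : Hecke q m) (I : m.-tuple 'I_n) : Aq q n :=
  \sum_(J : m.-tuple 'I_n)
    bra I (aact (tensor_module n m q0) chi (ket K J)) *:
      \prod_(k < m) Xgen q (tnth J k) (tnth I k).

Definition qdet (m : nat) (I : m.-tuple 'I_n) : Aq q n :=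
  Imm (character (sign_module q (@nat_of_ord m.-1))) I.
Definition qper (m : nat) (I : m.-tuple 'I_n) : Aq q n :=
  Imm (character (triv_module q (@nat_of_ord m.-1))) I.

End Immanants.

Definition qnat (K : fieldType) (q : K) (k : nat) : K := (q ^+ k - 1) / (q - 1).
Definition qfact (K : fieldType) (q : K) (k : nat) : K :=
  \prod_(1 <= i < k.+1) qnat q i.
Definition mq2 (K : fieldType) (q : K) (n : nat) (I : seq 'I_n) : K :=
  \prod_(i : 'I_n) qfact (q ^+ 2) (count_mem i I).

Definition is_partition (r : nat) (lam : seq nat) : bool :=
  [&& sorted geq lam, all (leq 1) lam & sumn lam == r].

Definition nondecr_seq (n : nat) (I : seq 'I_n) : bool :=
  sorted (fun i j : 'I_n => (i <= j)%N) I.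

(* Sequences (I_1,...,I_l) of tuples over [n] with |I_j| = lam_j. *)
Definition tuples_of_shape (n l : nat) (lam : l.-tuple nat) : finType :=
  {dffun forall j : 'I_l, (tnth lam j).-tuple 'I_n}.

Definition is_splitting (n r l : nat) (lam : l.-tuple nat) (I : r.-tuple 'I_n)
    (J : tuples_of_shape n lam) : bool :=
  [forall j, nondecr_seq (J j)]
  && perm_eq (flatten [seq tval (J j) | j : 'I_l]) I.

(* Main.v *)
From HB Require Import structures.
Require Import Defs.
From mathcomp Require Import all_boot all_order all_fingroup all_algebra.
From mathcomp Require Import ring zify.
From mathcomp Require Import boolp classical_sets.
From mathcomp Require Import reals complex.

Set Implicit Arguments.
Unset Strict Implicit.
Unset Printing Implicit Defensive.

Import GRing.Theory.
Local Open Scope ring_scope.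

(** Both families are treated at once: let c be a root of (c - q)(c + 1/q) = 0 and
    induce the module T_i |-> c of the parabolic subalgebra; c = q is the trivial
    and c = -1/q the sign module.  The induced module is the submodule, generated
    by the sorted word |J0>, of the tensor space on l letters with parameter c,
    which has the words J of content lam as a basis.  As \sum_s T_s (x) T_(s^-1)
    intertwines left and right multiplication in H (x) H, the induced character is
      \sum_J T_(w_J) E T_(w_J)^tau,     E = \sum_(u in S_lam) c^(l(u)) T_u,
    where w_J is any word with T_(w_J)|J0> = |J> and tau reverses words.  Choose w_J
    by stably sorting the pairs (i_k, j_k) with respect to J.  Then <I|T_(w_J) is
    q^e <I'|, where I' is the concatenation of the blocks {i_k : j_k = j} and e
    counts the inversions of J between equal entries of I; moving T_(w_J)^tau across
    X_1 ... X_r by the RTT relation gives the same factor on the right.  On I' the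
    operator E factors over the blocks, and summing q^(2e) over the J with given
    blocks gives a product of q^2-multinomial coefficients.  For c = -1/q a block
    with a repeated entry contributes 0. *)

(** * Canonical words of the symmetric group *)

(** [Tperm] multiplies along an arbitrarily chosen reduced word, so characters become computable
    only after Matsumoto's theorem. An explicit list with one reduced word per permutation provides
    it, and turns sums over the group into sums open to induction on the number of letters. Reversed
    words are carried along because a character pairs T_s with T_(s^-1). The vector |J0> behaves
    like the generator of the inducing module because R multiplies a pair of equal letters by c. The
    converse map, from tensors to the induced module, is an average over the group; composed with
    the obvious map it gives the scalar \sum_(u in S_lam) c^(2 l(u)), a Poincare polynomial, and
    this is where q not being a root of unity enters. That I is non-decreasing means that sorting by
    J only exchanges neighbours with i_k <= i_(k+1). On such pairs the (q - 1/q) term of R is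
    absent, so each exchange costs a power of q and creates no further terms. *)

Fixpoint desc (r k : nat) : seq nat :=
  match r, k with
  | r'.+1, k'.+1 => r' :: desc r' k'
  | _, _ => [::]
  end.

(* [cwords r] lists one reduced word for each permutation of r letters; the letter i
   stands for the transposition of the positions i and i+1. *)
Fixpoint cwords (r : nat) : seq (seq nat) :=
  if r is r'.+1 then [seq w ++ desc r' k | w <- cwords r', k <- iota 0 r]
  else [:: [::]].

Lemma desc_rcons r k : (k < r)%N -> desc r k.+1 = rcons (desc r k) (r - k.+1)%N.
Proof.
elim: r k => [|r IHr] [|k] // kr; first by rewrite /= subn1; case: (r).
by rewrite -[LHS]/(r :: desc r k.+1) IHr.
Qed.

Lemma size_desc r k : (k <= r)%N -> size (desc r k) = k.
Proof. by elim: r k => [|r IHr] [|k] //= kr; rewrite IHr. Qed.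

Lemma mem_desc r k i : i \in desc r k -> (r - k <= i < r)%N.
Proof.
elim: r k => [|r IHr] [|k] //=; rewrite inE => /orP[/eqP->|/IHr]; lia.
Qed.

Lemma rev_desc r k : (k <= r)%N -> rev (desc r k) = iota (r - k)%N k.
Proof.
elim: r k => [|r IHr] [|k] // kr.
rewrite [desc _ _]/= rev_cons IHr // subSS -[in RHS]addn1 iotaD cats1.
by congr rcons; lia.
Qed.

Lemma shift_desc b r k : (k <= r)%N ->
  desc (b + r) k = [seq (b + i)%N | i <- desc r k].
Proof.
elim: r k => [|r IHr] [|k] //= kr; rewrite ?addnS /= ?IHr //.
by case: (b + _)%N.
Qed.

(** The word [desc r k] takes the last point to position r - k. These words represent the cosets of
    S_r in S_(r+1) minimally, which is what makes [cwords] recursive. *)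
Lemma cwordsP r w :
  reflect (exists2 c, c \in cwords r & exists2 k, (k <= r)%N & w = c ++ desc r k)
          (w \in cwords r.+1).
Proof.
have -> : cwords r.+1 = [seq c ++ desc r k | c <- cwords r, k <- iota 0 r.+1] by [].
apply: (iffP allpairsP) => [[[c k] /= [cr kr ->]]|[c cr [k kr ->]]].
  by exists c => //; exists k => //; move: kr; rewrite (mem_iota 0 r.+1); lia.
by exists (c, k); rewrite (mem_iota 0 r.+1).
Qed.

Lemma cwords_ltn r w i : w \in cwords r -> i \in w -> (i.+1 < r)%N.
Proof.
elim: r w => [|r IHr] w; first by rewrite inE => /eqP->.
move=> /cwordsP[c cr [k _ ->]]; rewrite mem_cat => /orP[/(IHr _ cr)|/mem_desc]; lia.
Qed.

Lemma size_cwords r : size (cwords r) = r`!.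
Proof.
elim: r => // r IHr.
by rewrite size_allpairs IHr size_iota factS mulnC.
Qed.

(** * Exchange for canonical words in a monoid with braid relations *)

Section BraidWords.
Variables (M : Type) (e : M) (op : Monoid.law e) (T : nat -> M) (N : nat).
Local Infix "∘" := op (at level 40, left associativity).

Let opA x y z : x ∘ (y ∘ z) = x ∘ y ∘ z.
Proof. exact: Monoid.mulmA. Qed.

Definition tw (w : seq nat) : M := \big[op/e]_(i <- w) T i.

Lemma tw_nil : tw [::] = e. Proof. exact: big_nil. Qed.
Lemma tw_cons i w : tw (i :: w) = T i ∘ tw w. Proof. exact: big_cons. Qed.
Lemma tw_cat w w' : tw (w ++ w') = tw w ∘ tw w'. Proof. exact: big_cat. Qed.
Lemma tw_rcons w i : tw (rcons w i) = tw w ∘ T i.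
Proof. by rewrite -cats1 tw_cat tw_cons tw_nil Monoid.mulm1. Qed.

Hypothesis T_braid : forall i, (i.+1 < N)%N ->
  T i ∘ T i.+1 ∘ T i = T i.+1 ∘ T i ∘ T i.+1.
Hypothesis T_comm : forall i j, (i.+1 < j)%N -> (j < N)%N ->
  T i ∘ T j = T j ∘ T i.

Lemma tw_desc_low r k i : (r <= N)%N -> (i.+1 < r - k)%N ->
  tw (desc r k) ∘ T i = T i ∘ tw (desc r k).
Proof.
elim: r k => [|r IHr] [|k] //= rN ik; rewrite ?tw_nil ?Monoid.mulm1 ?Monoid.mul1m //.
by rewrite tw_cons -opA IHr ?opA; try lia; rewrite -(@T_comm i r) //; lia.
Qed.

Lemma tw_low_comm r w i : (r < i)%N -> (i < N)%N -> {in w, forall j, j < r}%N ->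
  tw w ∘ T i = T i ∘ tw w.
Proof.
move=> ri iN; elim: w => [|j w IHw] wr; rewrite ?tw_nil ?Monoid.mulm1 ?Monoid.mul1m
  //.
have jr : (j < r)%N by apply: wr; rewrite mem_head.
rewrite tw_cons -opA IHw => [|j' j'w]; last by apply: wr; rewrite inE j'w orbT.
by rewrite !opA T_comm //; lia.
Qed.

(** Both j and j.+1 occur in [desc r k]: T_(j+1) commutes with the letters below j, one braid move
    turns it into T_j, and T_j commutes with the letters above j.+1. *)
Lemma tw_desc_high r k j : (r <= N)%N -> (k <= r)%N -> (r - k <= j)%N ->
    (j.+1 < r)%N ->
  tw (desc r k) ∘ T j.+1 = T j ∘ tw (desc r k).
Proof.
elim: r k j => [|r IHr] [|k] j //= rN kr kj jr; first by lia.
have [jr'|jr'] := ltnP j.+1 r.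
  rewrite !tw_cons -opA IHr //; try lia.
  by rewrite !opA -(@T_comm j r) //; lia.
have {jr jr'} rE : r = j.+1 by lia.
subst r; case: k kr kj => [|k] kr kj; first by lia.
rewrite /= !tw_cons -!opA (@tw_low_comm j) ?opA //.
  by rewrite T_braid.
by move=> i /mem_desc; lia.
Qed.

(** Exchange property without cancellation: the second alternative factors [c] itself instead of
    cancelling i i, so braid relations suffice. Below r - k - 1 the letter i commutes with the tail
    [desc r k]; at r - k - 1 it lengthens the tail, at r - k it is the last letter of the tail;
    above, it passes through as i - 1. When it has passed the tail, induction applies. *)
Lemma cwords_rcons r c i : (r <= N.+1)%N -> c \in cwords r -> (i.+1 < r)%N ->
  (exists c' : seq nat, [/\ c' \in cwords r, size c' = (size c).+1
                & tw (rcons c i) = tw c'])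
  \/ (exists c' : seq nat, [/\ c' \in cwords r, size c = (size c').+1
                & tw c = tw (rcons c' i)]).
Proof.
elim: r c i => [|r IHr] c i // rN /cwordsP[d dr [k kr ->]] ir.
have ih j : (j.+1 < r)%N -> tw (desc r k) ∘ T i = T j ∘ tw (desc r k) ->
    (exists c' : seq nat, [/\ c' \in cwords r.+1, size c' = (size (d ++ desc r k)).+1
                  & tw (rcons (d ++ desc r k) i) = tw c'])
    \/ (exists c' : seq nat, [/\ c' \in cwords r.+1, size (d ++ desc r k) = (size
      c').+1
                  & tw (d ++ desc r k) = tw (rcons c' i)]).
  move=> jr DT; case: (IHr d j (ltnW rN) dr jr) => -[d' [d'r sd td]].
  - left; exists (d' ++ desc r k); split; [|by rewrite !size_cat sd|].
      by apply/cwordsP; exists d' => //; exists k.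
    by rewrite tw_rcons !tw_cat -td tw_rcons -!opA DT.
  right; exists (d' ++ desc r k); split; [|by rewrite !size_cat sd|].
    by apply/cwordsP; exists d' => //; exists k.
  by rewrite tw_rcons !tw_cat td tw_rcons -!opA DT.
have [ik|ik|ik] := ltngtP i.+1 (r - k).
- by apply: (ih i); rewrite ?tw_desc_low //; lia.
- have [ik'|ik'|ik'] := ltngtP i (r - k); first by lia.
    case: i ir ik ik' ih => [|j] ir ik ik' ih; first by lia.
    by apply: (ih j); rewrite ?tw_desc_high //; lia.
  right; exists (d ++ desc r k.-1).
  have k0 : (0 < k)%N by lia.
  have dE : desc r k = rcons (desc r k.-1) i.
    have := @desc_rcons r k.-1; rewrite (prednK k0) -ik' => -> //; lia.
  split; [|by rewrite dE !size_cat size_rcons addnS|by rewrite dE rcons_cat].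
  by apply/cwordsP; exists d => //; exists k.-1 => //; lia.
- left; exists (d ++ desc r k.+1).
  have dE : desc r k.+1 = rcons (desc r k) i by rewrite desc_rcons; [congr rcons;
    lia|lia].
  split; [|by rewrite dE !size_cat size_rcons addnS|by rewrite dE rcons_cat].
  by apply/cwordsP; exists d => //; exists k.+1 => //; lia.
Qed.

End BraidWords.

(** * Matsumoto's theorem for canonical words *)

Section HeckeWords.
Variables (K : fieldType) (q : K) (r : nat).
Local Notation H := (Hecke q r).

(** Indexing by natural numbers lets words be shifted and concatenated freely; an index out of range
    gives 1. *)
Definition hT (i : nat) : H := oapp (@HeckeT K q r) 1 (insub i).
Definition hw (w : seq nat) : H := \prod_(i <- w) hT i.
Definition sT (i : nat) : 'S_r := oapp (@adj_tperm r) 1%g (insub i).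
Definition sw (w : seq nat) : 'S_r := (\prod_(i <- w) sT i)%g.

Lemma hT_quad i : q != 0 -> (i.+1 < r)%N -> hT i * hT i = 1 + (q - q^-1) *: hT i.
Proof.
move=> q0 ir; rewrite /hT; case: insubP => [k _ _|]; last by lia.
have /= := palg_relE (P := hecke_pres q (@nat_of_ord r.-1))
  (hecke_quad q (@nat_of_ord r.-1) k).
rewrite -[palg_gen _]/(HeckeT q k) scale0r; set t : H := HeckeT q k.
rewrite mulrDl !mulrDr !mulr_algl !mulr_algr !scalerA mulNr mulfV //.
rewrite scaleN1r addrA => /eqP; rewrite subr_eq0 -addrA -scalerDl => /eqP <-.
rewrite -addrA -scalerDl (_ : _ + (q - q^-1) = 0) ?scale0r ?addr0 //; ring.
Qed.

Lemma hT_braid i : (i.+2 < r)%N ->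
  hT i * hT i.+1 * hT i = hT i.+1 * hT i * hT i.+1.
Proof.
move=> ir; rewrite /hT; case: insubP => [k _ kE|]; last by lia.
case: insubP => [j _ jE|]; last by lia.
apply: (palg_relE (P := hecke_pres q (@nat_of_ord r.-1))
  (@hecke_braid _ q _ (@nat_of_ord r.-1) k j _)).
by rewrite -[LHS]/(val j) jE -kE.
Qed.

Lemma hT_comm i j : (i.+1 < j)%N -> (j.+1 < r)%N -> hT i * hT j = hT j * hT i.
Proof.
move=> ij jr; rewrite /hT; case: insubP => [k _ kE|]; last by lia.
case: insubP => [k' _ k'E|]; last by lia.
apply: (palg_relE (P := hecke_pres q (@nat_of_ord r.-1))
  (@hecke_comm _ q _ (@nat_of_ord r.-1) k k' _)).
by rewrite -[X in (_ < X)%N]/(val k') k'E -[X in (X.+1 < _)%N]/(val k) kE.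
Qed.

Lemma sTE i (x : 'I_r) : (i.+1 < r)%N ->
  sT i x = (if x == i :> nat then i.+1 else if x == i.+1 :> nat then i else x)
    :> nat.
Proof.
move=> ir; rewrite /sT; case: insubP => [k _ kE|]; last by lia.
rewrite -kE /= /adj_tperm permE /= -!val_eqE /=.
by case: ifP => //; case: ifP.
Qed.

Lemma sT_sq i : (i.+1 < r)%N -> (sT i * sT i = 1)%g.
Proof.
move=> ir; rewrite /sT; case: insubP => [k _ kE|]; last by lia.
exact: tperm2.
Qed.

Lemma sT_braid i : (i.+2 < r)%N ->
  (sT i * sT i.+1 * sT i = sT i.+1 * sT i * sT i.+1)%g.
Proof.
move=> ir; apply/permP => x; apply: val_inj; rewrite !permM /= !sTE //; try lia.
by repeat (case: eqP => //); lia.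
Qed.

Lemma sT_comm i j : (i.+1 < j)%N -> (j.+1 < r)%N -> (sT i * sT j = sT j * sT i)%g.
Proof.
move=> ij jr; apply/permP => x; apply: val_inj; rewrite !permM /= !sTE //; try lia.
by repeat (case: eqP => //); lia.
Qed.

(* The rewriting of words is run simultaneously in H, in the opposite of H and in
   the symmetric group. *)
Definition trip_op (x y : H * H * 'S_r) : H * H * 'S_r :=
  (x.1.1 * y.1.1, y.1.2 * x.1.2, (x.2 * y.2)%g).
Definition trip1 : H * H * 'S_r := (1, 1, 1%g).

Lemma trip_opA : associative trip_op.
Proof. by move=> x y z; rewrite /trip_op /= !mulrA mulgA. Qed.
Lemma trip_op1l : left_id trip1 trip_op.
Proof. by case=> [[a b] s]; rewrite /trip_op /= mul1r mulr1 mul1g. Qed.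
Lemma trip_op1r : right_id trip1 trip_op.
Proof. by case=> [[a b] s]; rewrite /trip_op /= mul1r mulr1 mulg1. Qed.
HB.instance Definition _ :=
  Monoid.isLaw.Build _ trip1 trip_op trip_opA trip_op1l trip_op1r.

Definition tripT i : H * H * 'S_r := (hT i, hT i, sT i).

Lemma trip_braid j : (j.+1 < r.-1)%N ->
  trip_op (trip_op (tripT j) (tripT j.+1)) (tripT j)
  = trip_op (trip_op (tripT j.+1) (tripT j)) (tripT j.+1).
Proof. by move=> jr; rewrite /trip_op /= !mulrA hT_braid ?sT_braid //; lia. Qed.

Lemma trip_comm j j' : (j.+1 < j')%N -> (j' < r.-1)%N ->
  trip_op (tripT j) (tripT j') = trip_op (tripT j') (tripT j).
Proof.
move=> jj' jr; have jr' : (j'.+1 < r)%N by lia.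
by rewrite /trip_op /= (hT_comm jj' jr') (sT_comm jj' jr').
Qed.

Lemma hw_cat w w' : hw (w ++ w') = hw w * hw w'.
Proof. exact: big_cat. Qed.
Lemma hw_cons i w : hw (i :: w) = hT i * hw w.
Proof. exact: big_cons. Qed.
Lemma hw_nil : hw [::] = 1.
Proof. exact: big_nil. Qed.
Lemma hw_rcons w i : hw (rcons w i) = hw w * hT i.
Proof. by rewrite -cats1 hw_cat hw_cons hw_nil mulr1. Qed.
Lemma sw_cat w w' : (sw (w ++ w') = sw w * sw w')%g.
Proof. exact: big_cat. Qed.
Lemma sw_cons i w : (sw (i :: w) = sT i * sw w)%g.
Proof. exact: big_cons. Qed.
Lemma sw_nil : (sw [::] = 1)%g.
Proof. exact: big_nil. Qed.
Lemma sw_rcons w i : (sw (rcons w i) = sw w * sT i)%g.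
Proof. by rewrite -cats1 sw_cat sw_cons sw_nil mulg1. Qed.

Lemma tw_trip w : tw trip_op tripT w = (hw w, hw (rev w), sw w).
Proof.
elim: w => [|i w IHw]; first by rewrite tw_nil /hw /sw !big_nil.
by rewrite tw_cons IHw /trip_op /= hw_cons sw_cons rev_cons hw_rcons.
Qed.

(** Letters are absorbed one by one through [cwords_rcons]. The shortening alternative cancels i i,
    which is legitimate in the symmetric group but not in H; as it makes the length drop, values in
    H are compared only when the lengths agree. *)
Lemma cwords_reduce (w : seq nat) : {in w, forall i, i.+1 < r}%N ->
  exists c : seq nat, [/\ c \in cwords r, (size c <= size w)%N, sw w = sw c
    & size c = size w -> hw w = hw c /\ hw (rev w) = hw (rev c)].
Proof.
elim/last_ind: w => [|w i IHw] wr.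
  exists [::]; split=> //; elim: (r) => // m IHm.
  by apply/cwordsP; exists [::] => //; exists 0%N => //; case: (m).
have [|c [cr sc wc wcE]] := IHw.
  by move=> j jw; apply: wr; rewrite mem_rcons inE jw orbT.
have ir : (i.+1 < r)%N by apply: wr; rewrite mem_rcons mem_head.
have [] := cwords_rcons trip_braid trip_comm (leqSpred r) cr ir.
- move=> [c' [c'r sc' twc]]; exists c'; split=> //.
  + by rewrite sc' size_rcons.
  + by move: twc; rewrite !tw_trip !sw_rcons wc => -[_ _ <-].
  + rewrite sc' size_rcons => -[/wcE[h1 h2]]; move: twc.
    rewrite !tw_trip !rev_rcons !hw_cons !hw_rcons h1 h2.
    by move=> -[-> -> _].
- move=> [c' [c'r sc' twc]]; exists c'; split=> //.
  + by rewrite size_rcons; move: sc; rewrite sc' => /ltnW/leqW.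
  + move: twc; rewrite !tw_trip !sw_rcons wc => -[_ _ ->].
    by rewrite -mulgA sT_sq // mulg1.
  + by rewrite size_rcons => sE; move: sc; rewrite sc' sE ltnNge leqnSn.
Qed.

Lemma sw_fix m c (x : 'I_r) : (m <= r)%N -> c \in cwords m -> (m <= x)%N -> sw c x =
  x.
Proof.
move=> mr cm mx; have : {in c, forall i, i.+1 < m}%N.
  by move=> i ic; apply: cwords_ltn cm ic.
elim: c {cm} => [|i c IHc] ch; first by rewrite sw_nil perm1.
have im := ch _ (mem_head _ _).
rewrite sw_cons permM (_ : sT i x = x).
  by apply: IHc => j jc; apply: ch; rewrite inE jc orbT.
by apply: val_inj; rewrite /= sTE; [|lia]; case: eqP => [|_]; [lia|case: eqP; lia].
Qed.

Lemma sw_desc m k (x : 'I_r) : (k <= m)%N -> x = m :> nat ->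
  sw (desc m k) x = (m - k)%N :> nat.
Proof.
elim: m k x => [|m IHm] [|k] x //= km xm; rewrite ?sw_nil ?perm1 //.
have xr := ltn_ord x.
rewrite sw_cons permM IHm // sTE; last by lia.
by rewrite xm; case: eqP; [lia|rewrite eqxx].
Qed.

(** In [d ++ desc m k] the factor d fixes the point m, so the image of m is m - k; this recovers k,
    then d by induction. *)
Lemma sw_cwords_inj m : (m <= r)%N -> {in cwords m &, injective sw}.
Proof.
elim: m => [_ c c'|m IHm mr c c' /cwordsP[d dm [k km ->]] /cwordsP[d' d'm [k' k'm
  ->]]].
  by rewrite !inE => /eqP-> /eqP->.
rewrite !sw_cat => sE; have := congr1 (fun s : 'S_r => val (s (Ordinal mr))) sE.
rewrite /= !permM (sw_fix (ltnW mr) dm) // (sw_fix (ltnW mr) d'm) // !sw_desc // =>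
  kE.
have {}kE : k = k' by lia.
by move: sE; rewrite kE => /mulIg/IHm-> //; apply: ltnW.
Qed.

Lemma cwords_uniq m : (m <= r)%N -> uniq (cwords m).
Proof.
elim: m => // m IHm mr; apply: allpairs_uniq; [exact/IHm/ltnW|exact: iota_uniq|].
move=> x y /allpairsP[[d j] [dm jm ->]] /allpairsP[[d' j'] [d'm j'm ->]].
move: dm jm d'm j'm; rewrite !(mem_iota 0 m.+1) /= => dm jm d'm j'm /(congr1 sw).
rewrite !sw_cat => sE; have := congr1 (fun s : 'S_r => val (s (Ordinal mr))) sE.
rewrite /= !permM (sw_fix (ltnW mr) dm) // (sw_fix (ltnW mr) d'm) // !sw_desc // =>
  jE.
have {}jE : j = j' by lia.
by move: sE; rewrite jE => /mulIg /(@sw_cwords_inj m (ltnW mr))->.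
Qed.

Lemma sw_cwords_perm : perm_eq [seq sw c | c <- cwords r] (index_enum 'S_r).
Proof.
have u : uniq [seq sw c | c <- cwords r].
  by rewrite map_inj_in_uniq ?cwords_uniq //; apply: sw_cwords_inj.
apply: uniq_perm => //; first exact: index_enum_uniq.
move=> s; rewrite mem_index_enum.
have cE : #|[seq sw c | c <- cwords r]| = #|'S_r|.
  by rewrite (card_uniqP u) size_map size_cwords card_Sn.
by rewrite (elimT (subset_cardP cE)) // subset_predT.
Qed.

Lemma word_ord (w : seq nat) : {in w, forall i, i.+1 < r}%N ->
  exists w' : seq 'I_r.-1, map val w' = w.
Proof.
elim: w => [|i w IHw] wr; first by exists [::].
have [|w' <-] := IHw; first by move=> j jw; apply: wr; rewrite inE jw orbT.
have ir : (i < r.-1)%N by have := wr _ (mem_head _ _); lia.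
by exists (Ordinal ir :: w').
Qed.

Lemma hw_ord (w : seq 'I_r.-1) : \prod_(i <- w) HeckeT q i = hw (map val w).
Proof. by rewrite /hw big_map; apply: eq_bigr => i _; rewrite /hT valK. Qed.
Lemma sw_ord (w : seq 'I_r.-1) : word_perm w = sw (map val w).
Proof. by rewrite /sw big_map; apply: eq_bigr => i _; rewrite /sT valK. Qed.

Lemma sw_rev (w : seq nat) : {in w, forall i, i.+1 < r}%N -> sw (rev w) = (sw w)^-1%g.
Proof.
elim: w => [|i w IHw] wr; first by rewrite sw_nil invg1.
rewrite rev_cons sw_rcons sw_cons invMg IHw; last first.
  by move=> j jw; apply: wr; rewrite inE jw orbT.
by congr (_ * _)%g; apply/esym/eqP; rewrite eq_invg_mul sT_sq // wr // mem_head.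
Qed.

(** Any reduced word of the permutation reduces to [c] itself, by injectivity of [sw], and without
    loss of length, so the choice in [Tperm] is harmless. For the inverse, the chosen word is
    reversed and the reversed half of [cwords_reduce] applies. *)
Lemma Tperm_cwords c : c \in cwords r ->
  Tperm q (sw c) = hw c /\ Tperm q (sw c)^-1%g = hw (rev c).
Proof.
move=> cr; have cw : {in c, forall i, i.+1 < r}%N by move=> i; apply: cwords_ltn.
have swI := sw_cwords_inj (leqnn r).
have wlt (w : seq 'I_r.-1) : {in map val w, forall i, i.+1 < r}%N.
  by move=> _ /mapP[i _ ->]; rewrite -ltn_predRL; apply: ltn_ord.
have red (w : seq 'I_r.-1) : word_perm w = sw c ->
    (size c <= size w)%N /\
    (size w = size c -> hw (map val w) = hw c /\ hw (rev (map val w)) = hw (rev c)).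
  rewrite sw_ord => wc; have [d [dr sd wd dE]] := cwords_reduce (wlt w).
  have {dr wd} dc : d = c by apply: swI => //; rewrite -wd.
  by move: sd dE; rewrite dc size_map => ? dE; split=> // /esym.
have [c' c'E] := word_ord cw.
have wc' : word_perm c' = sw c by rewrite sw_ord c'E.
have revV (w : seq 'I_r.-1) : word_perm (rev w) = (word_perm w)^-1%g.
  by rewrite !sw_ord map_rev sw_rev.
have TP s w0 : is_reduced_word s w0 ->
    exists2 w, is_reduced_word s w & Tperm q s = hw (map val w).
  move=> w0P; rewrite /Tperm hw_ord; set w := xget _ _; exists w => //.
  exact: (@xgetI _ _ [set w1 | is_reduced_word s w1] _ w0P).
have sc' : size c' = size c by rewrite -c'E size_map.
split.
  have [|w [wP wmin] ->] := TP (sw c) c'.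
    by split=> // w /red[]; rewrite -sc'.
  have [sc scE] := red w wP.
  by have [] // := scE _; apply/eqP; rewrite eqn_leq sc -sc' wmin.
have [|w [wP wmin] ->] := TP (sw c)^-1%g (rev c').
  split=> [|w wP]; first by rewrite revV wc'.
  have /red[] : word_perm (rev w) = sw c by rewrite revV wP invgK.
  by rewrite !size_rev sc'.
have [|sc scE] := red (rev w); first by rewrite revV wP invgK.
have [|_] := scE _; last by rewrite -map_rev revK.
apply/eqP; rewrite eqn_leq sc size_rev -sc' -(size_rev c') wmin //.
by rewrite revV wc'.
Qed.

Lemma sum_Tperm (U : nmodType) (G : H -> H -> U) :
  \sum_(s : 'S_r) G (Tperm q s) (Tperm q s^-1%g)
  = \sum_(c <- cwords r) G (hw c) (hw (rev c)).
Proof.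
rewrite -(perm_big _ sw_cwords_perm) big_map /=; apply: eq_big_seq => c cr.
by have [-> ->] := Tperm_cwords cr.
Qed.

End HeckeWords.

(** * The Casimir element of the Hecke algebra *)

Section Casimir.
Variables (K : fieldType) (q : K) (q0 : q != 0) (r : nat).
Local Notation H := (Hecke q r).
Local Notation hT := (@hT K q r).
Local Notation hw := (@hw K q r).

Lemma hw_desc_low m k i : (m < r)%N -> (i.+1 < m - k)%N ->
  hw (desc m k) * hT i = hT i * hw (desc m k)
  /\ hT i * hw (rev (desc m k)) = hw (rev (desc m k)) * hT i.
Proof.
move=> mr ik; have mr' : (m <= r.-1)%N by lia.
have := tw_desc_low (@trip_comm K q r) mr' ik.
by rewrite tw_trip /= /trip_op /= => -[-> -> _].
Qed.

Lemma hw_desc_high m k j : (m < r)%N -> (k <= m)%N -> (m - k <= j)%N ->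
    (j.+1 < m)%N ->
  hw (desc m k) * hT j.+1 = hT j * hw (desc m k)
  /\ hT j.+1 * hw (rev (desc m k)) = hw (rev (desc m k)) * hT j.
Proof.
move=> mr km kj jm; have mr' : (m <= r.-1)%N by lia.
have := tw_desc_high (@trip_braid K q r) (@trip_comm K q r) mr' km kj jm.
by rewrite tw_trip /= /trip_op /= => -[-> -> _].
Qed.

(** Such maps are the additive maps out of the K-tensor product H (x) H; quantifying over them
    states identities of H (x) H without constructing it. *)
Definition balanced (U : zmodType) (B : H -> H -> U) :=
  [/\ forall a a' b, B (a + a') b = B a b + B a' b,
      forall a b b', B a (b + b') = B a b + B a b'
    & forall x a b, B (x *: a) b = B a (x *: b)].

Lemma balanced_mul (U : zmodType) (B : H -> H -> U) (x y : H) :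
  balanced B -> balanced (fun a b => B (a * x) (y * b)).
Proof.
case=> B1 B2 B3; split=> *; first by rewrite mulrDl B1.
  by rewrite mulrDr B2.
by rewrite -scalerAl B3 scalerAr.
Qed.

Lemma sum_cwordsS (U : zmodType) (F : seq nat -> U) m :
  \sum_(c <- cwords m.+1) F c
  = \sum_(k < m.+1) \sum_(c <- cwords m) F (c ++ desc m k).
Proof.
rewrite exchange_big [LHS]big_allpairs_dep; apply: eq_bigr => c _.
by rewrite -(big_mkord xpredT (fun k => F (c ++ desc m k))) /index_iota subn0.
Qed.

(* The element \sum_s T_s (x) T_(s^-1) of H (x) H intertwines left and right
   multiplications. *)
Lemma casimir_gen m (U : zmodType) (B : H -> H -> U) i :
    (m <= r)%N -> (i.+1 < m)%N -> balanced B ->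
  \sum_(c <- cwords m) B (hw c * hT i) (hw (rev c))
  = \sum_(c <- cwords m) B (hw c) (hT i * hw (rev c)).
Proof.
elim: m i B => // m IHm i B mr im Bb; have [B1 B2 B3] := Bb.
rewrite !sum_cwordsS.
pose F (k : nat) := \sum_(c <- cwords m) B (hw (c ++ desc m k) * hT i)
                                           (hw (rev (c ++ desc m k))).
pose G (k : nat) := \sum_(c <- cwords m) B (hw (c ++ desc m k))
                                           (hT i * hw (rev (c ++ desc m k))).
rewrite -/(\sum_(k < m.+1) F k) -/(\sum_(k < m.+1) G k).
have pass j k : (j.+1 < m)%N ->
    hw (desc m k) * hT i = hT j * hw (desc m k)
    /\ hT i * hw (rev (desc m k)) = hw (rev (desc m k)) * hT j -> F k = G k.
  move=> jm [DT TD]; have := IHm j (fun a b => B (a * hw (desc m k))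
    (hw (rev (desc m k)) * b)) (ltnW mr) jm (balanced_mul _ _ Bb).
  rewrite /F /G => E; transitivity (\sum_(c <- cwords m)
      B (hw c * hT j * hw (desc m k)) (hw (rev (desc m k)) * hw (rev c))).
    by apply: eq_bigr => c _; rewrite rev_cat !hw_cat -mulrA DT mulrA.
  rewrite {}E; apply: eq_bigr => c _.
  by rewrite rev_cat !hw_cat mulrA -TD mulrA.
(* For every k but m - i.+1 and m - i, T_i passes through [desc m k]. These two tails differ by a
   final letter i, and their joint contribution is symmetric by the quadratic relation. *)
have k1m : (m - i.+1 < m.+1)%N by lia.
have k2m : (m - i < m.+1)%N by lia.
have k12 : Ordinal k2m != Ordinal k1m by rewrite -val_eqE /=; lia.
rewrite (bigD1 (Ordinal k1m)) //= (bigD1 (Ordinal k2m)) //= [RHS](bigD1 (Ordinal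
  k1m)) //=.
rewrite [in RHS](bigD1 (Ordinal k2m)) //= !addrA; congr (_ + _); last first.
  apply: eq_bigr => -[k /= km]; rewrite -!val_eqE /= => /andP[k1 k2].
  have [ik|ik] := ltnP i.+1 (m - k).
    by apply: (pass i); [lia|apply: hw_desc_low].
  case: i im F G pass k1m k2m k12 k1 k2 ik => [|j] im F G pass k1m k2m k12 k1 k2 ik.
    by exfalso; lia.
  by apply: (pass j); [lia|apply: hw_desc_high; lia].
rewrite /F /G -!big_split /=; apply: eq_bigr => c _.
have k2E : (m - i = (m - i.+1).+1)%N by lia.
have DE : desc m (m - i) = rcons (desc m (m - i.+1)) i.
  by rewrite k2E desc_rcons; [congr rcons; lia|lia].
rewrite DE -rcons_cat rev_rcons hw_cons hw_rcons; set x := hw _; set y := hw _.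
have ir : (i.+1 < r)%N by lia.
rewrite -[x * hT i * hT i]mulrA [hT i * (hT i * y)]mulrA hT_quad //.
rewrite mulrDr mulrDl mulr1 mul1r -scalerAr -scalerAl B1 B2 B3 addrCA !addrA.
by congr (_ + _); rewrite addrC.
Qed.

Lemma casimir (U : zmodType) (B : H -> H -> U) (w : seq nat) :
    {in w, forall i, i.+1 < r}%N -> balanced B ->
  \sum_(c <- cwords r) B (hw c * hw w) (hw (rev c))
  = \sum_(c <- cwords r) B (hw c) (hw w * hw (rev c)).
Proof.
elim: w B => [|i w IHw] B wr Bb.
  by rewrite hw_nil; apply: eq_bigr => c _; rewrite mulr1 mul1r.
have ir := wr _ (mem_head _ _).
have {}wr : {in w, forall i, i.+1 < r}%N by move=> j jw; apply: wr;
  rewrite inE jw orbT.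
have := casimir_gen (leqnn r) ir (balanced_mul (hw w) 1 Bb).
under eq_bigr do rewrite mul1r -mulrA -hw_cons.
under [in RHS]eq_bigr do rewrite mul1r.
move=> ->; transitivity (\sum_(c <- cwords r) B (hw c * hw w) (hT i * hw (rev c))).
  by apply: eq_bigr => c _.
have /= := IHw _ wr (balanced_mul 1 (hT i) Bb).
under eq_bigr do rewrite mulr1; under [in RHS]eq_bigr do rewrite mulr1.
by move=> ->; apply: eq_bigr => c _; rewrite hw_cons mulrA.
Qed.

(** The substitution s -> s^-1 swaps the two tensor factors, which turns this into [casimir] for the
    flipped map. *)
Lemma casimir_flip (U : zmodType) (B : H -> H -> U) (w : seq nat) :
    {in w, forall i, i.+1 < r}%N -> balanced B ->
  \sum_(c <- cwords r) B (hw w * hw c) (hw (rev c))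
  = \sum_(c <- cwords r) B (hw c) (hw (rev c) * hw w).
Proof.
move=> wr [B1 B2 B3].
have Bb : balanced (fun a b => B b a) by split=> *; rewrite ?B1 ?B2 ?B3.
have flip (G : H -> H -> U) : \sum_(c <- cwords r) G (hw c) (hw (rev c))
    = \sum_(c <- cwords r) G (hw (rev c)) (hw c).
  rewrite -sum_Tperm -(sum_Tperm (fun a b => G b a)).
  rewrite (reindex_inj invg_inj); apply: eq_bigr => s _.
  by rewrite invgK.
rewrite (flip (fun a b => B (hw w * a) b)) (flip (fun a b => B a (b * hw w))).
by rewrite (casimir wr Bb).
Qed.

End Casimir.

(** * R-matrices on words and the RTT relation *)

Section ListOperators.
Variables (K : fieldType) (c : K) (n : nat).
Implicit Types (U : lmodType K) (I L s t : seq 'I_n) (w : seq nat).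

(* [lop i Phi I] is the I-th coordinate of the tensor obtained by applying R, with
   parameter c, to the factors i and i+1 of the tensor with coordinates Phi. *)
Fixpoint lop U (i : nat) (Phi : seq 'I_n -> U) (I : seq 'I_n) : U :=
  match i, I with
  | 0, x :: y :: t =>
      if x == y then c *: Phi I
      else Phi (y :: x :: t) + (if (y < x)%N then (c - c^-1) *: Phi I else 0)
  | i'.+1, x :: t => lop i' (fun L => Phi (x :: L)) t
  | _, _ => Phi I
  end.

(** The head of the word acts last, as in the left action of [hw w]. Values lie in any module, so
    that Phi may be the coordinates of a tensor or the entries of X_1 ... X_r. *)
Definition lopw U (w : seq nat) (Phi : seq 'I_n -> U) : seq 'I_n -> U :=
  foldr (fun i => lop i) Phi w.

Lemma lopw_cat U w w' (Phi : seq 'I_n -> U) : lopw (w ++ w') Phi = lopw w (lopw w'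
  Phi).
Proof. exact: foldr_cat. Qed.

Lemma lop_catl U i s t (Phi : seq 'I_n -> U) :
  lop (size s + i) Phi (s ++ t) = lop i (fun L => Phi (s ++ L)) t.
Proof. by elim: s Phi => //= x s IHs Phi; rewrite IHs. Qed.

Lemma lop_catr U i s t (Phi : seq 'I_n -> U) : (i.+1 < size s)%N ->
  lop i Phi (s ++ t) = lop i (fun L => Phi (L ++ t)) s.
Proof.
elim: i s Phi => [|i IHi] [|x s] Phi //= si; first by case: s si.
by rewrite IHi.
Qed.

Lemma lop_at U s (x y : 'I_n) t (Phi : seq 'I_n -> U) :
  lop (size s) Phi (s ++ x :: y :: t) =
    if x == y then c *: Phi (s ++ x :: y :: t)
    else Phi (s ++ y :: x :: t)
         + (if (y < x)%N then (c - c^-1) *: Phi (s ++ x :: y :: t) else 0).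
Proof. by rewrite -[size s]addn0 lop_catl. Qed.

(** On a weakly increasing pair the (c - 1/c) term is absent and R acts monomially; the inequalities
    in [sorts_step] are there to stay in this case. *)
Lemma lop_le U s (x y : 'I_n) t (Phi : seq 'I_n -> U) : (x <= y)%N ->
  lop (size s) Phi (s ++ x :: y :: t) = c ^+ (x == y) *: Phi (s ++ y :: x :: t).
Proof.
move=> xy; rewrite lop_at; case: eqP => [->|_]; first by rewrite expr1.
by rewrite ltnNge xy /= addr0 expr0 scale1r.
Qed.

(** R preserves content, so only rearrangements of I matter; in particular lengths may be assumed
    when rewriting under [lop]. *)
Lemma eq_lop U i (Phi Psi : seq 'I_n -> U) I :
  (forall L, perm_eq L I -> Phi L = Psi L) -> lop i Phi I = lop i Psi I.
Proof.
elim: i Phi Psi I => [|i IHi] Phi Psi [|x t] PP /=; try exact: PP.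
  case: t PP => [|y t] PP; first exact: PP.
  rewrite (PP [:: x, y & t]) // (PP [:: y, x & t]) //.
  by rewrite -[_ :: _]/([:: y; x] ++ t) -[X in perm_eq _ X]/([:: x; y] ++ t)
    perm_cat2r (perm_catC [:: y]).
by apply: IHi => L Lt; apply: PP; rewrite perm_cons.
Qed.

Lemma eq_lopw U w (Phi Psi : seq 'I_n -> U) I :
  (forall L, perm_eq L I -> Phi L = Psi L) -> lopw w Phi I = lopw w Psi I.
Proof.
elim: w I => [|i w IHw] I PP; first exact: PP.
by apply: eq_lop => L LI; apply: IHw => L' L'L; apply/PP/(perm_trans L'L).
Qed.

Lemma lop_morph U U' (f : U -> U') i Phi I :
    (forall x y, f (x + y) = f x + f y) -> (forall a x, f (a *: x) = a *: f x) ->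
  lop i (fun L => f (Phi L)) I = f (lop i Phi I).
Proof.
move=> fD fZ; have f0 : f 0 = 0 by rewrite -(scale0r 0) fZ scale0r.
elim: i Phi I => [|i IHi] Phi [|x t] //=; case: t => [|y t] //.
by case: ifP => _; [rewrite fZ|case: ifP; rewrite fD ?fZ ?f0].
Qed.

Lemma lopw_morph U U' (f : U -> U') w Phi I :
    (forall x y, f (x + y) = f x + f y) -> (forall a x, f (a *: x) = a *: f x) ->
  lopw w (fun L => f (Phi L)) I = f (lopw w Phi I).
Proof.
move=> fD fZ; elim: w I => [|i w IHw] I //=.
by rewrite -lop_morph //; apply: eq_lop => L _; apply: IHw.
Qed.

Lemma lopwZ U a w (Phi : seq 'I_n -> U) I :
  lopw w (fun L => a *: Phi L) I = a *: lopw w Phi I.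
Proof.
apply: (lopw_morph (f := fun x => a *: x)) => [x y|b x]; first exact: scalerDr.
by rewrite !scalerA mulrC.
Qed.

Lemma lopw_shift U w s t (Phi : seq 'I_n -> U) :
  lopw [seq (size s + i)%N | i <- w] Phi (s ++ t)
  = lopw w (fun L => Phi (s ++ L)) t.
Proof.
elim: w t => //= i w IHw t; rewrite lop_catl; apply: eq_lop => L _; exact: IHw.
Qed.

Lemma lopw_catr U w s t (Phi : seq 'I_n -> U) :
    {in w, forall i, i.+1 < size s}%N ->
  lopw w Phi (s ++ t) = lopw w (fun L => Phi (L ++ t)) s.
Proof.
elim: w s => //= i w IHw s ws; rewrite lop_catr ?ws ?mem_head //.
apply: eq_lop => L /perm_size sL; apply: IHw => j jw.
by rewrite sL; apply: ws; rewrite inE jw orbT.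
Qed.

Section Tuples.
Variable m : nat.
Implicit Types (k : 'I_m.-1) (J : m.-tuple 'I_n).

Lemma split_at k J : tval J = take k J ++ tnth J (posl k) :: tnth J (posr k) :: drop
  k.+2 J.
Proof.
have km : (k.+1 < m)%N := ltn_pred_ordS k.
rewrite -{1}(cat_take_drop k J) (drop_nth (tnth J (posl k))) ?size_tuple ?(ltnW km)
  //.
rewrite (drop_nth (tnth J (posl k))) ?size_tuple //.
by rewrite -[k : nat]/(posl k : nat) -tnth_nth /= -[k.+1]/(posr k : nat) -tnth_nth.
Qed.

Lemma size_take_pos k J : size (take k J) = k.
Proof. by rewrite size_takel // size_tuple ltnW // (ltn_pred_ord k). Qed.

Lemma val_swap_pos k J :
  tval (swap_pos k J) = take k J ++ tnth J (posr k) :: tnth J (posl k) :: drop k.+2 J.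
Proof.
have x0 : 'I_n := tnth J (posl k).
rewrite (split_at k (swap_pos k J)) swap_posl swap_posr; congr (_ ++ _ :: _ :: _).
- apply: (@eq_from_nth _ x0).
    by rewrite !size_take_pos.
  rewrite size_take_pos => i ik; rewrite !nth_take //.
  have im : (i < m)%N := ltn_trans ik (ltn_pred_ord k).
  have := swapE k J (Ordinal im).
  rewrite !(tnth_nth x0) /= => ->.
  by rewrite ltn_eqF // ltn_eqF // ltnW.
- apply: (@eq_from_nth _ x0).
    by rewrite !size_drop !size_tuple.
  rewrite size_drop size_tuple => i ik; rewrite !nth_drop.
  have im : (k.+2 + i < m)%N by lia.
  have := swapE k J (Ordinal im).
  rewrite !(tnth_nth x0) /= => ->.
  by case: eqP; [lia|]; case: eqP; [lia|].
Qed.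

Lemma lop_tuple U k J (Phi : seq 'I_n -> U) :
  lop k Phi J =
    if tnth J (posl k) == tnth J (posr k) then c *: Phi J
    else Phi (swap_pos k J)
      + (if (tnth J (posr k) < tnth J (posl k))%N then (c - c^-1) *: Phi J else 0).
Proof.
have := lop_at (take k J) (tnth J (posl k)) (tnth J (posr k)) (drop k.+2 J) Phi.
by rewrite size_take_pos -split_at -val_swap_pos.
Qed.

(** The family v with coefficients u covers both a single tensor (one index, u = 1) and the sum over
    all kets in [Imm]. *)
Lemma Rk_lop (F : finType) U (v : F -> tensor_space K n m) (u : F -> U)
    (Phi : seq 'I_n -> U) k J :
    (forall L : m.-tuple 'I_n, \sum_x v x L *: u x = Phi L) ->
  \sum_x Rk c n k (v x) J *: u x = lop k Phi J.
Proof.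
move=> PhiE; rewrite lop_tuple -!PhiE; under eq_bigr do rewrite RkE /=.
case: ifP => _; first by rewrite scaler_sumr; apply: eq_bigr => x _; rewrite scalerA.
under eq_bigr do rewrite scalerDl; rewrite big_split /=; congr (_ + _).
case: ifP => _; last by rewrite big1 // => x _; rewrite scale0r.
by rewrite scaler_sumr; apply: eq_bigr => x _; rewrite scalerA.
Qed.

End Tuples.

End ListOperators.

(** * The RTT relation on words *)

Section RTT.
Variables (K : fieldType) (q : K) (n : nat).
Local Notation X := (@Xgen K q n).

Lemma sum_Rmat (U : lmodType K) (G : 'I_n -> 'I_n -> U) i j :
  \sum_a \sum_b Rmat q i j a b *: G a b =
    if i == j then q *: G i j
    else G j i + (if (j < i)%N then (q - q^-1) *: G i j else 0).
Proof.
have delta x y (g : K) : \sum_a \sum_b (g * ((a == x) && (b == y))%:R) *: G a b = g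
  *: G x y.
  rewrite (bigD1 x) //= [X in _ + X]big1 ?addr0 => [|a /negPf ax]; last first.
    by rewrite big1 // => b _; rewrite ax mulr0 scale0r.
  rewrite (bigD1 y) //= !eqxx mulr1 big1 ?addr0 // => b /negPf by_.
  by rewrite by_ mulr0 scale0r.
rewrite /Rmat; case: eqP => [->|/eqP ij] /=.
  rewrite -delta; apply: eq_bigr => a _; apply: eq_bigr => b _.
  by rewrite ltnn /= mulr0 !addr0.
case: ifP => ji /=; last first.
  rewrite -[in RHS](scale1r (G j i)) -delta addr0; apply: eq_bigr => a _.
  by apply: eq_bigr => b _; rewrite !mulr0 add0r addr0 mul1r.
rewrite -[in RHS](scale1r (G j i)) -!delta -big_split; apply: eq_bigr => a _ /=.
by rewrite -big_split; apply: eq_bigr => b _ /=; rewrite -scalerDl mulr0 add0r mul1r.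
Qed.

Lemma Rmat_sym (i j k l : 'I_n) : Rmat q i j k l = Rmat q k l i j.
Proof.
rewrite /Rmat; congr (_ * (nat_of_bool _)%:R + (nat_of_bool _)%:R + _ * (nat_of_bool
  _)%:R).
- by apply/and3P/and3P => -[/eqP-> /eqP-> /eqP->].
- by apply/and3P/and3P => -[ij /eqP kj /eqP li]; rewrite kj li !eqxx eq_sym; split.
- by apply/and3P/and3P => -[ij /eqP kj /eqP li]; rewrite kj li !eqxx; split.
Qed.

(** By [Rmat_sym], R has the same shape on the column indices as on the row indices. *)
Lemma rttE i j k l :
  (if i == j then q *: (X i k * X j l)
   else X j k * X i l + (if (j < i)%N then (q - q^-1) *: (X i k * X j l) else 0))
  = (if k == l then q *: (X i k * X j l)
     else X i l * X j k
       + (if (l < k)%N then (q - q^-1) *: (X i k * X j l) else 0)).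
Proof.
rewrite -(sum_Rmat (fun a b => X a k * X b l)) -(sum_Rmat (fun a b => X i a * X j b)).
have := palg_relE (P := Aq_pres q n) (RTT q i j k l); rewrite !teval_sum => E.
transitivity (\sum_a teval (@palg_gen K (Aq_pres q n))
  (\big[@Add _ _/Cst 0]_(b < n) (Cst (Rmat q i j a b) * (Var (a, k) * Var (b,
    l)))%AT)).
  apply: eq_bigr => a _; rewrite teval_sum; apply: eq_bigr => b _ /=.
  by rewrite mulr_algl.
rewrite {}E; apply: eq_bigr => a _; rewrite teval_sum; apply: eq_bigr => b _ /=.
by rewrite mulr_algr Rmat_sym.
Qed.

Definition Xw (P L : seq 'I_n) : Aq q n := \prod_(p <- zip L P) X p.1 p.2.

Lemma Xw_cons p P a L : Xw (p :: P) (a :: L) = X a p * Xw P L.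
Proof. exact: big_cons. Qed.

Lemma Xw_cat P P' L L' : size L = size P -> Xw (P ++ P') (L ++ L') = Xw P L * Xw P'
  L'.
Proof. by move=> sLP; rewrite /Xw zip_cat // big_cat. Qed.

(** By RTT, R crosses from the rows to the columns, where it acts monomially since x <= y. *)
Lemma lop_Xw P (x y : 'I_n) P' L : (x <= y)%N -> size L = size (P ++ x :: y :: P') ->
  lop q (size P) (Xw (P ++ x :: y :: P')) L
  = q ^+ (x == y) *: Xw (P ++ y :: x :: P') L.
Proof.
move=> xy; elim: P L => [|p P IHP] [|a L] //=; last first.
  move=> [sL]; rewrite Xw_cons scalerAr -IHP //.
  transitivity (lop q (size P) (fun L' => X a p * Xw (P ++ x :: y :: P') L') L).
    by apply: eq_lop => L' _; rewrite Xw_cons.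
  by apply: (@lop_morph _ q n (Aq q n) (Aq q n) (fun u => X a p * u)) => *;
    rewrite ?mulrDr // scalerAr.
case: L => [|b L] // [sL]; have := rttE a b x y; rewrite !Xw_cons !mulrA.
move=> /(congr1 (fun u => u * Xw P' L)).
rewrite (ltnNge y x) xy /= addr0 => E.
have -> : q ^+ (x == y) *: (X a y * X b x * Xw P' L)
    = (if x == y then q *: (X a x * X b y * Xw P' L) else X a y * X b x * Xw P' L).
  by case: eqP => [->|_]; rewrite ?expr1 // expr0 scale1r.
have -> : (if x == y then q *: (X a x * X b y * Xw P' L) else X a y * X b x * Xw P' L)
    = (if x == y then q *: (X a x * X b y) else X a y * X b x) * Xw P' L.
  by case: ifP => _; rewrite ?scalerAl.
rewrite -E; case: ifP => _; first by rewrite -scalerAl.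
by rewrite mulrDl; case: ifP => _; rewrite ?mul0r // -scalerAl.
Qed.

Lemma Xw_tuple m (P L : m.-tuple 'I_n) :
  \prod_(k < m) X (tnth L k) (tnth P k) = Xw P L.
Proof.
elim: m P L => [|m IHm] P L; first by rewrite big_ord0 (tuple0 P) (tuple0 L) /Xw
  big_nil.
case/tupleP: P => p P; case/tupleP: L => a L; rewrite /= Xw_cons big_ord_recl !tnth0.
by rewrite -IHm; congr (_ * _); apply: eq_bigr => k _; rewrite !tnthS.
Qed.

End RTT.

(** * Tensor space with parameter c as a module over H *)

Section TensorModules.
Variables (K : fieldType) (q c : K) (n r : nat).
Local Notation H := (Hecke q r).
Local Notation V := (tensor_space K n r).

Lemma act_hw (act : H -> V -> V) (F : finType) (U : lmodType K) (v : F -> V)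
    (u : F -> U) (Phi : seq 'I_n -> U) (w : seq nat) (I : r.-tuple 'I_n) :
    (forall x, act 1 x = x) -> (forall a b x, act (a * b) x = act a (act b x)) ->
    (forall k x, act (HeckeT q k) x = Rk c n k x) ->
    {in w, forall i, i.+1 < r}%N ->
    (forall L : r.-tuple 'I_n, \sum_x v x L *: u x = Phi L) ->
  \sum_x act (hw q r w) (v x) I *: u x = lopw c w Phi I.
Proof.
move=> act1 actM actT; elim: w I => [|i w IHw] I wr PhiE.
  by rewrite hw_nil /= -PhiE; apply: eq_bigr => x _; rewrite act1.
have ir := wr _ (mem_head _ _).
have {}ir : (i < r.-1)%N by lia.
have {}wr : {in w, forall i, i.+1 < r}%N.
  by move=> j jw; apply: wr; rewrite inE jw orbT.
rewrite hw_cons /hT insubT /=.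
under eq_bigr do rewrite actM actT.
by apply: (@Rk_lop _ c _ _ _ _ (fun x => act (hw q r w) (v x))) => L; apply: IHw.
Qed.

Hypothesis cP : (c - q) * (c + q^-1) = 0.

Lemma root_neq0 : q != 0 -> c != 0.
Proof.
move=> q0; apply: contra_eq_neq cP => ->.
by rewrite sub0r add0r mulNr mulfV // oppr_eq0 oner_eq0.
Qed.

Hypothesis q0 : q != 0.

(** The relation (T - q)(T + 1/q) = 0 is invariant under q -> -1/q, so R with parameter c satisfies
    it for either root c. *)
Lemma tensorP_root s t : @pres_rel K (hecke_pres q (@nat_of_ord r.-1)) s t ->
  @meval K (hecke_pres q (@nat_of_ord r.-1)) V (@Rk K c n r) s =1
  @meval K (hecke_pres q (@nat_of_ord r.-1)) V (@Rk K c n r) t.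
Proof.
case=> [x|x y xy|x y xy] v /=.
- rewrite scale0r; have /eqP := cP; rewrite mulf_eq0 subr_eq0 addr_eq0.
  move=> /orP[]/eqP cE; first by rewrite cE; apply: Rk_quad.
  have c0 := root_neq0 q0; have E := Rk_quad c0 (k := x) (v := v) erefl.
  rewrite -[RHS]E !linearD !linearZ /= ?scalerDr !scalerA cE invrN invrK.
  rewrite opprK mulNr mulfV // mulrN mulVf // -!addrA; congr (_ + _).
  by rewrite addrCA.
- exact: (Rk_braid (root_neq0 q0)).
- exact: (Rk_comm (root_neq0 q0)).
Qed.

Definition root_module : amodule H := lift_module tensorP_root.

Lemma root_moduleT k (v : V) : aact root_module (HeckeT q k) v = Rk c n k v.
Proof.
exact: (@lift_actE K (hecke_pres q (@nat_of_ord r.-1)) V _ tensorP_root (Var k)).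
Qed.

End TensorModules.

Section Immanants.
Variables (K : fieldType) (q : K) (q0 : q != 0) (n r : nat).

Lemma tensor_moduleT k (v : tensor_space K n r) :
  aact (tensor_module n r q0) (HeckeT q k) v = Rk q n k v.
Proof.
exact: (@lift_actE K (hecke_pres q (@nat_of_ord r.-1)) _ _ (tensorP q0) (Var k)).
Qed.

Lemma ImmD (chi chi' : Hecke q r) (I : r.-tuple 'I_n) :
  Imm q0 (chi + chi') I = Imm q0 chi I + Imm q0 chi' I.
Proof.
rewrite /Imm; under eq_bigr do rewrite aactDl /bra ffunE scalerDl.
by rewrite big_split.
Qed.

Lemma ImmZ a (chi : Hecke q r) (I : r.-tuple 'I_n) :
  Imm q0 (a *: chi) I = a *: Imm q0 chi I.
Proof.
rewrite /Imm scaler_sumr; apply: eq_bigr => J _.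
by rewrite aactZl /bra ffunE scalerA.
Qed.

Lemma Imm_sum (F : Type) (s : seq F) (P : pred F) (chi : F -> Hecke q r)
    (I : r.-tuple 'I_n) :
  Imm q0 (\sum_(x <- s | P x) chi x) I = \sum_(x <- s | P x) Imm q0 (chi x) I.
Proof.
apply: (big_morph (fun chi => Imm q0 chi I)) => [chi1 chi2|]; first exact: ImmD.
by rewrite -(scale0r 0) ImmZ scale0r.
Qed.

Lemma Imm_hw (w : seq nat) (I : r.-tuple 'I_n) : {in w, forall i, i.+1 < r}%N ->
  Imm q0 (hw q r w) I = lopw q w (Xw q I) I.
Proof.
move=> wr; rewrite /Imm; under eq_bigr do rewrite Xw_tuple.
apply: (@act_hw _ q q n r (aact (tensor_module n r q0)) _ _ (@ket K n r)) => //.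
- exact: (@aact1 _ _ (tensor_module n r q0)).
- exact: (@aactM _ _ (tensor_module n r q0)).
- exact: tensor_moduleT.
move=> L; rewrite (bigD1 L) //= ffunE eqxx scale1r big1 ?addr0 // => J /negPf JL.
by rewrite ffunE eq_sym JL scale0r.
Qed.

End Immanants.

(** * Traces and characters *)

Section Trace.
Variables (K : fieldType) (V : lmodType K).

Lemma basis_matP d (e : 'I_d -> V) d' (v : 'I_d' -> V) : is_basis e ->
  exists A : 'M[K]_(d, d'), forall j, v j = \sum_i A i j *: e i.
Proof.
move=> eb; have /choice[f fP] : forall j, exists c : {ffun 'I_d -> K}, v j = \sum_i
  c i *: e i.
  by move=> j; have [c [cE _]] := eb (v j); exists c.
by exists (\matrix_(i, j) f j i) => j; rewrite [LHS]fP; apply: eq_bigr => i _;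
  rewrite mxE.
Qed.

Lemma basis_mat_inj d (e : 'I_d -> V) d' (A B : 'M[K]_(d, d')) : is_basis e ->
  (forall j, \sum_i A i j *: e i = \sum_i B i j *: e i) -> A = B.
Proof.
move=> eb AB; apply/matrixP => i j; have [c [_ cU]] := eb (\sum_i A i j *: e i).
have cA : c = [ffun i => A i j].
  by apply: cU; apply: eq_bigr => k _; rewrite ffunE.
have cB : c = [ffun i => B i j].
  by apply: cU; rewrite AB; apply: eq_bigr => k _; rewrite ffunE.
by have := congr1 (fun f : {ffun _} => f i) cB; rewrite cA !ffunE.
Qed.

Lemma comb_mulmx d (e : 'I_d -> V) d' (f : 'I_d' -> V) d'' (A : 'M[K]_(d, d'))
    (B : 'M[K]_(d', d'')) j : (forall k, f k = \sum_i A i k *: e i) ->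
  \sum_k B k j *: f k = \sum_i (A *m B) i j *: e i.
Proof.
move=> fE; under eq_bigr do rewrite fE scaler_sumr.
rewrite exchange_big; apply: eq_bigr => i _; rewrite mxE scaler_suml.
by apply: eq_bigr => k _; rewrite scalerA mulrC.
Qed.

Lemma comb_delta d (e : 'I_d -> V) j : e j = \sum_i (1%:M : 'M[K]_d) i j *: e i.
Proof.
rewrite (bigD1 j) //= !mxE eqxx scale1r big1 ?addr0 // => i /negPf ij.
by rewrite !mxE ij scale0r.
Qed.

(** The change-of-basis matrices stay rectangular: PQ = 1, QP = 1 and tr(AB) = tr(BA) give the
    equality without comparing the sizes d and d'. *)
Lemma is_trace_uniq (u : V -> V) t t' : linear u ->
  is_trace u t -> is_trace u t' -> t = t'.
Proof.
move=> ul [d [e [M [eb eM ->]]]] [d' [e' [M' [e'b e'M ->]]]].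
have uD (s : seq 'I_d) (c : 'I_d -> K) :
    u (\sum_(i <- s) c i *: e i) = \sum_(i <- s) c i *: u (e i).
  have u0 : u 0 = 0 by have := ul (- 1) 0 0; rewrite scaler0 addr0 scaleN1r addNr.
  elim: s => [|i s IHs]; first by rewrite !big_nil.
  by rewrite !big_cons ul IHs.
have [P PE] := basis_matP e' eb; have [Q QE] := basis_matP e e'b.
have PQ : P *m Q = 1%:M.
  by apply: (basis_mat_inj eb) => j; rewrite -(comb_mulmx Q j PE) -QE -comb_delta.
have QP : Q *m P = 1%:M.
  by apply: (basis_mat_inj e'b) => j; rewrite -(comb_mulmx P j QE) -PE -comb_delta.
have MP : M *m P = P *m M'.
  apply: (basis_mat_inj eb) => j; rewrite -(comb_mulmx P j eM) -(comb_mulmx M' j PE).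
  by rewrite -e'M PE uD.
by rewrite -[M]mulmx1 -PQ mulmxA MP mxtrace_mulC mulmxA QP mul1mx.
Qed.

Lemma traceE (u : V -> V) t : linear u -> is_trace u t -> trace u = t.
Proof.
move=> ul ut; rewrite /trace.
by apply: (@xget_unique _ 0 [set t | is_trace u t] t ut) => t' ut';
  apply: is_trace_uniq ut' ut.
Qed.

End Trace.

Lemma aact_linear (K : fieldType) (A : algType K) (V : amodule A) (a : A) :
  linear (aact V a).
Proof. by move=> k u v; rewrite aactDr aactZr. Qed.

Lemma aact0 (K : fieldType) (A : algType K) (V : amodule A) (a : A) : aact V a 0 = 0.
Proof. by have := @aactZr _ _ V 0 a 0; rewrite !scale0r. Qed.

Lemma aact_sumr (K : fieldType) (A : algType K) (V : amodule A) (a : A)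
    (T : Type) (s : seq T) (F : T -> V) :
  aact V a (\sum_(x <- s) F x) = \sum_(x <- s) aact V a (F x).
Proof. by apply: big_morph; [exact: aactDr|exact: aact0]. Qed.

Section CharacterWords.
Variables (K : fieldType) (q : K) (r : nat).

Lemma character_cwords (V : amodule (Hecke q r)) :
  character V = \sum_(w <- cwords r) trace (aact V (hw q r (rev w))) *: hw q r w.
Proof.
exact: (sum_Tperm (fun a b => trace (aact V b) *: a)).
Qed.

Variables (c : K) (cP : (c - q) * (c + q^-1) = 0).

Local Notation V1 := (lift_module (@onedimP K q 'I_r.-1 (@nat_of_ord r.-1) c cP)).

Lemma onedim_hw (w : seq nat) (v : V1) : {in w, forall i, i.+1 < r}%N ->
  aact V1 (hw q r w) v = c ^+ size w *: v.
Proof.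
elim: w => [|i w IHw] wr; first by rewrite hw_nil aact1 expr0 scale1r.
have ir := wr _ (mem_head _ _); have {}ir : (i < r.-1)%N by lia.
rewrite hw_cons aactM IHw => [|j jw]; last by apply: wr; rewrite inE jw orbT.
rewrite aactZr /hT insubT /= exprS mulrC -scalerA; congr (_ *: _).
exact: (@lift_actE K (hecke_pres q (@nat_of_ord r.-1)) K^o _
  (@onedimP K q 'I_r.-1 (@nat_of_ord r.-1) c cP) (Var _)).
Qed.

Lemma character_onedim :
  character V1 = \sum_(w <- cwords r) c ^+ size w *: hw q r w.
Proof.
rewrite character_cwords; apply: eq_big_seq => w wr; congr (_ *: _).
apply: traceE; first exact: aact_linear.
exists 1%N, (fun=> 1 : K^o), (c ^+ size w)%:M; split.
- move=> v; exists [ffun=> v]; split.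
    by rewrite big_ord1 ffunE /GRing.scale /= mulr1.
  move=> c' ->; apply/ffunP => i; rewrite (ord1 i) ffunE big_ord1.
  by rewrite /GRing.scale /= mulr1.
- move=> j; rewrite big_ord1 onedim_hw ?size_rev; first by rewrite (ord1 j) mxE.
  by move=> i; rewrite mem_rev; apply: cwords_ltn wr.
- by rewrite mxtrace_scalar.
Qed.

End CharacterWords.

(** * Symmetrizers of parabolic subalgebras *)

Lemma nseqSr (T : Type) m (x : T) : nseq m.+1 x = rcons (nseq m x) x.
Proof. by rewrite -addn1 nseqD cats1. Qed.

Fixpoint blockwords (lam : seq nat) : seq (seq nat) :=
  if lam is b :: lam' then
    [seq w ++ [seq (b + i)%N | i <- w'] | w <- cwords b, w' <- blockwords lam']
  else [:: [::]].

Lemma sum_blockwords_cons (U : zmodType) (F : seq nat -> U) b lam :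
  \sum_(w <- blockwords (b :: lam)) F w
  = \sum_(w <- cwords b) \sum_(w' <- blockwords lam) F (w ++ [seq (b + i)%N | i <-
    w']).
Proof. exact: big_allpairs_dep. Qed.

Lemma sum_blockwords_rcons (U : zmodType) (F : seq nat -> U) lam b :
  \sum_(w <- blockwords (rcons lam b)) F w
  = \sum_(w <- blockwords lam) \sum_(w' <- cwords b)
      F (w ++ [seq (sumn lam + i)%N | i <- w']).
Proof.
elim: lam F => [|a lam IHlam] F.
  rewrite sum_blockwords_cons /= big_seq1; apply: eq_bigr => w _.
  by rewrite big_seq1 /= cats0 map_id.
rewrite rcons_cons !sum_blockwords_cons; apply: eq_bigr => w _.
rewrite IHlam; apply: eq_bigr => w' _; apply: eq_bigr => w'' _.
rewrite map_cat catA -map_comp; congr F; congr (_ ++ _).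
by apply: eq_map => i /=; rewrite addnA.
Qed.

Lemma reshape_index_cons b lam i : reshape_index (b :: lam) i =
  if (i < b)%N then 0%N else (reshape_index lam (i - b)).+1.
Proof.
rewrite /reshape_index /=; have [ib|ib] := ltnP i b.
  by rewrite (_ : (i.+1 - b)%N = 0%N) //; lia.
by rewrite subSn.
Qed.

Lemma mem_blockwords lam w i : w \in blockwords lam -> i \in w ->
  (i.+1 < sumn lam)%N /\ reshape_index lam i = reshape_index lam i.+1.
Proof.
elim: lam w i => [|b lam IHlam] w i; first by rewrite inE => /eqP->.
case/allpairsP=> -[w1 w2] [/= w1b w2l ->]; rewrite mem_cat => /orP[iw|/mapP[j jw ->]].
  have ib := cwords_ltn w1b iw; split; first by lia.
  by rewrite !reshape_index_cons ib ltnW.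
have [jl jE] := IHlam _ _ w2l jw; split; first by lia.
rewrite !reshape_index_cons !ifF; try lia.
by congr _.+1; rewrite -addnS !addKn.
Qed.

(** The sum is the Poincare polynomial \prod_(k <= m) (1 + x + ... + x^(k-1)), whose factors divide
    x^k - 1. *)
Lemma sum_cwords_exp (K : fieldType) (x : K) m : (forall k, (0 < k)%N -> x ^+ k !=
  1) ->
  \sum_(w <- cwords m) x ^+ size w != 0.
Proof.
move=> xP; elim: m => [|m IHm]; first by rewrite big_seq1 expr0 oner_neq0.
rewrite sum_cwordsS; apply: contraNneq (xP m.+1 isT) => E.
have {E} : (\sum_(k < m.+1) x ^+ k) * \sum_(w <- cwords m) x ^+ size w = 0.
  rewrite -[RHS]E mulr_suml; apply: eq_bigr => k _; rewrite mulr_sumr.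
  apply: eq_bigr => w _; rewrite size_cat size_desc; last by rewrite -ltnS.
  by rewrite exprD mulrC.
move/eqP; rewrite mulf_eq0 (negPf IHm) orbF => /eqP sE.
by rewrite -subr_eq0 subrX1 sE mulr0.
Qed.

Lemma sum_blockwords_exp (K : fieldType) (x : K) lam :
    (forall k, (0 < k)%N -> x ^+ k != 1) ->
  \sum_(w <- blockwords lam) x ^+ size w != 0.
Proof.
move=> xP; elim: lam => [|b lam IHlam]; first by rewrite big_seq1 expr0 oner_neq0.
rewrite sum_blockwords_cons.
have -> : \sum_(w <- cwords b) \sum_(w' <- blockwords lam)
      x ^+ size (w ++ [seq (b + i)%N | i <- w'])
    = (\sum_(w <- cwords b) x ^+ size w) * \sum_(w <- blockwords lam) x ^+ size w.
  rewrite mulr_suml; apply: eq_bigr => w _; rewrite mulr_sumr; apply: eq_bigr => w' _.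
  by rewrite size_cat size_map exprD.
by rewrite mulf_neq0 // sum_cwords_exp.
Qed.

(** * Diagonal coefficients at a sorted word *)

Section SortedWords.
Variables (K : fieldType) (c : K) (l : nat).
Implicit Types (J A B C : seq 'I_l) (x y : 'I_l).

Definition delta J : seq 'I_l -> K^o := fun L => (L == J)%:R.

(** The letter y travels right through B and meets only letters >= y; each equal one contributes a
    factor c. *)
Lemma lop_insert (U : lmodType K) A y B C (Phi : seq 'I_l -> U) :
    all (fun b : 'I_l => y <= b)%N B ->
  lopw c (iota (size A) (size B)) Phi (A ++ y :: B ++ C)
  = c ^+ count_mem y B *: Phi (A ++ B ++ y :: C).
Proof.
elim: B A => [|b B IHB] A /=; first by rewrite scale1r.
case/andP=> yb yB; rewrite lop_le // -cat_rcons -(size_rcons A b) IHB //.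
by rewrite scalerA -exprD cat_rcons (eq_sym b).
Qed.

Lemma lopw_eq0 (U : lmodType K) w (Phi : seq 'I_l -> U) L :
  (forall L', Phi L' = 0) -> lopw c w Phi L = 0.
Proof.
move=> Phi0; rewrite (@eq_lopw _ _ _ _ w Phi (fun L => 0 *: Phi L)) => [|L' _].
  by rewrite lopwZ scale0r.
by rewrite scale0r.
Qed.

(* The matrix entry <J| T_w^tau |J>, tau reversing words. *)
Definition ecoef J (w : seq nat) : K := lopw c (rev w) (delta J) J.

Lemma lopw_delta_rcons J x L y (w : seq nat) : {in w, forall i, i.+1 < size L}%N ->
  lopw c w (delta (rcons J x)) (rcons L y) = (y == x)%:R *: lopw c w (delta J) L.
Proof.
move=> wL; rewrite -[rcons L y]cats1 lopw_catr // -lopwZ; apply: eq_lopw => L' _.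
by rewrite /delta cats1 eqseq_rcons /GRing.scale /= -natrM mulnb andbC.
Qed.

Lemma ecoef_rcons J x (w : seq nat) k :
    pairwise (fun i j : 'I_l => i <= j)%N (rcons J x) ->
    w \in cwords (size J) -> (k <= size J)%N ->
  ecoef (rcons J x) (w ++ desc (size J) k)
  = (if all (pred1 x) (drop (size J - k) J) then c ^+ k else 0) * ecoef J w.
Proof.
move=> Js wJ kJ; rewrite /ecoef rev_cat rev_desc // lopw_cat.
have wr : {in rev w, forall i, i.+1 < size J}%N.
  by move=> i; rewrite mem_rev; apply: cwords_ltn wJ.
set A := take (size J - k) J; set D := drop (size J - k) J.
have JE : J = A ++ D by rewrite cat_take_drop.
have sA : size A = (size J - k)%N by rewrite size_takel // leq_subr.
have sD : size D = k by rewrite size_drop; lia.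
move: (D) sD JE => {}D; case: D => [|y B] sD JE.
  rewrite -sD /= mul1r; have := lopw_delta_rcons J x x wr.
  by rewrite eqxx scale1r.
have sB : size (rcons B x) = k by rewrite size_rcons -sD.
have RJ : rcons J x = A ++ y :: rcons B x ++ [::].
  by rewrite cats0 [in LHS]JE rcons_cat rcons_cons.
have yB : all (fun b : 'I_l => y <= b)%N (rcons B x).
  by move: Js; rewrite RJ cats0 pairwise_cat pairwise_cons => /and3P[_ _ /andP[]].
have := @lop_insert _ A y (rcons B x) [::] (lopw c (rev w) (delta (rcons J x))) yB.
rewrite sB sA -RJ => ->; rewrite catA cats1 lopw_delta_rcons; last first.
  by move=> i /wr; rewrite size_cat sA sB; lia.
have xB : all (fun b : 'I_l => b <= x)%N (y :: B).
  move: Js; rewrite RJ cats0 -rcons_cons -rcons_cat -cats1 pairwise_cat.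
  by case/andP=> /allrelP Bx _; apply/allP => b bB; apply: Bx;
    rewrite ?mem_cat ?bB ?orbT ?mem_head.
case: (altP (y =P x)) => [yx|yx] /=; last by rewrite (negPf yx) scale0r scaler0 mul0r.
have Bx : B = nseq (size B) x.
  apply/all_pred1P/allP => b bB /=; rewrite -val_eqE eqn_leq -{2}yx.
  have /= := allP xB b; rewrite inE bB orbT => -> //.
  by apply: (allP yB); rewrite mem_rcons inE bB orbT.
have aB : all (pred1 x) B by rewrite Bx all_pred1_nseq.
rewrite yx eqxx scale1r [all _ _](_ : _ = true) //.
have -> : A ++ rcons B x = J by rewrite [RHS]JE yx Bx -[x :: nseq _ x]/(nseq (size
  B).+1 x) nseqSr.
suff -> : count_mem x (rcons B x) = k by [].
by rewrite -sB; apply/eqP; rewrite -all_count all_rcons /= eqxx.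
Qed.

(** A tail with k > b reaches a letter < x and contributes 0. The surviving tails form the canonical
    words of the run, shifted by [size J]. *)
Lemma sum_cwords_run (U : lmodType K) (F : seq nat -> U) J x b :
    pairwise (fun i j : 'I_l => i <= j)%N J -> all (fun j : 'I_l => j < x)%N J ->
  \sum_(w <- cwords (size J + b)) ecoef (J ++ nseq b x) w *: F w
  = \sum_(w <- cwords (size J)) \sum_(w' <- cwords b)
      (ecoef J w * c ^+ size w') *: F (w ++ [seq (size J + i)%N | i <- w']).
Proof.
move=> Js Jx; elim: b F => [|b IHb] F.
  rewrite addn0 /= cats0; apply: eq_bigr => w _.
  by rewrite big_seq1 /= cats0 expr0 mulr1.
have JE : J ++ nseq b.+1 x = rcons (J ++ nseq b x) x by rewrite nseqSr -rcons_cat.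
have sE : size (J ++ nseq b x) = (size J + b)%N by rewrite size_cat size_nseq.
have Jsx : pairwise (fun i j : 'I_l => i <= j)%N (rcons (J ++ nseq b x) x).
  rewrite -JE pairwise_cat Js; apply/and3P; split=> //.
    apply/allrelP => i j /(allP Jx)/ltnW ix; rewrite mem_nseq => /eqP->; exact: ix.
  elim: (b.+1) => // m IHm; rewrite pairwise_cons IHm andbT.
  by apply/allP => j /nseqP[-> _].
rewrite addnS sum_cwordsS.
transitivity (\sum_(k < (size J + b).+1 | (k < b.+1)%N) \sum_(w <- cwords (size J))
   \sum_(w' <- cwords b) (ecoef J w * c ^+ size (w' ++ desc b k))
      *: F (w ++ [seq (size J + i)%N | i <- w' ++ desc b k])).
  rewrite [RHS]big_mkcond; apply: eq_bigr => k _.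
  have kJ : (k <= size J + b)%N by rewrite -ltnS.
  have all_k : all (pred1 x) (drop (size J + b - k) (J ++ nseq b x)) = (k < b.+1)%N.
    rewrite drop_cat; case: ltnP => kb.
      rewrite [RHS](_ : _ = false); last by lia.
      have ? : (size J + b - k < size J)%N by [].
      rewrite all_cat (drop_nth x) //=.
      suff /negPf-> : nth x J (size J + b - k) != x by [].
      by rewrite -val_eqE neq_ltn (allP Jx) // mem_nth.
    rewrite [RHS](_ : _ = true); last by lia.
    by apply/allP => j /mem_drop/nseqP[-> _] /=.
  transitivity (\sum_(w <- cwords (size J + b)) (if (k < b.+1)%N then c ^+ k else 0)
    *:
     (ecoef (J ++ nseq b x) w *: F (w ++ desc (size J + b) k))).
    apply: eq_big_seq => w wJ; rewrite JE.
    have := ecoef_rcons (w := w) (k := k) Jsx; rewrite sE => -> //.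
    by rewrite all_k scalerA.
  rewrite -scaler_sumr; case: ifP => kb; last by rewrite scale0r.
  rewrite (IHb (fun w => F (w ++ desc (size J + b) k))) scaler_sumr.
  apply: eq_bigr => w _; rewrite scaler_sumr; apply: eq_bigr => w' _.
  rewrite scalerA; congr (_ *: F _); last by rewrite map_cat -catA shift_desc.
  by rewrite size_cat size_desc // exprD; ring.
rewrite -(big_ord_widen _ (fun k => \sum_(w <- cwords (size J))
   \sum_(w' <- cwords b) (ecoef J w * c ^+ size (w' ++ desc b k))
      *: F (w ++ [seq (size J + i)%N | i <- w' ++ desc b k]))); last by lia.
by rewrite exchange_big; apply: eq_bigr => w _; rewrite sum_cwordsS.
Qed.

Definition blocks (s : seq 'I_l) (lam : seq nat) : seq 'I_l :=
  flatten [seq nseq p.2 p.1 | p <- zip s lam].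

Lemma blocks_rcons s x lam b : size s = size lam ->
  blocks (rcons s x) (rcons lam b) = blocks s lam ++ nseq b x.
Proof. by move=> sl; rewrite /blocks zip_rcons // map_rcons flatten_rcons. Qed.

Lemma size_blocks s lam : size s = size lam -> size (blocks s lam) = sumn lam.
Proof.
rewrite /blocks; elim: s lam => [|x s IHs] [|b lam] //= [sl].
by rewrite size_cat size_nseq IHs.
Qed.

Lemma mem_blocks s lam x : x \in blocks s lam -> x \in s.
Proof.
rewrite /blocks; elim: s lam => [|y s IHs] [|b lam] //=.
by rewrite mem_cat inE => /orP[/nseqP[-> _]|/IHs->]; rewrite ?eqxx ?orbT.
Qed.

Lemma blocks_pairwise s lam : size s = size lam ->
  pairwise (fun i j : 'I_l => i < j)%N s ->
  pairwise (fun i j : 'I_l => i <= j)%N (blocks s lam).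
Proof.
rewrite /blocks; elim: s lam => [|x s IHs] [|b lam] //= [sl] /andP[xs ss].
rewrite pairwise_cat IHs // andbT; apply/andP; split.
  apply/allrelP => i j /nseqP[-> _] /mem_blocks js; exact: ltnW (allP xs j js).
elim: b => // m IHm; rewrite pairwise_cons IHm andbT.
by apply/allP => j /nseqP[-> _].
Qed.

(** Appending one run at a time shows that T_w^tau has diagonal entry c^l(w) at the block word for w
    in the parabolic subgroup, and 0 otherwise. *)
Lemma sum_ecoef_blocks (U : lmodType K) (F : seq nat -> U) s lam :
    size s = size lam -> pairwise (fun i j : 'I_l => i < j)%N s ->
  \sum_(w <- cwords (sumn lam)) ecoef (blocks s lam) w *: F w
  = \sum_(w <- blockwords lam) c ^+ size w *: F w.
Proof.
elim/last_ind: s lam F => [|s x IHs] lam F.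
  move=> /esym/size0nil-> _; rewrite !big_seq1 /ecoef /= /delta eqxx.
  by rewrite expr0.
case/lastP: lam => [|lam b]; rewrite !size_rcons // => -[sl].
rewrite pairwise_rcons => /andP[sx ss]; rewrite blocks_rcons // sumn_rcons.
rewrite -(size_blocks sl) sum_cwords_run; last first.
- by apply/allP => j /mem_blocks/(allP sx).
- exact: blocks_pairwise.
rewrite sum_blockwords_rcons size_blocks //.
under eq_bigr => w _ do under eq_bigr do rewrite -scalerA.
under eq_bigr do rewrite -scaler_sumr.
rewrite IHs //; apply: eq_bigr => w _; rewrite scaler_sumr; apply: eq_bigr => w' _.
by rewrite scalerA size_cat size_map exprD.
Qed.

Lemma nth_blocks x0 s lam i : size s = size lam -> (i < sumn lam)%N ->
  nth x0 (blocks s lam) i = nth x0 s (reshape_index lam i).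
Proof.
rewrite /blocks; elim: s lam i => [|x s IHs] [|b lam] i //= [sl] il.
rewrite reshape_index_cons nth_cat size_nseq nth_nseq; case: ltnP => // bi.
by rewrite IHs //=; lia.
Qed.

End SortedWords.

(** * Sorting words *)

(** Here R acts on the ket |A x y B> rather than on a coordinate: an increasing pair is simply
    swapped. *)
Lemma lop_delta (K : fieldType) (c : K) (l : nat) (A B L : seq 'I_l) (x y : 'I_l) :
  (x < y)%N ->
  lop c (size A) (delta K (A ++ x :: y :: B)) L = delta K (A ++ y :: x :: B) L.
Proof.
move=> xy; have xyF : (x == y) = false by apply/negbTE; rewrite -val_eqE neq_ltn xy.
elim: A L => [|p A IHA] [|a L] //=.
  case: L => [|b L]; first by rewrite /delta /= !eqseq_cons !andbF.
  rewrite /delta /= !eqseq_cons.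
  case: (altP (a =P b)) => [->|ab].
    case: (altP (b =P x)) => [->|_] /=; last by rewrite scaler0 andbF.
    by rewrite xyF scaler0.
  rewrite andbCA; have [ba|_] := ifP; last by rewrite addr0.
  suff -> : [&& a == x, b == y & L == B] = false by rewrite scaler0 addr0.
  by apply/and3P => -[/eqP ax /eqP by_ _]; move: ba; rewrite ax by_ ltnNge ltnW.
transitivity (lop c (size A) (fun L => (a == p)%:R *: delta K (A ++ x :: y :: B) L)
  L).
  apply: eq_lop => L' _; rewrite /delta eqseq_cons /GRing.scale /=.
  by rewrite -natrM mulnb.
have := lopwZ c (a == p)%:R [:: size A] (delta K (A ++ x :: y :: B)) L => /= ->.
by rewrite IHA /delta eqseq_cons /GRing.scale /= -natrM mulnb.
Qed.

Section SortPairs.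
Variables (n l : nat).
Local Notation pair := ('I_n * 'I_l)%type.
Implicit Types (u : seq pair) (a b : pair).

(* [sorts u w e u']: the transpositions [w] sort [u] with respect to the second
   components, [e] of them exchanging pairs with equal first components. *)
Inductive sorts : seq pair -> seq nat -> nat -> seq pair -> Prop :=
| sorts_nil u : sorts u [::] 0 u
| sorts_step u1 a b u2 w e u' : (b.2 < a.2)%N -> (a.1 <= b.1)%N ->
    sorts (u1 ++ b :: a :: u2) w e u' ->
    sorts (u1 ++ a :: b :: u2) (size u1 :: w) (e + (a.1 == b.1)) u'.

Lemma perm_swap u1 u2 a b :
  perm_eq (u1 ++ a :: b :: u2) (u1 ++ b :: a :: u2).
Proof.
by rewrite perm_cat2l -[X in perm_eq X _]/([:: a; b] ++ u2)
  -[X in perm_eq _ X]/([:: b; a] ++ u2) perm_cat2r (perm_catC [:: a]).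
Qed.

Lemma sorts_perm u w e u' : sorts u w e u' -> perm_eq u u'.
Proof.
elim=> {u w e u'} [u|u1 a b u2 w e u' _ _ _]; first exact: perm_refl.
exact/perm_trans/perm_swap.
Qed.

Lemma sorts_lt u w e u' : sorts u w e u' -> {in w, forall i, i.+1 < size u}%N.
Proof.
elim=> {u w e u'} [//|u1 a b u2 w e u' _ _ _ IH] i.
rewrite inE => /orP[/eqP->|/IH]; rewrite !size_cat /=; lia.
Qed.

(** Stability: only strict descents of the second components are exchanged. *)
Lemma sorts_filter u w e u' j : sorts u w e u' ->
  [seq p <- u' | p.2 == j] = [seq p <- u | p.2 == j].
Proof.
elim=> {u w e u'} [//|u1 a b u2 w e u' ba _ _ ->]; rewrite !filter_cat /=.
by case: (altP (a.2 =P j)) ba => [->|] //; case: (altP (b.2 =P j)) => // ->;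
  rewrite ltnn.
Qed.

(** Read backwards, each step meets an increasing pair of distinct letters, so no coefficient
    arises. *)
Lemma sorts_snd u w e u' (K : fieldType) (c : K) (U : lmodType K) (Phi : seq 'I_l ->
  U) :
  sorts u w e u' -> lopw c (rev w) Phi (map snd u') = Phi (map snd u).
Proof.
move=> us; elim: us Phi => {u w e u'} [//|u1 a b u2 w e u' ba _ _ IH] Phi.
rewrite rev_cons -cats1 lopw_cat IH /= !map_cat /= -(size_map snd).
rewrite lop_le ?(ltnW ba) // (_ : b.2 == a.2 = false) ?scale1r //.
by apply/negbTE; rewrite -val_eqE neq_ltn ba.
Qed.

Lemma sorts_delta u w e u' (K : fieldType) (c : K) L : sorts u w e u' ->
  lopw c w (delta K (map snd u')) L = delta K (map snd u) L.
Proof.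
move=> us; elim: us L => {u w e u'} [//|u1 a b u2 w e u' ba _ _ IH] L /=.
rewrite (eq_lop _ _ (fun L' _ => IH L')) !map_cat /= -(size_map snd).
exact: lop_delta.
Qed.

Lemma sorts_fst u w e u' (K : fieldType) (c : K) (U : lmodType K) (Phi : seq 'I_n ->
  U) :
  sorts u w e u' -> lopw c w Phi (map fst u) = c ^+ e *: Phi (map fst u').
Proof.
elim=> {u w e u'} [u|u1 a b u2 w e u' _ ab _ IH] /=; first by rewrite scale1r.
rewrite map_cat /= -{1}(size_map fst) lop_le //.
by rewrite addnC exprD -scalerA -IH map_cat.
Qed.

(** Each exchange is made in the columns by [lop_Xw]; reversing the word makes the first exchange
    reach [Xw] first. *)
Lemma sorts_Xw u w e u' (K : fieldType) (q : K) L :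
    sorts u w e u' -> size L = size u ->
  lopw q (rev w) (Xw q (map fst u)) L = q ^+ e *: Xw q (map fst u') L.
Proof.
move=> us; elim: us L => {u w e u'} [u|u1 a b u2 w e u' _ ab _ IH] L sL.
  by rewrite scale1r.
rewrite rev_cons -cats1 lopw_cat /= addnC exprD -scalerA -IH; last first.
  by rewrite sL !size_cat.
rewrite -lopwZ; apply: eq_lopw => L' /perm_size sL'.
rewrite !map_cat /= -(size_map fst) lop_Xw //.
by rewrite sL' sL size_cat size_cat /= !size_map.
Qed.

Lemma sorts_cons u w e u' a : sorts u w e u' -> sorts (a :: u) (map S w) e (a :: u').
Proof.
elim=> {u w e u'} [u|u1 x b u2 w e u' xb bx _ IH]; first exact: sorts_nil.
exact: (sorts_step (u1 := a :: u1)).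
Qed.

Lemma sorts_trans u w e u' w' e' u'' : sorts u w e u' -> sorts u' w' e' u'' ->
  sorts u (w ++ w') (e + e') u''.
Proof.
elim=> {u w e u'} [//|u1 a b u2 w e u' xb bx _ IH] /IH us /=.
by rewrite addnAC; apply: sorts_step.
Qed.

Definition inv_count a u := count (fun b : pair => (b.2 < a.2)%N && (b.1 == a.1)) u.
Fixpoint inversions u := if u is a :: t then (inv_count a t + inversions t)%N else
  0%N.

Local Notation sorted2 u := (pairwise (fun a b : pair => a.2 <= b.2)%N u).
Local Notation sorted1 u := (pairwise (fun a b : pair => a.1 <= b.1)%N u).

Lemma sorts_insert a u : sorted2 u -> all (fun b => a.1 <= b.1)%N u ->
  exists w u', sorts (a :: u) w (inv_count a u) u' /\ sorted2 u'.
Proof.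
elim: u => [|b u IHu] /=; first by exists [::], [:: a]; split=> //; apply: sorts_nil.
move=> /andP[bu us] /andP[ab au]; have [ba|ba] := ltnP b.2 a.2; last first.
  have -> : inv_count a u = 0%N.
    apply/eqP; rewrite -leqn0 leqNgt -has_count; apply/hasPn => x /(allP bu) /= bx.
    by rewrite ltnNge (leq_trans ba bx).
  exists [::], (a :: b :: u); split; first exact: sorts_nil.
  rewrite /= ba us bu !andbT; apply/allP => x /(allP bu); exact: leq_trans.
have [w [u' [us' u's]]] := IHu us au.
exists (0%N :: map S w), (b :: u'); split.
  rewrite /= addnC eq_sym.
  by apply: (@sorts_step [::]) => //; apply: sorts_cons.
rewrite /= u's andbT; apply/allP => x; rewrite -(perm_mem (sorts_perm us')) inE.
by case/orP=> [/eqP->|/(allP bu)//]; apply: ltnW.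
Qed.

(** Insertion sort from the right. The head has the least first component, as [sorts_insert]
    requires, and its count is unaffected by sorting the tail. *)
Lemma sorts_exists u : sorted1 u -> exists w u', sorts u w (inversions u) u' /\
  sorted2 u'.
Proof.
elim: u => [|a u IHu] /=; first by exists [::], [::]; split=> //; apply: sorts_nil.
case/andP=> au /IHu[w [u' [us u's]]].
have uu' := sorts_perm us.
have [|w' [u'' [us' u''s]]] := @sorts_insert a u' u's.
  by rewrite -(perm_all _ uu').
exists (map S w ++ w'), u''; split=> //.
have -> : inv_count a u = inv_count a u' by rewrite /inv_count (seq.permP uu').
by rewrite addnC; apply: sorts_trans us'; apply: sorts_cons.
Qed.

Lemma sorted_flatten u (s : seq 'I_l) :
    sorted2 u -> pairwise (fun i j : 'I_l => i < j)%N s -> {in u, forall p, p.2 \in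
      s} ->
  u = flatten [seq [seq p <- u | p.2 == j] | j <- s].
Proof.
elim: s u => [|x s IHs] u us /=; first by case: u us => // p u _ _ /(_ p (mem_head _
  _)).
move=> /andP[xs ss] usx.
have split_u : u = [seq p <- u | p.2 == x] ++ [seq p <- u | p.2 != x].
  elim: u us usx {IHs} => //= p u IHu /andP[pu us] usx.
  have {}IHu := IHu us (fun p' p'u => usx p' (predU1r _ _ p'u)).
  case: (altP (p.2 =P x)) => [px|px] /=; first by congr (_ :: _).
  have xp : (x < p.2)%N.
    have := usx p (mem_head _ _); rewrite inE (negPf px) /=; exact: (allP xs).
  rewrite (eq_in_filter (a2 := pred0)) ?filter_pred0 /=.
    rewrite (eq_in_filter (a2 := predT)) ?filter_predT // => p' /(allP pu) pp'.
    by apply/eqP => p'x; move: (leq_trans xp pp'); rewrite p'x ltnn.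
  by move=> p' /(allP pu) pp'; apply/eqP => p'x; move: (leq_trans xp pp');
    rewrite p'x ltnn.
rewrite [LHS]split_u; congr (_ ++ _).
rewrite [LHS](IHs _ (pairwise_filter _ us) ss); last first.
  by move=> p; rewrite mem_filter => /andP[px /usx]; rewrite inE (negPf px).
congr flatten; apply/eq_in_map => j js; rewrite -filter_predI.
apply: eq_filter => p /=; case: eqP => // ->.
by rewrite -val_eqE neq_ltn (allP xs j js) orbT.
Qed.

End SortPairs.

(** * Factorization over blocks *)

Section ImmanantFactorization.
Variables (K : fieldType) (q c : K) (n : nat).

Definition block_imm (S : seq 'I_n) : Aq q n :=
  \sum_(w <- cwords (size S)) c ^+ size w *: lopw q w (Xw q S) S.

(** Each shifted word acts only within its own block and [Xw] is multiplicative on concatenations,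
    so the blocks separate by linearity. *)
Lemma block_imm_flatten (ss : seq (seq 'I_n)) :
  \sum_(w <- blockwords (map size ss))
    c ^+ size w *: lopw q w (Xw q (flatten ss)) (flatten ss)
  = \prod_(S <- ss) block_imm S.
Proof.
elim: ss => [|S ss IHss].
  by rewrite big_nil big_seq1 /= expr0 scale1r /Xw big_nil.
rewrite big_cons -IHss sum_blockwords_cons mulr_suml; set R := flatten ss.
apply: eq_big_seq => w wS; rewrite mulr_sumr; apply: eq_bigr => w' _.
rewrite size_cat size_map exprD -scalerAl -scalerAr scalerA; congr (_ *: _).
rewrite /= -/R lopw_cat lopw_catr => [|i]; last exact: cwords_ltn.
transitivity (lopw q w (fun L => Xw q S L * lopw q w' (Xw q R) R) S); last first.
  apply: (@lopw_morph _ q n (Aq q n) (Aq q n) (fun x => x * lopw q w' (Xw q R) R))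
    => *.
    by rewrite mulrDl.
  by rewrite scalerAl.
apply: eq_lopw => L /perm_size LS; rewrite -LS lopw_shift.
transitivity (lopw q w' (fun L' => Xw q S L * Xw q R L') R).
  by apply: eq_lopw => L' _; rewrite Xw_cat.
apply: (@lopw_morph _ q n (Aq q n) (Aq q n) (fun x => Xw q S L * x)) => *.
  by rewrite mulrDr.
by rewrite scalerAr.
Qed.

End ImmanantFactorization.

(** * q-multinomial coefficients *)

Section Multinomial.
Variables (K : fieldType) (t : K) (n l : nat).
Hypothesis tP : forall k, (0 < k)%N -> t ^+ k != 1.
Implicit Types (S : 'I_l -> seq 'I_n).

Definition mfact (I : seq 'I_n) : K := \prod_(i < n) qfact t (count_mem i I).

Lemma qnat_neq0 k : (0 < k)%N -> qnat t k != 0.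
Proof.
move=> k0; have t1 := tP (ltn0Sn 0); rewrite expr1 in t1.
by rewrite mulf_neq0 ?invr_eq0 ?subr_eq0 // tP.
Qed.

Lemma qfactS k : qfact t k.+1 = qfact t k * qnat t k.+1.
Proof. by rewrite /qfact big_nat_recr. Qed.

Lemma qfact_neq0 k : qfact t k != 0.
Proof.
elim: k => [|k IHk]; first by rewrite /qfact big_geq // oner_neq0.
by rewrite qfactS mulf_neq0 // qnat_neq0.
Qed.

Lemma mfact_neq0 I : mfact I != 0.
Proof. by apply/prodf_neq0 => i _; apply: qfact_neq0. Qed.

Lemma mfact_cons i I : mfact (i :: I) = mfact I * qnat t (count_mem i I).+1.
Proof.
rewrite /mfact (bigD1 i) //= [in RHS](bigD1 i) //= eqxx add1n qfactS.
rewrite (eq_bigr (fun j => qfact t (count_mem j I))) => [|j ij].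
  by rewrite mulrAC.
by rewrite eq_sym (negPf ij).
Qed.

(** After multiplication by t - 1 the sum telescopes. *)
Lemma qnat_sum (N : 'I_l -> nat) :
  \sum_(j < l) t ^+ (\sum_(j' < l | (j' < j)%N) N j')%N * qnat t (N j)
  = qnat t (\sum_(j < l) N j)%N.
Proof.
rewrite /qnat; under eq_bigr do rewrite mulrA; rewrite -mulr_suml; congr (_ / _).
elim: l N => [|m IHm] N; first by rewrite !big_ord0 expr0 subrr.
rewrite !big_ord_recr /=.
have -> : (\sum_(j' < m.+1 | (j' < m)%N) N j' = \sum_(j' < m) N (widen_ord (leqnSn
  m) j'))%N.
  rewrite big_mkcond big_ord_recr /= ltnn addn0; apply: eq_bigr => j' _.
  by rewrite /= ltn_ord.
transitivity ((t ^+ (\sum_(j < m) N (widen_ord (leqnSn m) j))%N - 1)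
  + t ^+ (\sum_(j' < m) N (widen_ord (leqnSn m) j'))%N * (t ^+ N ord_max - 1)).
  congr (_ + _); rewrite -IHm; apply: eq_bigr => j _.
  congr (t ^+ _ * _); rewrite big_mkcond big_ord_recr /=.
  by rewrite ltnNge (ltnW (ltn_ord j)) /= addn0 [RHS]big_mkcond.
by rewrite exprD mulrBr mulr1 addrC subrKA.
Qed.

Definition fiber (I : seq 'I_n) (J : seq 'I_l) (j : 'I_l) : seq 'I_n :=
  [seq p.1 | p <- zip I J & p.2 == j].

Lemma fiber_cons i I j J j' :
  fiber (i :: I) (j :: J) j' = if j == j' then i :: fiber I J j' else fiber I J j'.
Proof. by rewrite /fiber /=; case: ifP. Qed.

Lemma inv_count_fiber i (j : 'I_l) I J : size I = size J ->
  inv_count (i, j) (zip I J) = (\sum_(j' < l | (j' < j)%N) count_mem i (fiber I J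
    j'))%N.
Proof.
elim: I J => [|a I IHI] [|b J] //=; first by rewrite big1.
move=> [sIJ]; rewrite -[LHS]/(((b < j)%N && (a == i) + inv_count (i, j) (zip I
  J))%N) IHI //.
under [in RHS]eq_bigr => j' _ do rewrite fiber_cons.
have [bj|bj] := ltnP b j => /=.
  rewrite (bigD1 b) //= [in RHS](bigD1 b) //= eqxx /= addnA; congr (_ + _)%N.
  by apply: eq_bigr => j' /andP[_]; rewrite eq_sym => /negPf->.
by apply: eq_bigr => j' j'j; rewrite ifF //; apply/negbTE/eqP => bj'; move: bj;
  rewrite bj' leqNgt j'j.
Qed.

Lemma count_fibers a S : count a (flatten [seq S j | j <- enum 'I_l]) = (\sum_j
  count a (S j))%N.
Proof. by rewrite count_flatten sumnE -map_comp big_map big_enum. Qed.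

(** The value is a product of t-multinomial coefficients, one for each letter. By induction on I:
    its head i goes to some block j and is inverted with the copies of i in the blocks before j;
    [qnat_sum] is the resulting recurrence. *)
Lemma sum_fibers m (I : m.-tuple 'I_n) S :
    pairwise (fun i j : 'I_n => i <= j)%N I ->
    (forall j, pairwise (fun i j : 'I_n => i <= j)%N (S j)) ->
    perm_eq (flatten [seq S j | j <- enum 'I_l]) I ->
  \sum_(J : m.-tuple 'I_l | [forall j, fiber I J j == S j]) t ^+ inversions (zip I J)
  = mfact I / \prod_j mfact (S j).
Proof.
have mfact0 : mfact [::] = 1.
  by rewrite /mfact big1 // => i _; rewrite /qfact big_geq.
elim: m I S => [|m IHm] I S.
  rewrite (tuple0 I) => _ _ /perm_nilP S0.
  have {}S0 j : S j = [::].
    case SE: (S j) => [//|x s]; have : x \in flatten [seq S j | j <- enum 'I_l].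
      by apply/flatten_mapP; exists j; rewrite ?mem_enum // SE mem_head.
    by rewrite S0.
  rewrite (bigD1 [tuple]) /=; last by apply/forallP => j; rewrite S0.
  rewrite big1 ?addr0 => [|J]; last by case/andP=> _ /eqP[]; apply: tuple0.
  by rewrite big1 => [|j _]; rewrite ?S0 ?mfact0 ?divr1.
case/tupleP: I => i I /= /andP[iI Is] Ss SI.
rewrite (reindex (fun p : 'I_l * m.-tuple 'I_l => [tuple of p.1 :: p.2])) /=;
  last first.
  exists (fun J => (thead J, [tuple of behead J])) => [[j J] _|J _] /=.
    by congr (_, _); apply: val_inj.
  by rewrite -tuple_eta.
rewrite -(pair_big_dep xpredT
  (fun j (J : m.-tuple 'I_l) => [forall j', fiber (i :: I) (j :: J) j' == S j'])
  (fun j (J : m.-tuple 'I_l) => t ^+ (inv_count (i, j) (zip I J) + inversions (zip I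
    J)))) /=.
pose N j := count_mem i (S j).
have NI : (\sum_j N j)%N = (count_mem i I).+1.
  by rewrite -count_fibers (seq.permP SI) /= eqxx.
rewrite mfact_cons -NI -qnat_sum [mfact I * _]mulrC -mulrA mulr_suml.
apply: eq_bigr => j _.
(* If S j does not start with the least letter i, then, being sorted, it contains no i, and the
   terms on both sides vanish. *)
have [[s SE]|Sj] := pselect (exists s, S j = i :: s); last first.
  rewrite big1 => [|J /forallP/(_ j)]; last first.
    by rewrite fiber_cons eqxx => /eqP E; case: Sj; exists (fiber I J j).
  suff -> : N j = 0%N by rewrite /qnat expr0 subrr mul0r mulr0 mul0r.
  apply/count_memPn; apply/negP => iS; case: Sj; exists (behead (S j)).
  case SE: (S j) iS => [//|h s] /=; rewrite inE => /orP[/eqP<-//|is_].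
  have /= := Ss j; rewrite SE => /andP[/allP/(_ _ is_) hi _].
  have : h \in i :: I.
    by rewrite -(perm_mem SI); apply/flatten_mapP; exists j;
      rewrite ?mem_enum // SE mem_head.
  rewrite inE => /orP[/eqP->//|/(allP iI) ih].
  by congr (_ :: _); apply/val_inj/eqP; rewrite eqn_leq hi ih.
pose S' j' := if j' == j then s else S j'.
have fE (J : m.-tuple 'I_l) : [forall j', fiber (i :: I) (j :: J) j' == S j']
    = [forall j', fiber I J j' == S' j'].
  apply: eq_forallb => j'; rewrite fiber_cons /S' (eq_sym j).
  have [->|//] := eqVneq j' j; by rewrite SE eqseq_cons eqxx.
under eq_bigl do rewrite fE.
transitivity (\sum_(J : m.-tuple 'I_l | [forall j', fiber I J j' == S' j'])
    t ^+ (\sum_(j' < l | (j' < j)%N) N j')%N * t ^+ inversions (zip I J)).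
  apply: eq_bigr => J /forallP JS; rewrite exprD inv_count_fiber ?size_tuple //.
  congr (t ^+ _ * _); apply: eq_bigr => j' j'j; rewrite (eqP (JS j')) /S' ifF //.
  by apply/negbTE/eqP => j'E; rewrite j'E ltnn in j'j.
rewrite -mulr_sumr IHm //.
- rewrite [\prod_j0 mfact (S' j0)](bigD1 j) // [\prod_j0 mfact (S j0)](bigD1 j) //=.
  rewrite SE mfact_cons /S' eqxx.
  have -> : \prod_(j' < l | j' != j) mfact (if j' == j then s else S j')
      = \prod_(j' < l | j' != j) mfact (S j').
    by apply: eq_bigr => j' /negPf->.
  have NE : N j = (count_mem i s).+1 by rewrite /N SE /= eqxx.
  have P0 : \prod_(j' < l | j' != j) mfact (S j') != 0.
    by apply/prodf_neq0 => j' _; apply: mfact_neq0.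
  have q0 := qnat_neq0 (ltn0Sn (count_mem i s)).
  rewrite NE; move: (mfact_neq0 s) q0 P0 => s0 q0 P0; field.
  by rewrite s0 q0 P0.
- move=> j'; rewrite /S'; case: eqP => // _.
  by have := Ss j; rewrite SE /= => /andP[].
- apply/seq.permP => a; have := (seq.permP SI) a; rewrite !count_fibers /=.
  rewrite (bigD1 j) //= SE /= -addnA => /addnI <-; rewrite (bigD1 j) //= /S' eqxx.
  by congr (_ + _)%N; apply: eq_bigr => j' /negPf->.
Qed.

End Multinomial.

(** * The induced character *)

Local Arguments aact : simpl never.

Lemma enum_ord_pairwise l : pairwise (fun i j : 'I_l => i < j)%N (enum 'I_l).
Proof.
have := iota_ltn_sorted 0 l; rewrite -val_enum_ord sorted_pairwise;
  last exact: ltn_trans.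
by rewrite pairwise_map.
Qed.

Section InducedCharacter.
Variables (K : fieldType) (q c : K) (q0 : q != 0) (cP : (c - q) * (c + q^-1) = 0).
Hypothesis c2P : forall k, (0 < k)%N -> (c ^+ 2) ^+ k != 1.
Variables (r l : nat) (lam : l.-tuple nat) (J0 : r.-tuple 'I_l).
Hypothesis J0E : tval J0 = blocks (enum 'I_l) lam.

Local Notation H := (Hecke q r).
Local Notation hw := (@hw K q r).
Local Notation M := (root_module l r cP q0).
Local Notation V1 := (lift_module (@onedimP K q (parab_gen r lam) (@parab_pos r lam)
  c cP)).
Local Notation emb := (parab_emb q r lam).
Local Notation E := (ext_module emb V1).
Local Notation m0 := (ket K J0).
Local Notation tns a v := (@tens K _ _ emb V1 a v).

Lemma size_enum_lam : size (enum 'I_l) = size lam.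
Proof. by rewrite size_enum_ord size_tuple. Qed.

Lemma sumn_lam : sumn lam = r.
Proof. by rewrite -(size_blocks size_enum_lam) -J0E size_tuple. Qed.

Lemma root_module_hw (w : seq nat) (v : M) (Phi : seq 'I_l -> K^o) (I : r.-tuple
  'I_l) :
    {in w, forall i, i.+1 < r}%N -> (forall L : r.-tuple 'I_l, v L = Phi L) ->
  aact M (hw w) v I = lopw c w Phi I.
Proof.
move=> wr vE; have := @act_hw K q c l r (aact M) 'I_1 K^o (fun=> v) (fun=> 1) Phi w I.
rewrite big_ord1 /GRing.scale /= mulr1 => -> //.
- exact: (@aact1 _ _ M).
- exact: (@aactM _ _ M).
- exact: root_moduleT.
- by move=> L; rewrite big_ord1 mulr1.
Qed.

Lemma root_module_ket (w : seq nat) (I J : r.-tuple 'I_l) :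
  {in w, forall i, i.+1 < r}%N -> aact M (hw w) (ket K J) I = lopw c w (delta K J) I.
Proof. by move=> wr; apply: root_module_hw => // L; rewrite ffunE. Qed.

Lemma root_module_content (w : seq nat) (I J : r.-tuple 'I_l) :
    {in w, forall i, i.+1 < r}%N -> ~~ perm_eq J I ->
  aact M (hw w) (ket K J) I = 0.
Proof.
move=> wr JI; rewrite root_module_ket // (@eq_lopw _ _ _ _ w _ (fun=> 0)).
  exact: lopw_eq0.
move=> L LI; rewrite /delta; case: eqP => // LJ.
by rewrite -LJ LI in JI.
Qed.

(** Positions in one block carry the same letter of J0, and R multiplies equal letters by c. *)
Lemma Rk_m0 (x : parab_gen r lam) : Rk c l (val x) m0 = c *: m0.
Proof.
have J0x : tnth J0 (posl (val x)) = tnth J0 (posr (val x)).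
  have /eqP rx : reshape_index lam (val (val x)) == reshape_index lam (val (val
    x)).+1.
    exact: (valP x).
  have il : 'I_l by exact: tnth J0 (posl (val x)).
  rewrite !(tnth_nth il) J0E !nth_blocks ?size_enum_lam //.
  - by rewrite /= rx.
  - by rewrite sumn_lam; apply: ltn_ord.
  - by rewrite sumn_lam; apply: ltn_ord.
apply/ffunP => I; rewrite RkE /= [RHS]ffunE.
case: (tnth I (posl (val x)) =P tnth I (posr (val x))) => // II.
have IJ : I != J0 by apply: contra_notN II => /eqP->.
have sIJ : swap_pos (val x) I != J0.
  apply/eqP => sI; apply: II.
  by rewrite -(swap_posl (val x)) sI J0x -sI swap_posr.
rewrite !ffunE (negPf IJ) (negPf sIJ) add0r /GRing.scale /= !mulr0.
by case: ifP.
Qed.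

(** This makes v -> v m0 a map of parabolic modules, so that a (x) v -> v a m0, encoded by [geval],
    respects the balancing relation. *)
Lemma parab_m0 b (v : V1) : aact M (emb b) (v *: m0) = (aact V1 b v : K) *: m0.
Proof.
elim/pclassW: b v => t; elim: t => [x|d|s IHs t IHt|s IHs t IHt] v.
- rewrite [emb _]palg_liftE -[teval _ _]/(HeckeT q (val x)) aactZr root_moduleT
  Rk_m0 scalerA mulrC.
  congr (_ *: _); apply/esym.
  exact: (@lift_actE K (hecke_pres q (@parab_pos r lam)) K^o _ (onedimP cP) (Var x)).
- by rewrite palg_cstE linearZ rmorph1 !aactZl !aact1 scalerA.
- by rewrite -palg_addE raddfD !aactDl IHs IHt -scalerDl.
- by rewrite -palg_mulE rmorphM !aactM IHt IHs.
Qed.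

Fixpoint geval (t : tensor_term H V1 K) : M :=
  match t with
  | Tens a v => (v : K) *: aact M a m0
  | TZero => 0
  | TAdd s u => geval s + geval u
  | TScale k s => k *: geval s
  end.

Lemma geval_teq s t : teq emb s t -> geval s = geval t.
Proof.
elim=> {s t} //=.
- by move=> s t u _ -> _ ->.
- by move=> s s' t t' _ -> _ ->.
- by move=> k t t' _ ->.
- by move=> s t u; rewrite addrA.
- by move=> s t; rewrite addrC.
- by move=> t; rewrite add0r.
- by move=> t; rewrite scaleN1r addNr.
- by move=> k d t; rewrite scalerA.
- by move=> t; rewrite scale1r.
- by move=> k s t; rewrite scalerDr.
- by move=> k d t; rewrite scalerDl.
- by move=> a a' v; rewrite aactDl scalerDr.
- by move=> a v v'; rewrite scalerDl.
- by move=> k a v; rewrite aactZl !scalerA mulrC.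
- by move=> k a v; rewrite scalerA.
- by move=> a b v; rewrite aactM -(@aactZr _ _ M v a) -(@aactZr _ _ M v (emb b))
  parab_m0 (@aactZr _ _ M _ a).
Qed.

Definition ext_to_root (e : E) : M := geval (trepr e).
Local Notation g := ext_to_root.

Lemma ext_to_root_tclass t : g (tclass emb t) = geval t.
Proof. exact/geval_teq/trepr_eqv. Qed.

Lemma ext_to_rootD e e' : g (e + e') = g e + g e'.
Proof.
by elim/tclassW: e => s; elim/tclassW: e' => t; rewrite ext_addE !ext_to_root_tclass.
Qed.

Lemma ext_to_rootZ k e : g (k *: e) = k *: g e.
Proof. by elim/tclassW: e => s; rewrite ext_scaleE !ext_to_root_tclass. Qed.

Lemma ext_to_root_act x e : g (aact E x e) = aact M x (g e).
Proof.
elim/tclassW: e => t; rewrite [aact E x _]ext_actE !ext_to_root_tclass.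
elim: t => [a v||s IHs t IHt|k s IHs] /=.
- by rewrite aactZr aactM.
- by rewrite aact0.
- by rewrite aactDr IHs IHt.
- by rewrite aactZr IHs.
Qed.

Lemma tensDl a a' v : tns (a + a') v = tns a v + tns a' v.
Proof. by rewrite ext_addE; apply/tclassP/teq_tensDl. Qed.

Lemma tensZl k a v : tns (k *: a) v = k *: tns a v.
Proof. by rewrite ext_scaleE; apply/tclassP/teq_tensZl. Qed.

Lemma tensZr k a (v : V1) : tns a (k *: v) = k *: tns a v.
Proof. by rewrite ext_scaleE; apply/tclassP/teq_tensZr. Qed.

Lemma act_tens x a v : aact E x (tns a v) = tns (x * a) v.
Proof. exact: ext_actE. Qed.

Lemma tens_hw (w : seq nat) a (v : V1) :
    {in w, forall i, (i.+1 < r)%N /\ reshape_index lam i = reshape_index lam i.+1} ->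
  tns (a * hw w) v = c ^+ size w *: tns a v.
Proof.
elim: w a => [|i w IHw] a wP; first by rewrite hw_nil mulr1 expr0 scale1r.
rewrite hw_cons mulrA IHw => [|j jw]; last by apply: wP; rewrite inE jw orbT.
have [ir iE] := wP i (mem_head _ _); have {}ir : (i < r.-1)%N by lia.
have iP : reshape_index lam (Ordinal ir) == reshape_index lam (Ordinal ir).+1 by
  apply/eqP.
pose x : parab_gen r lam := exist _ (Ordinal ir) iP.
pose y : Parabolic q r lam := @palg_gen K (hecke_pres q (@parab_pos r lam)) x.
have -> : hT q r i = emb y.
  by rewrite [RHS]palg_liftE /hT insubT.
have -> : tns (a * emb y) v = tns a (c *: v).
  apply/tclassP; apply: teq_trans (teq_balanced _ _ _ _) _.
  have -> : aact V1 y v = c *: v; last exact: teq_refl.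
  exact: (@lift_actE K (hecke_pres q (@parab_pos r lam)) K^o _ (onedimP cP) (Var x)).
by rewrite tensZr scalerA -exprSr.
Qed.

Lemma sum_m0 (U : lmodType K) (F : seq nat -> U) :
  \sum_(w <- cwords r) (aact M (hw (rev w)) m0 J0 : K) *: F w
  = \sum_(w <- blockwords lam) c ^+ size w *: F w.
Proof.
have := sum_ecoef_blocks c F size_enum_lam (@enum_ord_pairwise l).
rewrite sumn_lam -J0E => <-; apply: eq_big_seq => w wr; congr (_ *: _).
by rewrite root_module_ket // => i; rewrite mem_rev; apply: cwords_ltn wr.
Qed.

(* H-linear by the Casimir identity, and inverse to [ext_to_root] up to the nonzero
   factor [norm_m0]: no coset representatives are needed to find a basis of [E]. *)
Definition root_to_ext (m : M) : E :=
  \sum_(w <- cwords r) (aact M (hw (rev w)) m J0 : K) *: tns (hw w) 1.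
Local Notation f := root_to_ext.

Lemma root_to_extD m m' : f (m + m') = f m + f m'.
Proof.
by rewrite /f -big_split; apply: eq_bigr => w _; rewrite aactDr ffunE scalerDl.
Qed.

Lemma root_to_extZ k m : f (k *: m) = k *: f m.
Proof.
rewrite /f scaler_sumr; apply: eq_bigr => w _.
by rewrite aactZr ffunE scalerA.
Qed.

Lemma root_to_ext0 : f 0 = 0.
Proof. by rewrite -(scale0r 0) root_to_extZ scale0r. Qed.

Lemma root_to_ext_hT k m : f (aact M (HeckeT q k) m) = aact E (HeckeT q k) (f m).
Proof.
have kr : (k.+1 < r)%N := ltn_pred_ordS k.
have kE : HeckeT q k = hw [:: val k].
  by rewrite hw_cons hw_nil mulr1 /hT valK.
have wk : {in [:: val k], forall i, i.+1 < r}%N by move=> i; rewrite inE => /eqP->.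
pose B a b : ext emb V1 := (aact M b m J0 : K) *: tns a 1.
have Bb : balanced B.
  split=> [a a' b|a b b'|k' a b]; rewrite /B.
  - by rewrite tensDl scalerDr.
  - by rewrite aactDl ffunE scalerDl.
  - by rewrite tensZl aactZl ffunE !scalerA mulrC.
rewrite kE /f aact_sumr; under [in RHS]eq_bigr do rewrite aactZr act_tens.
have := casimir_flip q0 wk Bb; rewrite /B => ->; apply: eq_bigr => w _.
by rewrite aactM.
Qed.

Lemma root_to_ext_act a m : f (aact M a m) = aact E a (f m).
Proof.
elim/pclassW: a m => t; elim: t => [k|d|s IHs t IHt|s IHs t IHt] m.
- exact: root_to_ext_hT.
- by rewrite palg_cstE !aactZl !aact1 root_to_extZ.
- by rewrite -palg_addE !aactDl root_to_extD IHs IHt.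
- by rewrite -palg_mulE !aactM IHs IHt.
Qed.

(** One factor c^l(w) is the coefficient <J0|T_w^tau|J0>, the other comes from T_w (x) 1 = c^l(w) (1
    (x) 1). *)
Definition norm_m0 : K := \sum_(w <- blockwords lam) (c ^+ 2) ^+ size w.
Local Notation N := norm_m0.

Lemma norm_m0_neq0 : N != 0.
Proof. exact: sum_blockwords_exp. Qed.

Lemma root_to_ext_m0 : f m0 = N *: tns 1 1.
Proof.
rewrite /f sum_m0 /N scaler_suml; apply: eq_big_seq => w wl.
rewrite -[hw w]mul1r tens_hw => [|i iw]; last first.
  by have := mem_blockwords wl iw; rewrite sumn_lam.
by rewrite scalerA -exprM mul2n -addnn exprD.
Qed.

Lemma ext_to_root_to_ext e : f (g e) = N *: e.
Proof.
elim/tclassW: e; elim=> [a v||s IHs t IHt|k s IHs].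
- rewrite ext_to_root_tclass /= root_to_extZ root_to_ext_act root_to_ext_m0 aactZr
  act_tens mulr1 scalerA mulrC -scalerA.
  by rewrite -tensZr /GRing.scale /= mulr1.
- by rewrite ext_to_root_tclass root_to_ext0 [tclass _ _](_ : _ = 0) // scaler0.
- by rewrite -ext_addE ext_to_rootD root_to_extD IHs IHt scalerDr.
- by rewrite -ext_scaleE ext_to_rootZ root_to_extZ IHs !scalerA mulrC.
Qed.

Variable s : r.-tuple 'I_l -> seq nat.
Hypothesis sP : forall J : r.-tuple 'I_l, perm_eq J J0 ->
  [/\ {in s J, forall i, i.+1 < r}%N,
      forall Phi : seq 'I_l -> K^o, lopw c (rev (s J)) Phi J0 = Phi J
    & forall L, lopw c (s J) (delta K J0) L = delta K J L].

Lemma act_sorting (J : r.-tuple 'I_l) : perm_eq J J0 -> aact M (hw (s J)) m0 = ket K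
  J.
Proof.
move=> /sP[sr _ sJ]; apply/ffunP => L.
by rewrite root_module_ket // sJ ffunE.
Qed.

Lemma act_rev_sorting (J : r.-tuple 'I_l) m : perm_eq J J0 -> aact M (hw (rev (s
  J))) m J0 = m J.
Proof.
(* [lopw] acts on functions of all words, so m is extended by 0 to words of other lengths. *)
move=> /sP[sr sJ _]; pose Phi L : K^o := if insub L is Some t then m t else 0.
have PhiE (t : r.-tuple 'I_l) : m t = Phi t by rewrite /Phi valK.
by rewrite (root_module_hw (Phi := Phi)) // => [|i]; rewrite ?sJ // mem_rev;
  apply: sr.
Qed.

Lemma root_to_ext_ket0 (J : r.-tuple 'I_l) : ~~ perm_eq J J0 -> f (ket K J) = 0.
Proof.
move=> JJ; rewrite /f big_seq big1 // => w wr; rewrite root_module_content ?scale0r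
  //.
by move=> i; rewrite mem_rev; apply: cwords_ltn wr.
Qed.

Lemma root_to_ext_to_root_ket (J : r.-tuple 'I_l) : perm_eq J J0 -> g (f (ket K J))
  = N *: ket K J.
Proof.
move=> JJ; rewrite -(act_sorting JJ) root_to_ext_act root_to_ext_m0 ext_to_root_act
  ext_to_rootZ aactZr; congr (_ *: aact M _ _).
by rewrite ext_to_root_tclass /= aact1 scale1r.
Qed.

Local Notation P := [pred J : r.-tuple 'I_l | perm_eq J J0].
Definition ext_basis (i : 'I_#|P|) : E := N^-1 *: f (ket K (enum_val i)).

Lemma root_to_ext_expand m : N^-1 *: f m = \sum_i (m (enum_val i) : K) *: ext_basis i.
Proof.
have mE : m = \sum_J (m J : K) *: ket K J.
  apply/ffunP => L; rewrite sum_ffunE (bigD1 L) //= !ffunE eqxx /GRing.scale /= mulr1.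
  by rewrite big1 ?addr0 // => J /negPf JL; rewrite !ffunE eq_sym JL; apply: mulr0.
rewrite -(big_enum_val (fun J => (m J : K) *: (N^-1 *: f (ket K J)))) /=.
rewrite [f m in LHS](_ : _ = \sum_J (m J : K) *: f (ket K J)).
  rewrite scaler_sumr (bigID P) /= [X in _ + X]big1 ?addr0 => [|J JJ].
    by apply: eq_bigr => J _; rewrite !scalerA mulrC.
  by rewrite root_to_ext_ket0 ?scaler0.
rewrite {1}mE (big_morph f root_to_extD root_to_ext0); apply: eq_bigr => J _;
  exact: root_to_extZ.
Qed.

(** The maps f / N and g are mutually inverse between E and the span of the kets of content J0. *)
Lemma ext_basisP : is_basis ext_basis.
Proof.
have N0 := norm_m0_neq0.
move=> v; exists [ffun i => g v (enum_val i)]; split.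
  under eq_bigr do rewrite ffunE.
  by rewrite -root_to_ext_expand ext_to_root_to_ext scalerA mulVf // scale1r.
move=> d ->; apply/ffunP => i; rewrite ffunE.
have g0 : g 0 = 0 by rewrite -(scale0r 0) ext_to_rootZ scale0r.
have gb j : g (ext_basis j) = ket K (enum_val j).
  by rewrite ext_to_rootZ root_to_ext_to_root_ket ?scalerA ?mulVf ?scale1r //;
    apply: (enum_valP j).
rewrite (big_morph g ext_to_rootD g0) sum_ffunE (bigD1 i) //= big1 ?addr0 => [|j ji].
  by rewrite ext_to_rootZ gb !ffunE eqxx; apply: mulr1.
by rewrite ext_to_rootZ gb !ffunE (inj_eq enum_val_inj) eq_sym (negPf ji);
  apply: mulr0.
Qed.

Lemma trace_ext (w : seq nat) :
  trace (aact E (hw w)) = \sum_(J : r.-tuple 'I_l | perm_eq J J0) aact M (hw w) (ket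
    K J) J.
Proof.
apply: traceE; first exact: aact_linear.
exists #|P|, ext_basis.
exists (\matrix_(i, j) aact M (hw w) (ket K (enum_val j)) (enum_val i)); split.
- exact: ext_basisP.
- move=> j; rewrite /ext_basis aactZr -root_to_ext_act root_to_ext_expand;
  apply: eq_bigr => i _.
  by rewrite mxE.
- rewrite /mxtrace; under [in RHS]eq_bigr do rewrite mxE.
  by rewrite -(big_enum_val (fun J : r.-tuple 'I_l => aact M (hw w) (ket K J) J)).
Qed.

Lemma character_ext :
  character E = \sum_(J : r.-tuple 'I_l | perm_eq J J0) hw (s J) *
    (\sum_(w <- blockwords lam) c ^+ size w *: hw w) * hw (rev (s J)).
Proof.
rewrite character_cwords; under eq_bigr do rewrite trace_ext scaler_suml.
rewrite exchange_big; apply: eq_bigr => J JJ.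
have [sr _ _] := sP JJ.
have rsr : {in rev (s J), forall i, i.+1 < r}%N by move=> i; rewrite mem_rev;
  apply: sr.
pose B a b : H := (aact M (hw (rev (s J)) * b) m0 J0 : K) *: a.
have Bb : balanced B.
  split=> [a a' b|a b b'|k a b]; rewrite /B.
  - by rewrite scalerDr.
  - by rewrite mulrDr aactDl ffunE scalerDl.
  - by rewrite -scalerAr aactZl ffunE !scalerA mulrC.
pose B' a b : H := (aact M b m0 J0 : K) *: (hw (s J) * a).
have B'b : balanced B'.
  split=> [a a' b|a b b'|k a b]; rewrite /B'.
  - by rewrite mulrDr scalerDr.
  - by rewrite aactDl ffunE scalerDl.
  - by rewrite -scalerAr aactZl ffunE !scalerA mulrC.
(* <J|T_w^tau|J> = <J0|T_(s J)^tau T_w^tau T_(s J)|J0>; two Casimir moves take T_(s J) and its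
   reversal out of the coefficient to the two sides of T_w. *)
transitivity (\sum_(w <- cwords r) B (hw w) (hw (rev w) * hw (s J))).
  apply: eq_bigr => w _; rewrite /B -[in LHS](act_sorting JJ) -(act_rev_sorting _ JJ).
  by rewrite !aactM.
rewrite -(casimir_flip q0 sr Bb).
transitivity (\sum_(w <- cwords r) B' (hw w) (hw (rev (s J)) * hw (rev w))) => //.
rewrite -(casimir q0 rsr B'b) /B' sum_m0 mulr_sumr mulr_suml.
by apply: eq_bigr => w _; rewrite -scalerAr -scalerAl mulrA.
Qed.

End InducedCharacter.

(** * Immanants of induced characters *)

Lemma count_blocks l (s : seq 'I_l) lam : uniq s -> size s = size lam ->
  [seq count_mem x (blocks s lam) | x <- s] = lam.
Proof.
rewrite /blocks; elim: s lam => [|x s IHs] [|b lam] //= /andP[xs us] [sl].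
have := mem_blocks (s := s) (lam := lam) (x := x); rewrite /blocks => xb.
rewrite count_cat count_nseq /= eqxx mul1n.
rewrite (count_memPn (contra xb xs)) addn0; congr (_ :: _).
rewrite -[RHS](IHs _ us sl); apply/eq_in_map => y ys.
rewrite count_cat count_nseq /= (_ : x == y = false) ?mul0n //.
by apply: contraNF xs => /eqP->.
Qed.

Lemma prodr_eq0 (A : pzRingType) (T : eqType) (s : seq T) (F : T -> A) x :
  x \in s -> F x = 0 -> \prod_(y <- s) F y = 0.
Proof.
elim: s => // y s IHs; rewrite inE big_cons => /orP[/eqP<- ->|xs Fx].
  by rewrite mul0r.
by rewrite IHs // mulr0.
Qed.

Lemma not_uniq_adjacent n (S : seq 'I_n) :
    pairwise (fun i j : 'I_n => i <= j)%N S -> ~~ uniq S ->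
  exists A x B, S = A ++ x :: x :: B.
Proof.
elim: S => //= x S IHS /andP[xS Ss]; rewrite negb_and negbK => /orP[|uS]; last first.
  by have [A [y [B ->]]] := IHS Ss uS; exists (x :: A), y, B.
case: S xS Ss {IHS} => // y S /= /andP[xy _] /andP[yS _];
  rewrite inE => /orP[/eqP->|xS'].
  by exists [::], y, S.
exists [::], x, S; congr (_ :: _ :: _); apply/val_inj/eqP.
by rewrite eqn_leq xy (allP yS).
Qed.

(** * Immanants of a single block *)

Section BlockImmanants.
Variables (K : fieldType) (q c : K) (q0 : q != 0) (cP : (c - q) * (c + q^-1) = 0).
Variables (n m : nat).

Lemma Imm_onedim (S : m.-tuple 'I_n) :
  Imm q0 (character (lift_module (@onedimP K q 'I_m.-1 (@nat_of_ord m.-1) c cP))) S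
  = block_imm q c S.
Proof.
rewrite character_onedim // Imm_sum /block_imm size_tuple; apply: eq_big_seq => w wm.
by rewrite ImmZ Imm_hw // => i; apply: cwords_ltn wm.
Qed.

(** Casimir for the scalar by which the one-dimensional module acts: T_i moves into that scalar and
    becomes c. *)
Lemma hT_symmetrizer i : (i.+1 < m)%N ->
  hT q m i * (\sum_(w <- cwords m) c ^+ size w *: hw q m w)
  = c *: \sum_(w <- cwords m) c ^+ size w *: hw q m w.
Proof.
move=> im; pose V := lift_module (@onedimP K q 'I_m.-1 (@nat_of_ord m.-1) c cP).
pose B a b : Hecke q m := (aact V b 1 : K) *: a.
have Bb : balanced B.
  split=> [a a' b|a b b'|k a b]; rewrite /B.
  - by rewrite scalerDr.
  - by rewrite aactDl scalerDl.
  - by rewrite aactZl !scalerA mulrC.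
have im' : {in [:: i], forall i, i.+1 < m}%N by move=> j; rewrite inE => /eqP->.
have aE w : w \in cwords m -> aact V (hw q m (rev w)) 1 = c ^+ size w.
  move=> wm; rewrite onedim_hw ?size_rev; first exact: mulr1.
  by move=> j; rewrite mem_rev; apply: cwords_ltn wm.
have ai v : aact V (hw q m [:: i]) v = c *: v by rewrite onedim_hw ?expr1.
transitivity (\sum_(w <- cwords m) B (hw q m [:: i] * hw q m w) (hw q m (rev w))).
  rewrite mulr_sumr; apply: eq_big_seq => w wm.
  by rewrite /B aE // hw_cons hw_nil mulr1 scalerAr.
rewrite (casimir_flip q0 im' Bb) scaler_sumr; apply: eq_big_seq => w wm.
by rewrite /B aactM ai aactZr aE // scalerA.
Qed.

(** At an adjacent repeated letter <S|T_i = q <S|, whereas T_i multiplies the symmetrizer by c;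
    hence q - c kills the immanant. *)
Lemma block_imm_eq0 (S : m.-tuple 'I_n) : c != q ->
  pairwise (fun i j : 'I_n => i <= j)%N S -> ~~ uniq S -> block_imm q c S = 0.
Proof.
move=> cq Ss uS; have [A [x [B SE]]] := not_uniq_adjacent Ss uS.
have im : ((size A).+1 < m)%N.
  by rewrite -(size_tuple S) SE size_cat /=; lia.
have := congr1 (fun h => Imm q0 h S) (hT_symmetrizer im).
rewrite mulr_sumr ImmZ !Imm_sum /= => E.
have wE w : w \in cwords m -> Imm q0 (hw q m w) S = lopw q w (Xw q S) S.
  by move=> wm; rewrite Imm_hw // => i; apply: cwords_ltn wm.
have bE : \sum_(w <- cwords m) Imm q0 (c ^+ size w *: hw q m w) S = block_imm q c S.
  by rewrite /block_imm size_tuple; apply: eq_big_seq => w wm; rewrite ImmZ wE.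
rewrite bE in E; have : q *: block_imm q c S = c *: block_imm q c S.
  rewrite -E -bE scaler_sumr; apply: eq_big_seq => w wm.
  have Aw : {in size A :: w, forall i, i.+1 < m}%N.
    by move=> i; rewrite inE => /orP[/eqP->//|]; apply: cwords_ltn wm.
  rewrite -scalerAr !ImmZ -hw_cons (Imm_hw q0 S Aw) wE //= scalerA mulrC -scalerA;
    congr (_ *: _).
  by have := lop_at q A x x B (lopw q w (Xw q S)); rewrite eqxx -SE.
move/eqP; rewrite -subr_eq0 -scalerBl scaler_eq0 subr_eq0 eq_sym (negPf cq).
by move=> /eqP.
Qed.

End BlockImmanants.

(** * Both induced characters *)

Section Main.
Variables (K : fieldType) (q c : K) (q0 : q != 0) (cP : (c - q) * (c + q^-1) = 0).
Hypothesis qP : forall k, (0 < k)%N -> q ^+ k != 1.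

Lemma root_exp_neq1 k : (0 < k)%N -> (c ^+ 2) ^+ k != 1.
Proof.
move=> k0; rewrite -exprM; have k20 : (0 < 2 * k)%N by rewrite muln_gt0.
have /eqP := cP; rewrite mulf_eq0 subr_eq0 addr_eq0 => /orP[]/eqP->.
  exact: qP.
by rewrite mulnC exprM -exprM mulnC exprM sqrrN -exprM exprVn invr_eq1 qP.
Qed.

Lemma Imm_ext (n r l : nat) (I : r.-tuple 'I_n) (lam : l.-tuple nat) :
    nondecr_seq I -> sumn lam = r ->
  Imm q0 (character (ext_module (parab_emb q r lam)
    (lift_module (@onedimP K q (parab_gen r lam) (@parab_pos r lam) c cP)))) I
  = \sum_(S : tuples_of_shape n lam | is_splitting I S)
      (mq2 q I / \prod_(j < l) mq2 q (S j)) *: \prod_(j < l) block_imm q c (S j).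
Proof.
move=> I_nd lamr; have leT_trans k : transitive (fun i j : 'I_k => i <= j)%N.
  by move=> x y z; apply: leq_trans.
have leT_anti k : antisymmetric (fun i j : 'I_k => i <= j)%N.
  by move=> x y xy; apply/val_inj/eqP; rewrite eqn_leq.
have Is : pairwise (fun i j : 'I_n => i <= j)%N I by rewrite -sorted_pairwise.
have sl : size (enum 'I_l) = size lam by rewrite size_enum_ord size_tuple.
have J0s : size (blocks (enum 'I_l) lam) == r by rewrite size_blocks ?lamr.
pose J0 : r.-tuple 'I_l := Tuple J0s.
have J0c j : count_mem j J0 = tnth lam j.
  have := count_blocks (enum_uniq 'I_l) sl.
  move=> /(congr1 (nth 0%N ^~ j)); rewrite (nth_map j) ?size_enum_ord // nth_ord_enum.
  by rewrite -tnth_nth.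
have /choice[s /choice[u su]] : forall J : r.-tuple 'I_l, exists w, exists u',
    sorts (zip I J) w (inversions (zip I J)) u'
    /\ pairwise (fun a b : 'I_n * 'I_l => a.2 <= b.2)%N u'.
  move=> J; apply: sorts_exists; rewrite -(pairwise_map fst (fun i j : 'I_n => i <=
    j)%N).
  by rewrite -/(unzip1 _) unzip1_zip ?size_tuple.
have z1 (J : r.-tuple 'I_l) : map fst (zip I J) = I by rewrite -/(unzip1 _)
  unzip1_zip ?size_tuple.
have z2 (J : r.-tuple 'I_l) : map snd (zip I J) = J by rewrite -/(unzip2 _)
  unzip2_zip ?size_tuple.
have u2 (J : r.-tuple 'I_l) : perm_eq J J0 -> map snd (u J) = J0.
  move=> JJ; have [us u's] := su J; apply: (pairwise_eq (@leT_anti l)).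
  - by rewrite pairwise_map.
  - exact: blocks_pairwise sl (enum_ord_pairwise l).
  - by rewrite (perm_trans _ JJ) // perm_sym -{1}(z2 J) perm_map // (sorts_perm us).
have u1 (J : r.-tuple 'I_l) : map fst (u J) = flatten [seq fiber I J j | j <- enum
  'I_l].
  have [us u's] := su J.
  rewrite (sorted_flatten u's (enum_ord_pairwise l)) => [|p _];
    last by rewrite mem_enum.
  rewrite map_flatten -map_comp; congr flatten; apply: eq_map => j /=.
  by rewrite (sorts_filter j us).
have fib_perm (J : r.-tuple 'I_l) : perm_eq (flatten [seq fiber I J j | j <- enum
  'I_l]) I.
  by rewrite -u1 perm_sym -{1}(z1 J) perm_map // (sorts_perm (su J).1).
have fib_size (J : r.-tuple 'I_l) j : size (fiber I J j) = count_mem j J.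
  by rewrite size_map size_filter -{2}(z2 J) count_map.
have sJP (J : r.-tuple 'I_l) : perm_eq J J0 ->
  [/\ {in s J, forall i, i.+1 < r}%N,
      forall Phi : seq 'I_l -> K^o, lopw c (rev (s J)) Phi J0 = Phi J
    & forall L, lopw c (s J) (delta K J0) L = delta K J L].
  move=> JJ; have [us _] := su J; split=> [i si|Phi|L].
  - by have := sorts_lt us si; rewrite size_zip !size_tuple minnn.
  - by rewrite -(u2 J JJ) (sorts_snd c Phi us) z2.
  - by rewrite -(u2 J JJ) (sorts_delta c L us) z2.
rewrite (character_ext q0 cP root_exp_neq1 (J0 := J0) erefl sJP) Imm_sum.
(* The base is q^2 because rows ([sorts_fst]) and columns ([sorts_Xw]) each give q to the number of
   inversions. *)
pose F (J : r.-tuple 'I_l) : Aq q n :=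
  (q ^+ 2) ^+ inversions (zip I J) *: \prod_(j < l) block_imm q c (fiber I J j).
transitivity (\sum_(J : r.-tuple 'I_l | perm_eq J J0) F J).
  apply: eq_bigr => J JJ; have [us _] := su J; have [sr _ _] := sJP J JJ.
  have lamE : map size [seq fiber I J j | j <- enum 'I_l] = lam.
    rewrite -map_comp -[RHS](map_tnth_enum lam); apply: eq_map => j /=.
    by rewrite fib_size -J0c; apply/seq.permP.
  rewrite mulr_sumr mulr_suml Imm_sum /F.
  have -> : \prod_(j < l) block_imm q c (fiber I J j)
      = \prod_(S <- [seq fiber I J j | j <- enum 'I_l]) block_imm q c S.
    by rewrite [RHS]big_map enumT.
  rewrite -block_imm_flatten lamE scaler_sumr.
  apply: eq_big_seq => w wl; rewrite -scalerAr -scalerAl ImmZ -!hw_cat Imm_hw;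
    last first.
    move=> i; rewrite !mem_cat mem_rev => /orP[/orP[/sr//|iw]|/sr//].
    by have [] := mem_blockwords wl iw; rewrite lamr.
  rewrite scalerA [_ * c ^+ _]mulrC -scalerA; congr (_ *: _).
  rewrite !lopw_cat; have := sorts_fst q (lopw q w (lopw q (rev (s J)) (Xw q I))) us.
  rewrite z1 u1 => ->; have Xs L : perm_eq L (flatten [seq fiber I J j | j <- enum
    'I_l]) ->
      lopw q (rev (s J)) (Xw q I) L = q ^+ inversions (zip I J)
        *: Xw q (flatten [seq fiber I J j | j <- enum 'I_l]) L.
    move=> LI; have := sorts_Xw q (L := L) us; rewrite z1 u1 => -> //.
    by rewrite (perm_size (perm_trans LI (fib_perm J))) size_zip !size_tuple minnn.
  by rewrite (eq_lopw _ _ Xs) lopwZ scalerA -exprD addnn -mul2n exprM.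
(* Each J of content lam determines exactly one splitting, its fibers, so the sum over J can be
   grouped by splittings. *)
pose Sof (J : r.-tuple 'I_l) (S : tuples_of_shape n lam) :=
  [forall j, fiber I J j == tval (S j)].
have q2P k : (0 < k)%N -> (q ^+ 2) ^+ k != 1 by move=> k0;
  rewrite -exprM qP ?muln_gt0.
transitivity (\sum_(S : tuples_of_shape n lam | is_splitting I S)
    \sum_(J : r.-tuple 'I_l | Sof J S) F J); last first.
  apply: eq_bigr => S /andP[/forallP Ss SI].
  rewrite -[mq2 q I / _](sum_fibers q2P (S := fun j => tval (S j))) //; last first.
    by move=> j; rewrite -sorted_pairwise //; apply: Ss.
  rewrite scaler_suml; apply: eq_bigr => J /forallP JS; congr (_ *: _).
  by apply: eq_bigr => j _; rewrite (eqP (JS j)).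
rewrite (exchange_big_dep (fun J : r.-tuple 'I_l => perm_eq J J0)) /=; last first.
  move=> S J _ /forallP JS; apply/allP => j _ /=; apply/eqP.
  by rewrite J0c -fib_size (eqP (JS j)) size_tuple.
apply: eq_bigr => J JJ.
have fs j : size (fiber I J j) == tnth lam j.
  by rewrite fib_size -J0c; apply/eqP/seq.permP.
pose SJ : tuples_of_shape n lam := [ffun j => Tuple (fs j)].
rewrite (big_pred1 SJ) // => S; apply/andP/eqP => [[_ /forallP JS]|->].
  by apply/ffunP => j; rewrite ffunE; apply: val_inj; rewrite /= (eqP (JS j)).
have SJE j : tval (SJ j) = fiber I J j by rewrite ffunE.
split; last by apply/forallP => j; rewrite SJE.
apply/andP; split.
  apply/forallP => j; rewrite SJE /nondecr_seq sorted_pairwise //.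
  rewrite /fiber pairwise_map pairwise_filter //.
  by rewrite -(pairwise_map fst (fun i j : 'I_n => i <= j)%N) z1.
rewrite -[X in perm_eq X _](_ : flatten [seq fiber I J j | j <- enum 'I_l] = _) //.
by congr flatten; apply: eq_map => j; rewrite SJE.
Qed.

End Main.

(* The factor [mq2 q I] of the first identity equals 1 when I has no repeated
   entry; without it the identity fails for I = (1,1), lam = (1,1). *)
Theorem corollary4p4 (R : realType) (q : complex R) (q_neq0 : q != 0)
    (q_not_root_of_unity : forall k : nat, (0 < k)%N -> q ^+ k != 1)
    (n r l : nat) (I : r.-tuple 'I_n) (I_nondecreasing : nondecr_seq I)
    (lam : l.-tuple nat) (lam_partition : is_partition r lam) :
  Imm q_neq0 (psi q r lam) I =
    mq2 q I *:
    \sum_(J : tuples_of_shape n lam | is_splitting I J)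
      \prod_(j < l) qdet q_neq0 (J j)
  /\
  Imm q_neq0 (phi q r lam) I =
    \sum_(J : tuples_of_shape n lam | is_splitting I J)
      (mq2 q I / \prod_(j < l) mq2 q (J j)) *:
      \prod_(j < l) qper q_neq0 (J j).
Proof.
have lamr : sumn lam = r by case/and3P: lam_partition => _ _ /eqP.
split; last first.
  rewrite [LHS](Imm_ext q_neq0 (triv_quad q) q_not_root_of_unity I_nondecreasing
    lamr).
  apply: eq_bigr => S _; congr (_ *: _); apply: eq_bigr => j _.
  exact/esym/(Imm_onedim q_neq0 (triv_quad q)).
rewrite [LHS](Imm_ext q_neq0 (sign_quad q) q_not_root_of_unity I_nondecreasing lamr).
rewrite scaler_sumr; apply: eq_bigr => S /andP[/forallP Ss _].
have qdetE j : qdet q_neq0 (S j) = block_imm q (- q^-1) (S j).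
  exact: (Imm_onedim q_neq0 (sign_quad q)).
under [in RHS]eq_bigr do rewrite qdetE.
have q2 : q ^+ 2 != 1 by apply: q_not_root_of_unity.
(* Blocks without repetition have [mq2] equal to 1, so only [mq2 q I] remains; a repetition in some
   block kills the term on both sides. *)
case: (boolP [forall j, uniq (S j)]) => [/forallP uS|].
  rewrite (_ : \prod_(j < l) mq2 q (S j) = 1) ?divr1 // big1 // => j _.
  rewrite /mq2 big1 // => i _; rewrite (count_uniq_mem i (uS j)) /qfact.
  case: (i \in _); last by rewrite big_geq.
  by rewrite big_nat1 /qnat expr1 divff // subr_eq0.
rewrite negb_forall => /existsP[j uS].
suff -> : \prod_(j < l) block_imm q (- q^-1) (S j) = 0 by rewrite !scaler0.
apply: (@prodr_eq0 _ _ _ _ j); first exact: mem_index_enum.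
apply: (block_imm_eq0 q_neq0 (sign_quad q)) => //; last first.
  rewrite -sorted_pairwise; last by move=> x y z; apply: leq_trans.
  exact: Ss.
(* -1/q = q would give q^2 = -1, hence q^4 = 1. *)
apply/eqP => qq; have := q_not_root_of_unity 4%N isT.
have qq1 : q ^+ 2 = - 1 by rewrite expr2 -{1}qq mulNr mulVf.
by rewrite (exprM q 2 2) qq1 sqrrN expr1n eqxx.
Qed.
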